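(* Let $P$ be any property (i.e. set) of binary trees and let $X_n^P$ be the number of subtrees of the random binary search tree $\mathcal{T}_n$ with this property. Then, as $n\to\infty$, $$\frac{\mathbb{E} X_n^P}{n}\to\mu_P:=\mathbb{P}(\mathcal{T}\in P),\qquad \frac{\mathrm{Var} X_n^P}{n}\to\sigma_P^2:=\lim_{N\to\infty}\sum_{T,T'\in P:\;|T|,|T'|\le N}\sigma_{T,T'}<\infty,$$ and $$\frac{X_n^P-\mathbb{E} X_n^P}{\sqrt n}\xrightarrow{d}\mathcal{N}(0,\sigma_P^2).$$ Similarly, if $P$ is any property (i.e. set) of ordered (or unordered) rooted trees and $\hat X_n^P$ is the number of subtrees of the random recursive tree $\Lambda_n$ with this property, then, as $n\to\infty$, $$\frac{\mathbb{E}\hat X_n^P}{n}\to\hat\mu_P:=\mathbb{P}(\boldsymbol{\Lambda}\in P),\qquad \frac{\mathrm{Var}\hat X_n^P}{n}\to\hat\sigma_P^2:=\lim_{N\to\infty}\sum_{\Lambda,\Lambda'\in P:\;|\Lambda|,|\Lambda'|\le N}\hat\sigma_{\Lambda,\Lambda'}<\infty,$$ and $$\frac{\hat X_n^P-\mathbb{E}\hat X_n^P}{\sqrt n}\xrightarrow{d}\mathcal{N}(0,\hat\sigma_P^2).$$ Furthermore, in the two convergence-in-distribution statements one can replace $\mathbb{E} X_n^P$ by $n\mu_P$ and $\mathbb{E}\hat X_n^P$ by $n\hat\mu_P$, respectively.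
   Context: Random binary search tree $\mathcal{T}_n$: insert the keys of a uniformly random permutation of $\{1,\dots,n\}$ one by one; the first key is placed at the root, and each later key starts at the root and at each occupied node proceeds to the left child position if it is smaller than the key there and to the right child position if it is larger, until it reaches an empty position, where it is placed. It is regarded as an unlabelled binary tree (left and right children distinguished). Random recursive tree $\Lambda_n$: start with a root labelled $1$; for $i=2,\dots,n$, node $i$ is attached as a child of a uniformly random node among $1,\dots,i-1$ (independently of earlier choices). It is regarded as an ordered rooted tree by ordering the children of each node by increasing labels from left to right and then ignoring the labels, or as an unordered rooted tree by ignoring also the ordering. All trees are nonempty; $|T|$ is the number of nodes. ''Subtree'' means fringe subtree (a node together with all its descendants) and ''copy'' means isomorphic (as a binary, ordered or unordered tree, respectively). $\mathcal{N}(0,0)$ is the point mass at $0$. $\mathcal{T}$ denotes the random binary search tree $\mathcal{T}_N$ with random size $N$, $\mathbb{P}(N=k)=\frac{2}{(k+1)(k+2)}$, $k\ge1$; $\boldsymbol\Lambda$ denotes the random recursive tree $\Lambda_N$ with random size $N$, $\mathbb{P}(N=k)=\frac{1}{k(k+1)}$, $k\ge1$. Covariance constants. For binary trees $T,T'$ of sizes $k\ge m$, let $p_{k,T}:=\mathbb{P}(\mathcal{T}_k=T)$, $p_{m,T'}:=\mathbb{P}(\mathcal{T}_m=T')$, let $q^T_{T'}$ be the number of subtrees of $T$ that are copies of $T'$, and $$\sigma_{T,T'}=\sigma_{T',T}:=\tfrac{2}{(k+1)(k+2)}q^T_{T'}p_{k,T}-\beta(k,m)p_{k,T}p_{m,T'},$$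 $$\beta(k,m):=\tfrac{4(k+m+3)}{(k+1)(k+2)(m+1)(m+2)}-\tfrac{4(k^2+3km+m^2+4k+4m+3)}{(k+1)(m+1)(k+m+1)(k+m+2)(k+m+3)}.$$ For ordered (or unordered) rooted trees $\Lambda,\Lambda'$ of sizes $k\ge m$, let $\hat p_{k,\Lambda}:=\mathbb{P}(\Lambda_k=\Lambda)$, $\hat p_{m,\Lambda'}:=\mathbb{P}(\Lambda_m=\Lambda')$, let $\hat q^\Lambda_{\Lambda'}$ be the number of subtrees of $\Lambda$ that are copies of $\Lambda'$, and $$\hat\sigma_{\Lambda,\Lambda'}=\hat\sigma_{\Lambda',\Lambda}:=\tfrac{1}{k(k+1)}\hat q^\Lambda_{\Lambda'}\hat p_{k,\Lambda}-\hat\beta(k,m)\hat p_{k,\Lambda}\hat p_{m,\Lambda'},\qquad \hat\beta(k,m):=\tfrac{k^2+km+m^2+k+m}{k(k+1)m(m+1)(k+m+1)}.$$ *)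

(* Defs.v *)
From Stdlib Require List.
From HB Require Import structures.
From mathcomp Require Import all_boot all_order all_algebra all_fingroup.
From mathcomp Require Import generic_quotient.
From mathcomp Require Import all_classical all_reals all_analysis.

Set Implicit Arguments.
Unset Strict Implicit.
Unset Printing Implicit Defensive.

Import Order.TTheory GRing.Theory Num.Theory.
Import numFieldNormedType.Exports.

Local Open Scope quotient_scope.
Local Open Scope classical_set_scope.
Local Open Scope ring_scope.

(* [BEmpty] is the empty position. The trees considered are the nonempty ones,
   that is, those of positive size. *)
Inductive bintree := BEmpty | BNode of bintree & bintree.

Fixpoint bt_encode (t : bintree) : GenTree.tree unit :=
  if t is BNode l r then GenTree.Node 0 [:: bt_encode l; bt_encode r]
  else GenTree.Leaf tt.

Fixpoint bt_decode (t : GenTree.tree unit) : bintree :=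
  if t is GenTree.Node _ [:: l; r] then BNode (bt_decode l) (bt_decode r)
  else BEmpty.

Lemma bt_encodeK : cancel bt_encode bt_decode.
Proof. by elim=> //= l -> r ->. Qed.

HB.instance Definition _ := Countable.copy bintree (can_type bt_encodeK).

Fixpoint bt_size (t : bintree) : nat :=
  if t is BNode l r then (bt_size l + bt_size r).+1 else 0.

Fixpoint bt_subtrees (t : bintree) : seq bintree :=
  if t is BNode l r then t :: bt_subtrees l ++ bt_subtrees r else [::].

Inductive keytree := KEmpty | KNode of keytree & nat & keytree.

Fixpoint insert_key (x : nat) (t : keytree) : keytree :=
  if t is KNode l y r then
    if (x < y)%N then KNode (insert_key x l) y r else KNode l y (insert_key x r)
  else KNode KEmpty x KEmpty.

Fixpoint forget_keys (t : keytree) : bintree :=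
  if t is KNode l _ r then BNode (forget_keys l) (forget_keys r) else BEmpty.

Definition search_tree (s : seq nat) : bintree :=
  forget_keys (foldl (fun t x => insert_key x t) KEmpty s).

Definition bst n (s : 'S_n) : bintree :=
  search_tree [seq (s i).+1 | i <- enum 'I_n].

Inductive otree := ONode of seq otree.

Definition children (t : otree) : seq otree := let: ONode s := t in s.

Fixpoint otree_nested_ind (Q : otree -> Prop)
    (Qnode : forall s, (forall t, List.In t s -> Q t) -> Q (ONode s))
    (t : otree) : Q t :=
  let: ONode s := t in
  Qnode s ((fix loop s : forall t, List.In t s -> Q t :=
    if s is u :: s' then
      fun t tin => match tin with
        | or_introl e => eq_ind u Q (otree_nested_ind Qnode u) t e
        | or_intror tin' => loop s' t tin'
        end
    else fun t tin => False_ind (Q t) tin) s).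

Fixpoint ot_encode (t : otree) : GenTree.tree unit :=
  let: ONode s := t in GenTree.Node 0 (map ot_encode s).

Fixpoint ot_decode (t : GenTree.tree unit) : otree :=
  if t is GenTree.Node _ s then ONode (map ot_decode s) else ONode [::].

Lemma ot_encodeK : cancel ot_encode ot_decode.
Proof.
elim/otree_nested_ind => s IH /=; congr ONode; rewrite -map_comp.
elim: s IH => //= u s IHs IH; rewrite IH; last by left.
by rewrite IHs // => t tin; apply: IH; right.
Qed.

HB.instance Definition _ := Countable.copy otree (can_type ot_encodeK).

Fixpoint ot_size (t : otree) : nat :=
  let: ONode s := t in (sumn (map ot_size s)).+1.

Fixpoint ot_subtrees (t : otree) : seq otree :=
  let: ONode s := t in t :: flatten (map ot_subtrees s).

Inductive labtree := LNode of nat & seq labtree.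

(* The new node becomes the rightmost child of its parent, so that inserting
   labels in increasing order keeps siblings sorted by label. *)
Fixpoint attach (parent new : nat) (t : labtree) : labtree :=
  let: LNode l s := t in
  if l == parent then LNode l (rcons s (LNode new [::]))
  else LNode l (map (attach parent new) s).

Fixpoint forget_labels (t : labtree) : otree :=
  let: LNode _ s := t in ONode (map forget_labels s).

(* [f i] (with [i] counted from 0) encodes the parent [(f i).+1] of the node
   labelled [i.+2]. A uniformly distributed [f] amounts to independent uniform
   choices of the parents. *)
Definition rrt_choices n := {dffun forall i : 'I_n.-1, 'I_i.+1}.

Definition rrt n (f : rrt_choices n) : otree :=
  forget_labels (foldl (fun t i => attach (f i).+1 i.+2 t) (LNode 1 [::])
                       (enum 'I_n.-1)).

Inductive unordered_iso : otree -> otree -> Prop :=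
  UnorderedIso (s t t' : seq otree) of
    perm_eq t t' & List.Forall2 unordered_iso s t' :
    unordered_iso (ONode s) (ONode t).

Lemma otree_ind_in (Q : otree -> Prop) :
  (forall s, {in s, forall t, Q t} -> Q (ONode s)) -> forall t, Q t.
Proof.
move=> Qnode; elim/otree_nested_ind => s IH; apply: Qnode.
elim: s IH => // u s IHs IH t; rewrite inE => /predU1P[->|ts].
  by apply: IH; left.
by apply: IHs ts => v vin; apply: IH; right.
Qed.

Lemma Forall2_nth (T U : Type) (x0 : T) (y0 : U) (r : T -> U -> Prop) s u :
  List.Forall2 r s u <->
  size s = size u /\
  forall i, (i < size s)%N -> r (nth x0 s i) (nth y0 u i).
Proof.
split.
  elim=> {s u} // x y s u rxy _ [e IH]; split=> [|[|i]] //=; last exact: IH.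
  by rewrite e.
elim: s u => [|x s IH] [|y u] //= [] // [eqsz] rnth.
by constructor; [exact: (rnth 0) | apply: IH; split=> // i; exact: (rnth i.+1)].
Qed.

Lemma Forall2_perm (T U : eqType) (r : T -> U -> Prop) s s' u :
  perm_eq s' s -> List.Forall2 r s u ->
  exists2 u', perm_eq u' u & List.Forall2 r s' u'.
Proof.
case: s => [|x0 s1] s's; first by move: s's => /perm_nilP-> h; exists u.
case: u => [|y0 u1]; first by move=> h; inversion h.
move: s's => /(perm_iotaP x0)[Is pIs ->] /(Forall2_nth x0 y0)[eqsz rnth].
exists (map (nth y0 (y0 :: u1)) Is).
  by apply/(perm_iotaP y0); exists Is => //; rewrite -eqsz.
apply/(Forall2_nth x0 y0); rewrite !size_map; split=> // i iIs.
rewrite !(nth_map 0%N) //; apply: rnth.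
by have := mem_nth 0%N iIs; rewrite (perm_mem pIs) mem_iota add0n.
Qed.

Lemma unordered_isoP s t : unordered_iso (ONode s) (ONode t) <->
  exists2 t', perm_eq t' t & List.Forall2 unordered_iso s t'.
Proof.
split=> [h|[t' tt' st']]; last by apply: UnorderedIso st'; rewrite perm_sym.
by inversion h as [s1 t1 t' tt' st' e1 e2]; exists t'; rewrite // perm_sym.
Qed.

Lemma unordered_iso_refl t : unordered_iso t t.
Proof.
elim/otree_ind_in: t => s IH; apply/unordered_isoP; exists s => //.
apply/(Forall2_nth (ONode [::]) (ONode [::])); split=> // i si.
exact/IH/mem_nth.
Qed.

Lemma unordered_iso_sym t u : unordered_iso t u -> unordered_iso u t.
Proof.
elim/otree_ind_in: t u => s IH [v] /unordered_isoP[v' v'v sv'].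
have v's : List.Forall2 unordered_iso v' s.
  move: sv' => /(Forall2_nth (ONode [::]) (ONode [::]))[eqsz sv'].
  apply/(Forall2_nth (ONode [::]) (ONode [::])); split=> // i iv'.
  by apply: IH; [apply: mem_nth | apply: sv']; rewrite eqsz.
apply/unordered_isoP; apply: Forall2_perm v's; by rewrite perm_sym.
Qed.

Lemma unordered_iso_trans t u v :
  unordered_iso t u -> unordered_iso u v -> unordered_iso t v.
Proof.
elim/otree_ind_in: t u v => s IH [u] [v] /unordered_isoP[u' u'u su'].
move=> /unordered_isoP[v' v'v uv'].
have [w wv' u'w] := Forall2_perm u'u uv'.
apply/unordered_isoP; exists w; first exact: perm_trans v'v.
move: su' u'w => /(Forall2_nth (ONode [::]) (ONode [::]))[sz1 su'].
move=> /(Forall2_nth (ONode [::]) (ONode [::]))[sz2 u'w].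
apply/(Forall2_nth (ONode [::]) (ONode [::])); split=> [|i si].
  by rewrite sz1.
apply: IH (su' i si) _; first exact: mem_nth.
by apply: u'w; rewrite -sz1.
Qed.

Definition unordered_eqv : rel otree := fun t u => `[< unordered_iso t u >].

Lemma unordered_eqv_refl : reflexive unordered_eqv.
Proof. by move=> t; apply/asboolP; exact: unordered_iso_refl. Qed.

Lemma unordered_eqv_sym : symmetric unordered_eqv.
Proof.
by move=> t u; apply/idP/idP => /asboolP h; apply/asboolP; exact: unordered_iso_sym.
Qed.

Lemma unordered_eqv_trans : transitive unordered_eqv.
Proof.
move=> u t v /asboolP tu /asboolP uv; apply/asboolP.
exact: unordered_iso_trans uv.
Qed.

Canonical unordered_equiv :=
  EquivRel unordered_eqv unordered_eqv_refl unordered_eqv_sym unordered_eqv_trans.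

Definition utree := {eq_quot unordered_equiv}.

HB.instance Definition _ := Choice.on utree.

Definition utree_of (t : otree) : utree := \pi_utree t.

Lemma utree_ofP t u : utree_of t = utree_of u <-> unordered_iso t u.
Proof. by split=> [/eqmodP/asboolP//|h]; apply/eqmodP/asboolP. Qed.

(* The choice of representative is irrelevant: see [ut_sizeE], [ut_subtreesE]. *)
Definition ut_size (u : utree) : nat := ot_size (repr u).

Definition ut_subtrees (u : utree) : seq utree :=
  map utree_of (ot_subtrees (repr u)).

Lemma unordered_iso_size t u : unordered_iso t u -> ot_size t = ot_size u.
Proof.
elim/otree_ind_in: t u => s IH [v] /unordered_isoP[v' v'v sv'] /=.
congr _.+1; rewrite -(perm_sumn (perm_map ot_size v'v)); congr sumn.
move: sv' => /(Forall2_nth (ONode [::]) (ONode [::]))[eqsz sv'].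
apply: (@eq_from_nth _ 0%N); rewrite !size_map // => i si.
rewrite !(nth_map (ONode [::])) -?eqsz //.
by apply: IH; [exact: mem_nth | exact: sv'].
Qed.

Lemma unordered_iso_subtrees t u : unordered_iso t u ->
  perm_eq (map utree_of (ot_subtrees t)) (map utree_of (ot_subtrees u)).
Proof.
elim/otree_ind_in: t u => s IH [v] suv.
have /utree_ofP/= -> := suv; rewrite perm_cons.
move/unordered_isoP: suv => [v' v'v sv'].
rewrite !map_flatten -!map_comp.
have /permPr <- : perm_eq
    (flatten [seq map utree_of (ot_subtrees x) | x <- v'])
    (flatten [seq map utree_of (ot_subtrees x) | x <- v]).
  exact/perm_flatten/perm_map.
elim: sv' IH => {s v v' v'v} //= x y s v xy _ IHs IH.
apply: perm_cat; first by apply: IH; rewrite ?mem_head.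
by apply: IHs => z zs; apply: IH; rewrite inE zs orbT.
Qed.

Lemma ut_sizeE t : ut_size (utree_of t) = ot_size t.
Proof. by apply/unordered_iso_size/utree_ofP; rewrite /utree_of reprK. Qed.

Lemma ut_subtreesE t :
  perm_eq (ut_subtrees (utree_of t)) (map utree_of (ot_subtrees t)).
Proof. by apply/unordered_iso_subtrees/utree_ofP; rewrite /utree_of reprK. Qed.

Definition urrt n (f : rrt_choices n) : utree := utree_of (rrt f).

Section UniformProbability.
Variables (R : realType) (Om : finType).
Implicit Types (A : pred Om) (X : Om -> R).

(* [Om] carries the uniform distribution. *)
Definition Pr A : R := #|A|%:R / #|Om|%:R.
Definition Ex X : R := (\sum_w X w) / #|Om|%:R.
Definition Var X : R := Ex (fun w => (X w - Ex X) ^+ 2).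

End UniformProbability.

(* [normal_prob 0 0] is not the point mass at 0. *)
Definition centered_normal (R : realType) (v : R) :
    probability (measurableTypeR R) R :=
  if v == 0 then [the probability _ _ of dirac (0 : measurableTypeR R)]
  else [the probability _ _ of normal_prob 0 (Num.sqrt v)].

Definition cvg_in_law (R : realType) (Om : nat -> finType)
    (Z : forall n, Om n -> R) (mu : probability (measurableTypeR R) R) :=
  forall f : R -> R, continuous f -> (exists B : R, forall x, `|f x| <= B) ->
  Ex (fun w => f (Z n w)) @[n --> \oo] --> \int[mu]_x f x.

Record random_tree := RandomTree {
  tree : choiceType;
  tree_size : tree -> nat;
  subtrees : tree -> seq tree;
  sample : nat -> finType;
  rtree : forall n, sample n -> tree }.

Arguments rtree {r} n _.

Definition BST : random_tree := RandomTree bt_size bt_subtrees bst.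
Definition ordered_RRT : random_tree := RandomTree ot_size ot_subtrees rrt.
Definition unordered_RRT : random_tree := RandomTree ut_size ut_subtrees urrt.

Section FringeSubtrees.
Variables (R : realType) (M : random_tree).
Implicit Types (P : set (tree M)) (T : tree M).

Definition fringe_count P n (w : sample M n) : R :=
  (count (mem P) (subtrees (rtree n w)))%:R.

(* The probability that the random tree with random size [N] is in [P], where
   [pN k] is the probability of [N = k]. *)
Definition mu_lim (pN : nat -> R) P : R :=
  limn (fun K => \sum_(1 <= k < K)
    pN k * Pr R [pred w : sample M k | rtree k w \in P]).

Definition ptree T : R := Pr R [pred w : sample M (tree_size T) | rtree _ w == T].

Definition sigma_ge (pN : nat -> R) (beta : nat -> nat -> R) T T' : R :=
  pN (tree_size T) * (count_mem T' (subtrees T))%:R * ptree T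
  - beta (tree_size T) (tree_size T') * ptree T * ptree T'.

Definition sigma pN beta T T' : R :=
  if (tree_size T' <= tree_size T)%N then sigma_ge pN beta T T'
  else sigma_ge pN beta T' T.

(* [PN] is finite, so these sums have their usual meaning (a [\sum_(_ \in _)]
   with infinite support would be 0). The condition [0 < tree_size T] only
   excludes [BEmpty]. *)
Definition sigma2_partial pN beta P (N : nat) : R :=
  let PN := [set T | P T /\ (0 < tree_size T <= N)%N] in
  \sum_(T \in PN) \sum_(T' \in PN) sigma pN beta T T'.

End FringeSubtrees.

Section Constants.
Variable R : realType.

Definition bst_pN (k : nat) : R := 2 / (k.+1 * k.+2)%:R.

Definition bst_beta (k m : nat) : R :=
  (4 * (k + m + 3))%:R / (k.+1 * k.+2 * m.+1 * m.+2)%:R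
  - (4 * (k ^ 2 + 3 * k * m + m ^ 2 + 4 * k + 4 * m + 3))%:R
    / (k.+1 * m.+1 * (k + m + 1) * (k + m + 2) * (k + m + 3))%:R.

Definition rrt_pN (k : nat) : R := 1 / (k * k.+1)%:R.

Definition rrt_beta (k m : nat) : R :=
  (k ^ 2 + k * m + m ^ 2 + k + m)%:R / (k * k.+1 * m * m.+1 * (k + m + 1))%:R.

End Constants.

(* Main.v *)
(* Split at the root, the binary search tree of size [n] yields a pair of
   independent ones of uniformly chosen sizes. The rotation correspondence turns
   the recursive tree of size [n] into the binary search tree of size [n - 1], so
   all three counts are functionals [X] of one random binary tree with
   [X (BNode l r) = X l + X r + t l r] and [t] bounded. The recurrence
   [a n = b n + (2 / n) * \sum_(j < n) a j] has the solution
   [a n = b n + (n + 1) * \sum_(k < n) 2 b k / ((k + 1) (k + 2))], which gives the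
   mean up to a bounded error, a variance [s2 * (n + 1) + O(sqrt n)], and, from a
   third-order Taylor expansion of one step, a Gaussian characteristic function up
   to an error that vanishes at scale [1 / sqrt n]; Levy continuity then yields the
   limit laws. For properties of trees of size at most [N] the variance is exactly
   [n + 1] times the partial sum of the covariances as soon as [n] is large. The
   error [O(sqrt n)] being uniform in the property, comparing a property with its
   truncation at [N] in a tree of size [N] shows that the partial sums converge to
   [s2], and no tightness in [N] is needed. *)
Require Import Defs.
From mathcomp Require Import all_boot all_order all_algebra all_fingroup.
From mathcomp Require Import all_classical all_reals all_analysis.
From mathcomp Require Import measurable_realfun.
From mathcomp Require Import ring lra zify.
Import Order.TTheory GRing.Theory Num.Theory.
Import numFieldNormedType.Exports.
Local Open Scope classical_set_scope.
Local Open Scope ring_scope.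

Set Implicit Arguments.
Unset Strict Implicit.
Unset Printing Implicit Defensive.

(** All expectations over random trees go through [bstE], a finite recursion in which the
    conditional independence of the two root subtrees is the nesting of two expectations. The actual
    samples enter only through identities between [Ex] and [bstE].

    The characteristic function is kept real, as the mean of [cos (s * centered T + theta)]. The
    free phase replaces complex multiplication: once the left subtree is fixed, its contribution is
    absorbed in the phase and the induction hypothesis applies to the right one.

    The main obstacle is that the toll may depend on the whole shape of the subtrees, hence is
    correlated with their counts. The variance recurrence thus has a covariance term of order sqrt
    n, controlled by Cauchy-Schwarz and a bootstrap on the variance itself; this is the source of
    the error O(sqrt n). The comparison is made with the Gaussian of the exact variance at size n,
    not of the limiting one, because the second-order terms of the cosine and of the Gaussian then
    cancel exactly through the variance recurrence. At s of order 1 / sqrt n the accumulated error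
    is of order log n / sqrt n. *)

Ltac natnz :=
  repeat match goal with |- is_true (_ && _) => apply/andP; split end;
  apply: lt0r_neq0;
  (* Casts of variables are generalised to nonnegative reals, so that [lra] sees that the
     denominator is positive. *)
  repeat match goal with
  | |- context [@GRing.natmul ?V ?o ?n] =>
      is_var n; let x := fresh "x" in
      have := ler0n _ n : 0 <= @GRing.natmul V o n;
      set x := @GRing.natmul V o n; clearbody x; intro
  end; lra.

(** * Divide-and-conquer recurrences *)

Section DivideAndConquer.
Variable R : realType.
Implicit Types (a b : nat -> R).

(** For [k >= 1] this is the law of the random size N; the extra weight 1 at [k = 0] belongs to the
    value at the empty tree. *)
Definition bst_weight (k : nat) : R := 2 / (k.+1 * k.+2)%:R.

Definition bst_series b n : R := \sum_(k < n) bst_weight k * b k.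

Lemma bst_weight_gt0 k : 0 < bst_weight k.
Proof. by rewrite divr_gt0 // ltr0n. Qed.

(** With A n the partial sum, the recurrence reads A (n+1) <= b n + (1 + 2/n) A n, and n (n+1) / 2
    is its integrating factor. At n = 0 the division by zero only multiplies an empty sum. *)
Lemma divide_sum_le a b : (forall n, a n <= b n + 2 / n%:R * \sum_(j < n) a j) ->
  forall n, \sum_(j < n) a j <= (n * n.+1)%:R / 2 * bst_series b n.
Proof.
move=> rec; elim=> [|n IH]; first by rewrite big_ord0 mul0n !mul0r.
have a_le : a n <= b n + n.+1%:R * bst_series b n.
  apply: le_trans (rec n) _; rewrite lerD2l.
  case: n IH {rec} => [|n] IH; first by rewrite /bst_series !big_ord0 !mulr0.
  apply: (@le_trans _ _ (2 / n.+1%:R * ((n.+1 * n.+2)%:R / 2 * bst_series b n.+1))).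
    by rewrite ler_wpM2l // divr_ge0.
  rewrite le_eqVlt; apply/orP; left; apply/eqP; rewrite natrM.
  by field; natnz.
rewrite big_ord_recr /= /bst_series big_ord_recr /= -/(bst_series b n).
apply: le_trans (lerD IH a_le) _.
rewrite le_eqVlt; apply/orP; left; apply/eqP.
rewrite /bst_weight !natrM -[n.+2%:R]natr1 -[n.+1%:R]natr1.
by field; natnz.
Qed.

Lemma divide_rec_le a b : (forall n, a n <= b n + 2 / n%:R * \sum_(j < n) a j) ->
  forall n, a n <= b n + n.+1%:R * bst_series b n.
Proof.
move=> rec n; apply: le_trans (rec n) _; rewrite lerD2l.
have := divide_sum_le rec n; case: n => [|n] IH.
  by rewrite /bst_series !big_ord0 !mulr0.
apply: (@le_trans _ _ (2 / n.+1%:R * ((n.+1 * n.+2)%:R / 2 * bst_series b n.+1))).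
  by rewrite ler_wpM2l // divr_ge0.
rewrite le_eqVlt; apply/orP; left; apply/eqP; rewrite natrM.
by field; natnz.
Qed.

Lemma divide_rec a b : (forall n, a n = b n + 2 / n%:R * \sum_(j < n) a j) ->
  forall n, a n = b n + n.+1%:R * bst_series b n.
Proof.
move=> rec n; apply/eqP; rewrite eq_le; apply/andP; split.
  by apply: divide_rec_le => k; rewrite -rec.
rewrite -lerN2 opprD -mulrN.
have -> : - bst_series b n = bst_series (fun k => - b k) n.
  by rewrite /bst_series -sumrN; apply: eq_bigr => i _; rewrite mulrN.
apply: (@divide_rec_le (fun k => - a k) (fun k => - b k)) => k /=.
by rewrite {1}rec opprD sumrN mulrN.
Qed.

Lemma divide_rec_unique a a' b :
  (forall n, (0 < n)%N -> a n = b n + 2 / n%:R * \sum_(j < n) a j) ->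
  (forall n, (0 < n)%N -> a' n = b n + 2 / n%:R * \sum_(j < n) a' j) ->
  a 0%N = a' 0%N -> a =1 a'.
Proof.
move=> ra ra' a0; elim/ltn_ind => -[|n] IH //.
by rewrite ra // ra' //; congr (_ + _ * _); apply: eq_bigr => i _; apply: IH.
Qed.

Lemma sum_bst_weight m n : (m <= n)%N ->
  \sum_(m <= k < n) bst_weight k = 2 / m.+1%:R - 2 / n.+1%:R.
Proof.
move=> mn; rewrite (@telescope_sumr_eq _ m n (fun k => - (2 / k.+1%:R))) //.
  by rewrite opprK addrC.
move=> k _; rewrite /bst_weight natrM -[k.+2%:R]natr1 -[k.+1%:R]natr1.
by field; natnz.
Qed.

(** A telescoping majorant for terms of order k^(-3/2), which gives tails of order 1 / sqrt n. With
    x and y the two roots, y^2 - x^2 = 1 yields 1/x - 1/y = 1 / (x y (x + y)), and x <= y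
    concludes. *)
Lemma bst_weight_sqrt k :
  bst_weight k * Num.sqrt k.+1%:R <=
    4 * ((Num.sqrt k.+1%:R)^-1 - (Num.sqrt k.+2%:R)^-1).
Proof.
rewrite /bst_weight natrM.
have xE : k.+1%:R = Num.sqrt k.+1%:R ^+ 2 :> R by rewrite sqr_sqrtr.
have yE : k.+2%:R = Num.sqrt k.+2%:R ^+ 2 :> R by rewrite sqr_sqrtr.
have x0 : 0 < Num.sqrt k.+1%:R :> R by rewrite sqrtr_gt0.
have y0 : 0 < Num.sqrt k.+2%:R :> R by rewrite sqrtr_gt0.
have xy : Num.sqrt k.+2%:R ^+ 2 = Num.sqrt k.+1%:R ^+ 2 + 1 :> R.
  by rewrite -xE -yE natr1.
rewrite {1}xE {1}yE.
move: (Num.sqrt k.+1%:R) (Num.sqrt k.+2%:R) x0 y0 xy => x y x0 y0 xy {xE yE}.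
have le_xy : x <= y by rewrite -(@ler_pXn2r _ 2) ?nnegrE ?ltW // xy; lra.
have -> : x^-1 - y^-1 = (x * y * (x + y))^-1.
  have -> : x^-1 - y^-1 = (y ^+ 2 - x ^+ 2) / (x * y * (x + y)).
    by field; rewrite !gt_eqF //; lra.
  by rewrite xy addrAC subrr add0r mul1r.
have -> : 2 / (x ^+ 2 * y ^+ 2) * x = 4 / (x * y * (y + y)).
  by field; rewrite !gt_eqF //; lra.
rewrite ler_wpM2l // lef_pV2 ?posrE ?mulr_gt0 ?addr_gt0 //.
by apply: ler_wpM2l; [rewrite mulr_ge0 // ltW | lra].
Qed.

End DivideAndConquer.

(** * Expectations over random binary search trees *)

Section BstExpectation.
Variable R : realType.
Implicit Types (h g : bintree -> R) (k : bintree -> bintree -> R).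

(* The expectation of [h] of the random binary search tree with [n] nodes: the
   left subtree has uniform size and, given the sizes, the two subtrees are
   independent random binary search trees. The first argument is fuel. *)
Fixpoint bstE_rec (fuel n : nat) h : R :=
  match fuel, n with
  | m.+1, n'.+1 =>
      (\sum_(j < n'.+1) bstE_rec m j (fun l => bstE_rec m (n' - j) (fun r =>
         h (BNode l r)))) / n'.+1%:R
  | _, _ => h BEmpty
  end.

Definition bstE n h : R := bstE_rec n n h.

(** Here [n] is the joint size of the two subtrees: this is the expectation over the pair of root
    subtrees of a tree with [n.+1] nodes. *)
Definition splitE n k : R :=
  (\sum_(j < n.+1) bstE j (fun l => bstE (n - j) (k l))) / n.+1%:R.

Lemma bstE_rec_fuel m n h : (n <= m)%N -> bstE_rec m n h = bstE n h.
Proof.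
rewrite /bstE; elim/ltn_ind: m n h => -[|m] IH [|n] h //; rewrite ltnS => nm /=.
congr (_ / _); apply: eq_bigr => j _.
have jn : (j <= n)%N by rewrite -ltnS.
rewrite (IH m) ?(leq_trans jn) // (IH n) ?ltnS //; congr (bstE_rec j j _).
apply/funext => l.
by rewrite (IH m) ?(leq_trans (leq_subr _ _)) // (IH n) ?ltnS ?leq_subr.
Qed.

Lemma bstE0 h : bstE 0 h = h BEmpty. Proof. by []. Qed.

Lemma bstES n h : bstE n.+1 h = splitE n (fun l r => h (BNode l r)).
Proof.
rewrite {1}/bstE /=; congr (_ / _); apply: eq_bigr => j _.
rewrite bstE_rec_fuel -1?ltnS //; congr (bstE _ _); apply/funext => l.
by rewrite bstE_rec_fuel ?leq_subr.
Qed.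

Lemma bstE_eq n h g :
  (forall T, bt_size T = n -> h T = g T) -> bstE n h = bstE n g.
Proof.
elim/ltn_ind: n h g => -[|n] IH h g hg; first by rewrite !bstE0 hg.
rewrite !bstES; congr (_ / _); apply: eq_bigr => j _.
have jn : (j <= n)%N by rewrite -ltnS.
apply: (IH j) => // l lj; apply: (IH (n - j)%N) => [|r rj]; first by rewrite ltnS leq_subr.
by apply: hg => /=; rewrite lj rj subnKC.
Qed.

Lemma splitE_eq n k k' :
  (forall l r, (bt_size l + bt_size r)%N = n -> k l r = k' l r) ->
  splitE n k = splitE n k'.
Proof.
move=> kk'; congr (_ / _); apply: eq_bigr => j _.
apply: bstE_eq => l lj; apply: bstE_eq => r rj.
by apply: kk'; rewrite lj rj subnKC // -ltnS.
Qed.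

Lemma bstE_le n h g :
  (forall T, bt_size T = n -> h T <= g T) -> bstE n h <= bstE n g.
Proof.
elim/ltn_ind: n h g => -[|n] IH h g hg; first by rewrite !bstE0 hg.
rewrite !bstES ler_wpM2r ?invr_ge0 //; apply: ler_sum => j _.
have jn : (j <= n)%N by rewrite -ltnS.
apply: (IH j) => // l lj; apply: (IH (n - j)%N) => [|r rj]; first by rewrite ltnS leq_subr.
by apply: hg => /=; rewrite lj rj subnKC.
Qed.

Lemma splitE_le n k k' :
  (forall l r, (bt_size l + bt_size r)%N = n -> k l r <= k' l r) ->
  splitE n k <= splitE n k'.
Proof.
move=> kk'; rewrite ler_wpM2r ?invr_ge0 //; apply: ler_sum => j _.
apply: bstE_le => l lj; apply: bstE_le => r rj.
by apply: kk'; rewrite lj rj subnKC // -ltnS.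
Qed.

Lemma bstED n h g : bstE n (fun T => h T + g T) = bstE n h + bstE n g.
Proof.
elim/ltn_ind: n h g => -[|n] IH h g; first by rewrite !bstE0.
rewrite !bstES -mulrDl -big_split /=; congr (_ / _); apply: eq_bigr => j _.
rewrite -IH //; congr (bstE _ _); apply/funext => l.
by rewrite -IH // ltnS leq_subr.
Qed.

Lemma bstEZ n c h : bstE n (fun T => c * h T) = c * bstE n h.
Proof.
elim/ltn_ind: n h => -[|n] IH h; first by rewrite !bstE0.
rewrite !bstES [RHS]mulrA mulr_sumr; congr (_ / _); apply: eq_bigr => j _.
rewrite -IH //; congr (bstE _ _); apply/funext => l.
by rewrite -IH // ltnS leq_subr.
Qed.

Lemma splitED n k k' :
  splitE n (fun l r => k l r + k' l r) = splitE n k + splitE n k'.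
Proof.
rewrite -mulrDl -big_split /=; congr (_ / _); apply: eq_bigr => j _.
by rewrite -bstED; congr (bstE _ _); apply/funext => l; rewrite bstED.
Qed.

Lemma splitEZ n c k : splitE n (fun l r => c * k l r) = c * splitE n k.
Proof.
rewrite mulrA mulr_sumr; congr (_ / _); apply: eq_bigr => j _.
by rewrite -bstEZ; congr (bstE _ _); apply/funext => l; rewrite bstEZ.
Qed.

Lemma bstEN n h : bstE n (fun T => - h T) = - bstE n h.
Proof.
rewrite -mulN1r -bstEZ; congr (bstE _ _); apply/funext => T.
by rewrite mulN1r.
Qed.

Lemma splitEN n k : splitE n (fun l r => - k l r) = - splitE n k.
Proof.
rewrite -mulN1r -splitEZ; congr splitE; apply/funext => l; apply/funext => r.
by rewrite mulN1r.
Qed.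

Lemma bstEB n h g : bstE n (fun T => h T - g T) = bstE n h - bstE n g.
Proof. by rewrite bstED bstEN. Qed.

Lemma splitEB n k k' :
  splitE n (fun l r => k l r - k' l r) = splitE n k - splitE n k'.
Proof. by rewrite splitED splitEN. Qed.

Lemma bstE_cst n c : bstE n (fun=> c) = c.
Proof.
elim/ltn_ind: n c => -[|n] IH c //; rewrite bstES /splitE.
under eq_bigr => j _.
  rewrite (_ : (fun l => _) = (fun=> c)); last first.
    by apply/funext => l; rewrite IH // ltnS leq_subr.
  rewrite IH //; over.
by rewrite sumr_const card_ord -[c *+ _]mulr_natr mulfK.
Qed.

Lemma splitE_cst n c : splitE n (fun _ _ => c) = c.
Proof. by rewrite -(bstES n (fun=> c)) bstE_cst. Qed.

Lemma bstE_norm_le n h g :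
  (forall T, bt_size T = n -> `|h T| <= g T) -> `|bstE n h| <= bstE n g.
Proof.
move=> hg; rewrite ler_norml -bstEN; apply/andP; split;
  by apply: bstE_le => T /hg; rewrite ler_norml => /andP[].
Qed.

Lemma splitE_norm_le n k k' :
  (forall l r, (bt_size l + bt_size r)%N = n -> `|k l r| <= k' l r) ->
  `|splitE n k| <= splitE n k'.
Proof.
move=> kk'; rewrite ler_norml -splitEN; apply/andP; split;
  by apply: splitE_le => l r /kk'; rewrite ler_norml => /andP[].
Qed.

(** Cauchy-Schwarz, from the nonnegativity of the variance of [|k|]. *)
Lemma splitE_abs_le_sqrt n k :
  splitE n (fun l r => `|k l r|) <= Num.sqrt (splitE n (fun l r => k l r ^+ 2)).
Proof.
set m := splitE _ _; have m0 : 0 <= m.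
  by rewrite -(splitE_cst n 0); apply: splitE_le.
rewrite -(ger0_norm m0) -sqrtr_sqr ler_wsqrtr //.
have : 0 <= splitE n (fun l r => (`|k l r| - m) ^+ 2).
  by rewrite -(splitE_cst n 0); apply: splitE_le => l r _; exact: sqr_ge0.
suff -> : splitE n (fun l r => (`|k l r| - m) ^+ 2) =
    splitE n (fun l r => k l r ^+ 2) - m ^+ 2 by rewrite subr_ge0.
rewrite (@splitE_eq _ _ (fun l r => k l r ^+ 2 - (2 * m) * `|k l r| + m ^+ 2)).
  by rewrite splitED splitEB splitEZ splitE_cst -/m; ring.
by move=> l r _; rewrite -[k l r ^+ 2]real_normK ?num_real //; ring.
Qed.

Lemma splitE_sizes n (u : nat -> nat -> R) :
  splitE n (fun l r => u (bt_size l) (bt_size r)) =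
  (\sum_(j < n.+1) u j (n - j)%N) / n.+1%:R.
Proof.
congr (_ / _); apply: eq_bigr => j _.
rewrite (@bstE_eq _ _ (fun=> u j (n - j)%N)) ?bstE_cst // => l lj.
by rewrite (@bstE_eq _ _ (fun=> u j (n - j)%N)) ?bstE_cst // => r rj; rewrite lj rj.
Qed.

Lemma sum_ord_sub n (u : nat -> R) :
  \sum_(j < n.+1) u (n - j)%N = \sum_(j < n.+1) u j.
Proof.
rewrite (reindex_inj rev_ord_inj) /=; apply: eq_bigr => j _.
by rewrite subSS subKn // -ltnS.
Qed.

Lemma splitE_sizesD n (u : nat -> R) :
  splitE n (fun l r => u (bt_size l) + u (bt_size r)) =
  2 / n.+1%:R * \sum_(j < n.+1) u j.
Proof.
rewrite (splitE_sizes n (fun i j => u i + u j)) big_split /= sum_ord_sub.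
by ring.
Qed.

Lemma splitEl n h :
  splitE n (fun l _ => h l) = (\sum_(j < n.+1) bstE j h) / n.+1%:R.
Proof.
congr (_ / _); apply: eq_bigr => j _; congr (bstE _ _).
by apply/funext => l; rewrite bstE_cst.
Qed.

Lemma splitEr n h :
  splitE n (fun _ r => h r) = (\sum_(j < n.+1) bstE j h) / n.+1%:R.
Proof.
rewrite -(sum_ord_sub n (fun j => bstE j h)).
by congr (_ / _); apply: eq_bigr => j _; rewrite bstE_cst.
Qed.

Lemma splitEM n h g :
  splitE n (fun l r => h l * g r) =
  (\sum_(j < n.+1) bstE j h * bstE (n - j) g) / n.+1%:R.
Proof.
congr (_ / _); apply: eq_bigr => j _; rewrite mulrC -bstEZ; congr (bstE _ _).
by apply/funext => l; rewrite bstEZ mulrC.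
Qed.

End BstExpectation.

(** * Limits of the weighted series, with rates *)

Section SeriesTail.
Variable R : realType.

(** [u - d] increases, [u + d] decreases, and every value of the former is below every value of the
    latter; the supremum of the former therefore lies between them. When [d] tends to 0 this yields
    a limit together with its rate. *)
Lemma telescoping_bound (u d : nat -> R) :
  (forall n, 0 <= d n) -> (forall n, `|u n.+1 - u n| <= d n - d n.+1) ->
  exists m, forall n, `|u n - m| <= d n.
Proof.
move=> d0 ud_abs.
have ud n : - (d n - d n.+1) <= u n.+1 - u n <= d n - d n.+1.
  by rewrite -ler_norml.
have up : {homo (fun n => u n - d n) : i j / (i <= j)%N >-> i <= j}.
  by apply: homo_leq => [//|y x z|n]; [exact: le_trans|have := ud n; lra].
have down : {homo (fun n => u n + d n) : i j / (i <= j)%N >-> j <= i}.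
  apply: (@homo_leq _ _ (fun x y => y <= x)) => [//|y x z|n].
    by move=> xy yz; exact: le_trans xy.
  by have := ud n; lra.
have cross n k : u n - d n <= u k + d k.
  apply: le_trans (up n (maxn n k) (leq_maxl _ _)) _.
  apply: le_trans (down k (maxn n k) (leq_maxr _ _)).
  by have := d0 (maxn n k); lra.
have S0 : has_sup (range (fun n => u n - d n)).
  split; first by exists (u 0%N - d 0%N); exists 0%N.
  by exists (u 0%N + d 0%N) => _ [n _ <-]; exact: cross.
exists (sup (range (fun n => u n - d n))) => n.
have lo : u n - d n <= sup (range (fun n => u n - d n)).
  by apply: ub_le_sup; [exists (u 0%N + d 0%N) => _ [k _ <-]; exact: cross | exists n].
have hi : sup (range (fun n => u n - d n)) <= u n + d n.
  by apply: ge_sup => [|_ [k _ <-]]; [case: S0 | exact: cross].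
by rewrite ler_norml; lra.
Qed.

Lemma bst_series_bounded (C : R) b : (forall n, `|b n| <= C) ->
  exists m, forall n, `|bst_series b n - m| <= 2 * C / n.+1%:R.
Proof.
move=> bC; apply: telescoping_bound => n.
  by rewrite divr_ge0 // mulr_ge0 // (le_trans _ (bC 0%N)).
rewrite /bst_series big_ord_recr /= addrAC subrr add0r normrM.
rewrite gtr0_norm ?bst_weight_gt0 //.
apply: (@le_trans _ _ (bst_weight R n * C)).
  by rewrite ler_wpM2l // ltW ?bst_weight_gt0.
rewrite le_eqVlt; apply/orP; left; apply/eqP.
have := sum_bst_weight R (leqnSn n); rewrite big_nat1 => ->.
by rewrite mulrBl mulrAC [in RHS]mulrC; congr (_ - _); ring.
Qed.

Lemma bst_series_sqrt (C : R) b :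
  (forall n, `|b n| <= C * Num.sqrt n.+1%:R) ->
  exists m, forall n, `|bst_series b n - m| <= 4 * C / Num.sqrt n.+1%:R.
Proof.
move=> bC.
have C0 : 0 <= C by have := bC 0%N; rewrite sqrtr1 mulr1; exact: le_trans.
apply: telescoping_bound => n.
  by rewrite divr_ge0 // mulr_ge0.
rewrite /bst_series big_ord_recr /= addrAC subrr add0r normrM.
rewrite gtr0_norm ?bst_weight_gt0 //.
apply: (@le_trans _ _ (bst_weight R n * (C * Num.sqrt n.+1%:R))).
  by rewrite ler_wpM2l // ltW ?bst_weight_gt0.
rewrite mulrCA.
apply: (le_trans (ler_wpM2l C0 (bst_weight_sqrt R n))).
by rewrite le_eqVlt; apply/orP; left; apply/eqP; ring.
Qed.

Lemma bst_series_le b b' n : (forall k, (k < n)%N -> b k <= b' k) ->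
  bst_series b n <= bst_series b' n :> R.
Proof.
move=> bb'; apply: ler_sum => k _; rewrite ler_wpM2l ?bb' //.
by rewrite ltW ?bst_weight_gt0.
Qed.

(** Both series telescope: the weights sum to at most 2, and the weights times sqrt (k+1) to at most
    4. The bound does not grow with [n], which lets the bootstrap of [variance_le] close. *)
Lemma bst_series_cst_sqrt (p q : R) n : 0 <= p -> 0 <= q ->
  bst_series (fun k => p + q * Num.sqrt k.+1%:R) n <= 2 * p + 4 * q.
Proof.
move=> p0 q0.
have -> : bst_series (fun k => p + q * Num.sqrt k.+1%:R) n =
  p * \sum_(0 <= k < n) bst_weight R k +
  q * \sum_(0 <= k < n) bst_weight R k * Num.sqrt k.+1%:R.
  rewrite !mulr_sumr -big_split /= big_mkord; apply: eq_bigr => k _.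
  by rewrite mulrDr [p * _]mulrC [q * (_ * _)]mulrCA.
rewrite sum_bst_weight // divr1; apply: lerD.
  rewrite mulrC ler_wpM2r // gerBl.
  by rewrite divr_ge0.
rewrite mulrC ler_wpM2r //.
apply: (@le_trans _ _ (\sum_(0 <= k < n)
    4 * ((Num.sqrt k.+1%:R)^-1 - (Num.sqrt k.+2%:R)^-1))).
  by apply: ler_sum => k _; exact: bst_weight_sqrt.
rewrite -mulr_sumr -[leRHS]mulr1 ler_wpM2l //.
rewrite (@telescope_sumr_eq _ 0 n (fun k => - (Num.sqrt k.+1%:R)^-1)) //.
  by rewrite sqrtr1 invr1 opprK addrC gerBl invr_ge0.
by move=> k _; rewrite opprK addrC.
Qed.

(** The closed form does solve the recurrence. The factor [n%:R / n%:R] is 1 for positive [n] and 0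
    at [n = 0], where the left-hand sum is empty. *)
Lemma divide_rec_solution (b : nat -> R) n :
  2 / n%:R * \sum_(j < n) (b j + j.+1%:R * bst_series b j) =
  n%:R / n%:R * (n.+1%:R * bst_series b n).
Proof.
have -> : \sum_(j < n) (b j + j.+1%:R * bst_series b j) =
    (n * n.+1)%:R / 2 * bst_series b n.
  elim: n => [|n IH]; first by rewrite big_ord0 mul0n !mul0r.
  rewrite big_ord_recr /= IH /bst_series big_ord_recr /= -/(bst_series b n).
  rewrite /bst_weight !natrM -[n.+2%:R]natr1 -[n.+1%:R]natr1.
  by field; natnz.
rewrite natrM; case: n => [|n]; first by rewrite !mul0r mulr0.
by field; natnz.
Qed.

End SeriesTail.

(** * Taylor estimates for the cosine and the exponential *)

Section Taylor.
Variable R : realType.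
Implicit Types x y h p : R.

Lemma MVT_min_max (f f' : R -> R) x y :
  (forall z : R, is_derive z (1 : R) f (f' z)) ->
  exists2 c, Num.min x y <= c <= Num.max x y & f y - f x = f' c * (y - x).
Proof.
move=> df; wlog xy : x y / x <= y.
  move=> hw; case/orP: (le_total x y) => [xy|yx].
    exact: hw.
  have [c cb e] := hw _ _ yx; exists c; last by rewrite -opprB e; ring.
  by rewrite minC maxC.
have cf : {within `[x, y], continuous f}.
  apply: derivable_within_continuous => z _.
  exact: (@ex_derive _ _ _ _ _ _ _ (df z)).
have [c] := MVT_segment xy (fun z _ => df z) cf.
by rewrite in_itv /= => cxy e; exists c; rewrite // min_l ?max_r.
Qed.

Lemma MVT_abs (f f' : R -> R) x : (forall z : R, is_derive z (1 : R) f (f' z)) ->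
  exists2 c, `|c| <= `|x| & f x - f 0 = f' c * x.
Proof.
move=> df; have [c cb e] := MVT_min_max 0 x df.
exists c; last by rewrite e subr0.
case/andP: cb; case/orP: (le_total 0 x) => x0.
  by rewrite min_l // max_r // => c0 cx; rewrite !ger0_norm // (le_trans c0).
by rewrite min_r // max_l // => xc c0; rewrite !ler0_norm ?lerN2 // (le_trans xc).
Qed.

Lemma abs_sin_le x : `|sin x| <= `|x|.
Proof.
have [c _] := MVT_abs x (fun z => is_derive_sin z).
rewrite sin0 subr0 => ->; rewrite normrM ler_piMl //.
by rewrite ler_norml cos_geN1 cos_le1.
Qed.

Lemma one_sub_cos x : 1 - cos x = 2 * sin (x / 2) ^+ 2.
Proof.
have := cosD (x / 2) (x / 2); rewrite -mulr2n -[_ *+ 2]mulr_natr divfK // => ->.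
by have := cos2Dsin2 (x / 2); nra.
Qed.

Lemma abs_cos_sub1_le x : `|cos x - 1| <= x ^+ 2 / 2.
Proof.
have s0 := sqr_ge0 (sin (x / 2)).
rewrite distrC one_sub_cos ger0_norm; last by lra.
have : sin (x / 2) ^+ 2 <= (x / 2) ^+ 2.
  by rewrite -[leLHS]real_normK ?num_real // -[leRHS]real_normK ?num_real //;
     rewrite ler_pXn2r ?nnegrE // abs_sin_le.
by lra.
Qed.

Lemma abs_sin_sub_le x : `|sin x - x| <= `|x| ^+ 3.
Proof.
have df z : is_derive z (1 : R) (fun y : R => sin y - y) (cos z - 1).
  exact: is_deriveB.
have [c cx] := MVT_abs x df.
rewrite sin0 !subr0 => ->; rewrite normrM exprSr ler_wpM2r //.
apply: le_trans (abs_cos_sub1_le c) _.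
have : c ^+ 2 <= `|x| ^+ 2.
  by rewrite -[leLHS]real_normK ?num_real // ler_pXn2r ?nnegrE.
by have := sqr_ge0 c; lra.
Qed.

Lemma abs_sin_sub_le2 x : `|sin x - x| <= 2 * x ^+ 2.
Proof.
have h1 := abs_sin_sub_le x; have h2 := abs_sin_le x.
have h3 : `|sin x - x| <= `|sin x| + `|x| by exact: ler_normB.
rewrite -[x ^+ 2]real_normK ?num_real //.
have x0 := normr_ge0 x; have [x1|x1] := leP `|x| 1.
  apply: le_trans h1 _; rewrite exprSr; have := sqr_ge0 `|x|; nra.
by nra.
Qed.

Lemma abs_cos_Taylor2_le x : `|cos x - 1 + x ^+ 2 / 2| <= x ^+ 4.
Proof.
have -> : cos x - 1 + x ^+ 2 / 2 =
    - 2 * (sin (x / 2) - x / 2) * (sin (x / 2) + x / 2).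
  by rewrite -[cos x - 1]opprB one_sub_cos; field.
have h1 := abs_sin_sub_le (x / 2); have h2 := abs_sin_le (x / 2).
rewrite !normrM normrN [`|2|]ger0_norm //.
have h3 : `|sin (x / 2) + x / 2| <= 2 * `|x / 2|.
  by apply: le_trans (ler_normD _ _) _; lra.
apply: (@le_trans _ _ (2 * `|x / 2| ^+ 3 * (2 * `|x / 2|))).
  by apply: ler_pM => //; rewrite ?mulr_ge0 // ler_wpM2l.
have -> : x ^+ 4 = `|x| ^+ 4.
  by rewrite -normrX ger0_norm // exprn_even_ge0.
rewrite normf_div [`|2|]ger0_norm //.
have : 0 <= `|x| ^+ 4 by rewrite exprn_ge0.
by move=> h; suff -> : 2 * (`|x| / 2) ^+ 3 * (2 * (`|x| / 2)) = `|x| ^+ 4 / 4; [lra | field].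
Qed.

(** [h] stands for the scaled toll and [p] for the scaled fluctuation of the subtrees. The expansion
    is made at [theta] rather than at [theta + p]: in expectation the linear term then vanishes with
    the mean of the centered toll, and the second-order terms form the toll of the variance. The
    price is the error terms in [p]. *)
Lemma cos_perturbation (theta p h : R) :
  `|cos (theta + p + h) - cos (theta + p) + h * sin theta
    + (h * p + h ^+ 2 / 2) * cos theta|
  <= `|h| ^+ 3 + h ^+ 4 + 3 * (`|h| * p ^+ 2) + h ^+ 2 * `|p|.
Proof.
have csb (z : R) : `|cos z| <= 1 by rewrite ler_norml cos_geN1 cos_le1.
have snb (z : R) : `|sin z| <= 1 by rewrite ler_norml sin_geN1 sin_le1.
have -> : cos (theta + p + h) - cos (theta + p) + h * sin theta
    + (h * p + h ^+ 2 / 2) * cos theta =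
  cos (theta + p) * (cos h - 1 + h ^+ 2 / 2) - sin (theta + p) * (sin h - h)
  - h * (sin theta * (cos p - 1) + cos theta * (sin p - p))
  - h ^+ 2 / 2 * (cos theta * (cos p - 1) - sin theta * sin p).
  rewrite [cos (_ + _ + _)]cosD [sin (_ + _)]sinD [cos (_ + _)]cosD; by field.
have leM (a b c : R) : `|a| <= 1 -> `|b| <= c -> `|a * b| <= c.
  move=> a1 bc; rewrite normrM (le_trans _ bc) // ler_piMl //.
have h1 : `|cos (theta + p) * (cos h - 1 + h ^+ 2 / 2)| <= h ^+ 4.
  by apply: leM => //; exact: abs_cos_Taylor2_le.
have h2 : `|sin (theta + p) * (sin h - h)| <= `|h| ^+ 3.
  by apply: leM => //; exact: abs_sin_sub_le.
have h3 : `|h * (sin theta * (cos p - 1) + cos theta * (sin p - p))|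
    <= 3 * (`|h| * p ^+ 2).
  rewrite normrM mulrCA ler_wpM2l //; apply: le_trans (ler_normD _ _) _.
  have := leM _ _ _ (snb theta) (abs_cos_sub1_le p).
  have := leM _ _ _ (csb theta) (abs_sin_sub_le2 p).
  by have := sqr_ge0 p; lra.
have h4 : `|h ^+ 2 / 2 * (cos theta * (cos p - 1) - sin theta * sin p)|
    <= h ^+ 2 * `|p|.
  rewrite normrM [`|h ^+ 2 / 2|]ger0_norm ?divr_ge0 ?sqr_ge0 //.
  rewrite -mulrA ler_wpM2l ?sqr_ge0 //.
  have -> : cos theta * (cos p - 1) - sin theta * sin p = cos (theta + p) - cos theta.
    by rewrite cosD; ring.
  have [c _ ->] := MVT_min_max theta (theta + p) (fun z => is_derive_cos z).
  have -> : theta + p - theta = p by ring.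
  rewrite normrM normrN; have := ler_wpM2r (normr_ge0 p) (snb c).
  have : 0 <= `|sin c| * `|p| by rewrite mulr_ge0.
  by lra.
apply: le_trans (ler_normB _ _) _; apply: lerD _ h4.
apply: le_trans (ler_normB _ _) _; apply: lerD _ h3.
by apply: le_trans (ler_normB _ _) _; rewrite addrC; apply: lerD.
Qed.

Lemma expRN_perturbation x y : 0 <= x -> 0 <= y ->
  `|expR (- y) - expR (- x) - (x - y)| <= `|x - y| * (x + y).
Proof.
move=> x0 y0.
have df z : is_derive z (1 : R) (fun u : R => expR (- u)) (- expR (- z)).
  by apply: is_derive_eq; rewrite ?scaler1 ?scaleN1r ?mulrN1.
have [c cb e] := MVT_min_max x y df.
have /andP[cmin cmax] := cb.
have c0 : 0 <= c by apply: le_trans cmin; rewrite le_min x0.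
have cs : c <= x + y by apply: le_trans cmax _; rewrite ge_max lerDl lerDr x0 y0.
have -> : expR (- y) - expR (- x) - (x - y) = (x - y) * (expR (- c) - 1).
  by rewrite e; ring.
rewrite normrM ler_wpM2l // (le_trans _ cs) // ler_norml.
have := expR_ge1Dx (- c); have : expR (- c) <= 1 by rewrite -expR0 ler_expR oppr_le0.
by lra.
Qed.

End Taylor.

(** * The characteristic function of a normal law *)

Section NormalCharacteristicFunction.
Variables (R : realType) (s : R).
Hypothesis s_gt0 : 0 < s.
Local Notation leb := (@lebesgue_measure R).
Local Notation pdf := (normal_pdf 0 s).

Let s_neq0 : s != 0. Proof. exact: lt0r_neq0. Qed.

(** The Radon-Nikodym derivative agrees with the density almost everywhere, because both integrate
    to the normal measure on every measurable set. *)
Lemma integral_normal_prob (f : R -> R) : measurable_fun setT f ->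
  (normal_prob 0 s).-integrable setT (EFin \o f) ->
  (\int[normal_prob 0 s]_x (f x)%:E = \int[leb]_x (f x * pdf x)%:E)%E.
Proof.
move=> mf fint; have dom := normal_prob_dominates 0 s.
rewrite -(Radon_Nikodym_change_of_variables dom) //.
apply: ae_eq_integral => //.
- apply: emeasurable_funM; first exact/measurable_EFinP.
  by apply: (measurable_int leb); apply: Radon_Nikodym_integrable.
- by apply/measurable_EFinP/measurable_funM => //; exact: measurable_normal_pdf.
- under [X in ae_eq _ _ _ X]eq_fun do rewrite EFinM.
  apply: ae_eqe_mul2l => /=.
  rewrite Radon_NikodymE //=; case: cid => /= h [h1 h2 h3].
  apply: integral_ae_eq => //=.
  + by apply/measurable_EFinP; exact: measurable_normal_pdf.
  + by move=> E E01 mE; rewrite -h3.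
Qed.

Lemma pdfE x : pdf x = normal_peak s * expR (- (x ^+ 2 / (2 * s ^+ 2))).
Proof.
by rewrite normal_pdfE // /normal_fun subr0 mulNr -mulr_natl.
Qed.

Lemma is_derive_pdf (x : R) : is_derive x (1 : R) pdf (- (x / s ^+ 2) * pdf x).
Proof.
rewrite (_ : pdf = fun y => normal_peak s * expR (- (y ^+ 2 / (2 * s ^+ 2)))); last first.
  by apply/funext => y; rewrite pdfE.
apply: is_derive_eq.
rewrite /GRing.scale /=; field.
exact: s_neq0.
Qed.

(** Domination by a multiple of the density of standard deviation 2 s: the ratio of the two Gaussian
    factors is exp (3 x^2 / (8 s^2)), and the constant 1 + 8 s^2 / 3 makes its lower bound by exp y
    >= 1 + y exceed 1 + x^2, hence |x|. *)
Lemma integrable_abs_pdf : leb.-integrable setT (EFin \o (fun x => `|x| * pdf x)).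
Proof.
have s2 : 2 * s != 0 by rewrite mulf_neq0.
set C := (1 + 8 * s ^+ 2 / 3) * normal_peak s / normal_peak (2 * s).
have peak2 : 0 < normal_peak (2 * s) by exact: normal_peak_gt0.
have C0 : 0 <= C.
  rewrite divr_ge0 ?normal_peak_ge0 // mulr_ge0 ?normal_peak_ge0 //.
  by rewrite addr_ge0 // divr_ge0 // mulr_ge0 // sqr_ge0.
have Gint : leb.-integrable setT (fun x => C%:E * (normal_pdf 0 (2 * s) x)%:E)%E.
  by apply: integrableZl => //; exact: integrable_normal_pdf.
apply: le_integrable Gint => //.
- apply/measurable_EFinP/measurable_funM; first exact: normr_measurable.
  exact: measurable_normal_pdf.
- move=> x _ /=; rewrite lee_fin normrM normr_id normrM (ger0_norm C0).
  rewrite !(ger0_norm (normal_pdf_ge0 _ _ _)).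
  rewrite pdfE normal_pdfE // /normal_fun subr0.
  have -> : C * (normal_peak (2 * s) * expR (- x ^+ 2 / ((2 * s) ^+ 2 *+ 2))) =
     (1 + 8 * s ^+ 2 / 3) * normal_peak s * expR (- (x ^+ 2 / (8 * s ^+ 2))).
    rewrite /C mulrA divfK ?gt_eqF //; congr (_ * expR _).
    by field.
  have -> : expR (- (x ^+ 2 / (2 * s ^+ 2))) =
      expR (- (3 * x ^+ 2 / (8 * s ^+ 2))) * expR (- (x ^+ 2 / (8 * s ^+ 2))).
    by rewrite -expRD; congr expR; field.
  have -> : `|x| * (normal_peak s * (expR (- (3 * x ^+ 2 / (8 * s ^+ 2))) *
       expR (- (x ^+ 2 / (8 * s ^+ 2))))) =
      `|x| * expR (- (3 * x ^+ 2 / (8 * s ^+ 2))) *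
      (normal_peak s * expR (- (x ^+ 2 / (8 * s ^+ 2)))) by ring.
  rewrite -[leRHS]mulrA; apply: ler_wpM2r.
    by rewrite mulr_ge0 ?normal_peak_ge0 ?expR_ge0.
  rewrite expRN ler_pdivrMr ?expR_gt0 //.
  have e1 := expR_ge1Dx (3 * x ^+ 2 / (8 * s ^+ 2)).
  have k0 : 0 <= 1 + 8 * s ^+ 2 / 3.
    by rewrite addr_ge0 // divr_ge0 // mulr_ge0 // sqr_ge0.
  apply: le_trans (ler_wpM2l k0 e1).
  have -> : (1 + 8 * s ^+ 2 / 3) * (1 + 3 * x ^+ 2 / (8 * s ^+ 2)) =
    1 + x ^+ 2 + (8 * s ^+ 2 / 3 + 3 * x ^+ 2 / (8 * s ^+ 2)) by field.
  have : 0 <= 8 * s ^+ 2 / 3 + 3 * x ^+ 2 / (8 * s ^+ 2).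
    by rewrite addr_ge0 // divr_ge0 // mulr_ge0 // sqr_ge0.
  have : 0 <= (`|x| - 1) ^+ 2 by exact: sqr_ge0.
  have : x ^+ 2 = `|x| ^+ 2 by rewrite real_normK ?num_real.
  by have := normr_ge0 x; move: (`|x|) => a; nra.
Qed.

Variable theta : R.

Let F tau := (\int[leb]_x (cos (tau * x + theta) * pdf x))%R.

Lemma continuous_affine (a b : R) : continuous (fun x : R => a * x + b).
Proof.
move=> x; apply: cvgD; last exact: cvg_cst.
by apply: cvgM; [exact: cvg_cst | exact: cvg_id].
Qed.

Lemma continuous_cos_affine (a b : R) : continuous (fun x : R => cos (a * x + b)).
Proof.
by move=> x; apply: continuous_comp; [exact: continuous_affine | exact: continuous_cos].
Qed.

Lemma continuous_sin_affine (a b : R) : continuous (fun x : R => sin (a * x + b)).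
Proof.
by move=> x; apply: continuous_comp; [exact: continuous_affine | exact: continuous_sin].
Qed.

Lemma integrable_bounded_pdf (f : R -> R) : continuous f -> (forall x, `|f x| <= 1) ->
  leb.-integrable setT (EFin \o (fun x => f x * pdf x)).
Proof.
move=> cf f1; apply: le_integrable (integrable_normal_pdf 0 s) => //.
  apply/measurable_EFinP/measurable_funM; last exact: measurable_normal_pdf.
  exact: continuous_measurable_fun.
move=> x _ /=; rewrite lee_fin normrM ler_piMl //.
Qed.

Lemma integrable_x_bounded_pdf (f : R -> R) : continuous f -> (forall x, `|f x| <= 1) ->
  leb.-integrable setT (EFin \o (fun x => f x * (x * pdf x))).
Proof.
move=> cf f1; apply: le_integrable integrable_abs_pdf => //.
  apply/measurable_EFinP/measurable_funM; first exact: continuous_measurable_fun.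
  by apply: measurable_funM => //; exact: measurable_normal_pdf.
move=> x _ /=; rewrite lee_fin !normrM normr_id ler_piMl // mulr_ge0.
Qed.

Lemma is_derive_sin_affine (a b x : R) :
  is_derive x (1 : R) (fun y : R => sin (a * y + b)) (a * cos (a * x + b)).
Proof. by apply: is_derive_eq; rewrite /GRing.scale /=; ring. Qed.

Lemma abs_cos_le1 (x : R) : `|cos x| <= 1.
Proof. by rewrite ler_norml cos_geN1 cos_le1. Qed.

Lemma abs_sin_le1 (x : R) : `|sin x| <= 1.
Proof. by rewrite ler_norml sin_geN1 sin_le1. Qed.

Section IntegrationByParts.
Variable tau : R.

(** [h] is the derivative of [H]. As [H] vanishes at both infinities, [h] has integral 0, and this
    is the integration by parts. *)
Let H x := sin (tau * x + theta) * pdf x.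
Let h x := tau * (cos (tau * x + theta) * pdf x)
  + - (s ^+ 2)^-1 * (sin (tau * x + theta) * (x * pdf x)).

Let is_derive_H (x : R) : is_derive x (1 : R) H (h x).
Proof.
have d1 := is_derive_sin_affine tau theta x; have d2 := is_derive_pdf x.
apply: is_derive_eq; rewrite /GRing.scale /= /h; field.
exact: s_neq0.
Qed.

Let continuous_pdf : continuous pdf.
Proof. exact: continuous_normal_pdf. Qed.

Let continuous_h : continuous h.
Proof.
move=> x; apply: cvgD; apply: cvgM; try exact: cvg_cst.
  by apply: cvgM; [exact: continuous_cos_affine | exact: continuous_pdf].
apply: cvgM; [exact: continuous_sin_affine | apply: cvgM; [exact: cvg_id|]].
exact: continuous_pdf.
Qed.

Let cvg_H (e : R) : `|e| = 1 -> H (e * n%:R) @[n --> \oo] --> (0 : R).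
Proof.
move=> e1; apply: (@squeeze_cvgr _ _ _ _ (fun n => - (normal_peak s * 2 * s ^+ 2 / n%:R))
    (fun n => normal_peak s * 2 * s ^+ 2 / n%:R)).
- near=> n; rewrite -ler_norml /H normrM.
  apply: (@le_trans _ _ (pdf (e * n%:R))).
    by rewrite (ger0_norm (normal_pdf_ge0 _ _ _)) ler_piMl ?normal_pdf_ge0 ?abs_sin_le1.
  have n0 : (0 < n)%N by near: n; exact: nbhs_infty_gt.
  have n1 : 1 <= n%:R :> R by rewrite ler1n.
  have -> : normal_peak s * 2 * s ^+ 2 / n%:R = normal_peak s * (2 * s ^+ 2 / n%:R).
    by rewrite !mulrA.
  rewrite pdfE ler_wpM2l ?normal_peak_ge0 // expRN.
  have -> : (e * n%:R) ^+ 2 = n%:R ^+ 2 by rewrite -real_normK ?num_real // normrM e1 mul1r ger0_norm.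
  have -> : 2 * s ^+ 2 / n%:R = (n%:R / (2 * s ^+ 2))^-1 by rewrite invf_div.
  have s2 : 0 < 2 * s ^+ 2 by rewrite mulr_gt0 // exprn_gt0.
  rewrite lef_pV2 ?posrE ?expR_gt0 ?divr_gt0 ?(lt_le_trans _ n1) //.
  apply: le_trans (expR_ge1Dx _); rewrite ler_wpDl //.
  apply: ler_wpM2r; first by rewrite invr_ge0 ltW.
  by rewrite expr2 ler_peMl.
- rewrite -oppr0; apply: cvgN; rewrite -[X in _ --> X](mulr0 (normal_peak s * 2 * s ^+ 2)).
  by apply: cvgMr; apply/gtr0_cvgV0; [near=> n; rewrite ltr0n; near: n; exact: nbhs_infty_gt | exact: cvgr_idn].
- rewrite -[X in _ --> X](mulr0 (normal_peak s * 2 * s ^+ 2)).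
  by apply: cvgMr; apply/gtr0_cvgV0; [near=> n; rewrite ltr0n; near: n; exact: nbhs_infty_gt | exact: cvgr_idn].
Unshelve. all: by end_near. Qed.

Let integrable_h : leb.-integrable setT (EFin \o h).
Proof.
rewrite (_ : EFin \o h = (fun x => tau%:E * (cos (tau * x + theta) * pdf x)%:E
   + (- (s ^+ 2)^-1)%:E * (sin (tau * x + theta) * (x * pdf x))%:E)%E) //.
apply: integrableD => //; apply: integrableZl => //.
  by apply: integrable_bounded_pdf => [|x]; [exact: continuous_cos_affine | exact: abs_cos_le1].
by apply: integrable_x_bounded_pdf => [|x]; [exact: continuous_sin_affine | exact: abs_sin_le1].
Qed.

Let integral_h_itv n : (0 < n)%N ->
  (\int[leb]_(x in `[(- n%:R)%R, n%:R%R]) (h x)%:E =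
   (H n%:R)%:E - (H (- n%:R))%:E)%E.
Proof.
move=> n0; have cH x : {for x, continuous H}.
  by apply: differentiable_continuous; apply/derivable1_diffP; exact: (@ex_derive _ _ _ _ _ _ _ (is_derive_H x)).
apply: continuous_FTC2.
- by rewrite gtrN // ltr0n.
- exact/continuous_subspaceT/continuous_h.
- split.
  + by move=> x _; exact: (@ex_derive _ _ _ _ _ _ _ (is_derive_H x)).
  + exact/cvg_at_right_filter/cH.
  + exact/cvg_at_left_filter/cH.
- by move=> x _; rewrite derive1E; exact: (@derive_val _ _ _ _ _ _ _ (is_derive_H x)).
Qed.

(** The fundamental theorem of calculus on [-n, n] gives boundary terms that tend to 0; dominated
    convergence, with |h| as majorant, identifies the limit of these integrals. *)
Let integral_h : (\int[leb]_x (h x)%:E = 0)%E.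
Proof.
pose D n : set R := `[(- n%:R)%R, n%:R%R]%classic.
have mh := measurable_int leb integrable_h.
have [_ _ cvg_h] : [/\ leb.-integrable setT (EFin \o h),
    [sequence (\int[leb]_x `|((EFin \o h) \_ (D n)) x - (EFin \o h) x|)%E]_n
      @ \oo --> 0%E
  & [sequence (\int[leb]_x ((EFin \o h) \_ (D n)) x)%E]_n @ \oo -->
      (\int[leb]_x (h x)%:E)%E].
  apply: (@dominated_convergence _ _ _ leb setT measurableT
    (fun n => (EFin \o h) \_ (D n)) (EFin \o h) (fun x => `|(h x)%:E|%E)) => //.
  - move=> n; apply/(measurable_restrictT _ _).1; first exact: measurable_itv.
    exact: measurable_funTS.
  - apply: aeW => x _; apply: cvg_near_cst; near=> n.
    have Dx : D n x.
      by rewrite /D /= in_itv /= -ler_norml; near: n; exact: nbhs_infty_ger.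
    by rewrite patchE mem_set.
  - exact: integrable_abse.
  - apply: aeW => x n _; rewrite patchE; case: ifP => // _.
    by rewrite abse0 abse_ge0.
have cvg0 : (H (1 * n%:R) - H (- 1 * n%:R))%:E @[n --> \oo] --> (0 - 0)%:E.
  apply/cvg_EFin; first by near=> n.
  by apply: cvgB; apply: cvg_H; rewrite ?normrN normr1.
rewrite subr0 in cvg0.
rewrite -(cvg_lim (@ereal_hausdorff R) cvg_h); apply: cvg_lim => //.
apply: cvg_trans cvg0.
apply: near_eq_cvg; near=> n; rewrite /= -integral_mkcond integral_h_itv.
  by rewrite mul1r mulN1r.
by near: n; exact: nbhs_infty_gt.
Unshelve. all: by end_near. Qed.

Lemma Rintegral_sin_pdf :
  (\int[leb]_x (- (sin (tau * x + theta) * (x * pdf x))))%R =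
  - (s ^+ 2 * tau) * F tau.
Proof.
have ic : leb.-integrable setT (EFin \o (fun x => cos (tau * x + theta) * pdf x)).
  by apply: integrable_bounded_pdf => [|x]; [exact: continuous_cos_affine | exact: abs_cos_le1].
have is' : leb.-integrable setT (EFin \o (fun x => sin (tau * x + theta) * (x * pdf x))).
  by apply: integrable_x_bounded_pdf => [|x]; [exact: continuous_sin_affine | exact: abs_sin_le1].
have := congr1 fine integral_h; rewrite -/(Rintegral _ _ _) /h RintegralD //; last 2 first.
- exact: (integrableZl measurableT tau ic).
- exact: (integrableZl measurableT (- (s ^+ 2)^-1) is').
rewrite RintegralZl // RintegralZl // -/(F tau) /= => e.
under eq_Rintegral do rewrite -mulN1r.
rewrite RintegralZl //; move: e.
set I := Rintegral _ _ _; set J := F tau => e.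
have -> : I = s ^+ 2 * (tau * J - (tau * J + - s ^- 2 * I)).
  by field; exact: s_neq0.
by rewrite e; ring.
Qed.

End IntegrationByParts.

Let is_derive_F (tau : R) : is_derive tau (1 : R) F (- (s ^+ 2 * tau) * F tau).
Proof.
have dc (x y : R) : is_derive x (1 : R) (fun u => cos (u * y + theta) * pdf y)
    (- (sin (x * y + theta) * (y * pdf y))).
  by apply: is_derive_eq; rewrite /GRing.scale /=; ring.
have tauI : `](tau - 1), (tau + 1)[%classic tau.
  by rewrite /= in_itv /= ltrBlDr ltrDl ltr01.
have intf (x : R) : `](tau - 1), (tau + 1)[%classic x ->
    leb.-integrable setT (EFin \o (fun y => cos (x * y + theta) * pdf y)).
  by move=> _; apply: integrable_bounded_pdf => [|y]; [exact: continuous_cos_affine | exact: abs_cos_le1].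
have derf (x y : R) : `](tau - 1), (tau + 1)[%classic x -> setT y ->
    derivable (fun u : R => cos (u * y + theta) * pdf y) x 1.
  by move=> _ _; exact: (@ex_derive _ _ _ _ _ _ _ (dc x y)).
have pE (x y : R) : partial1of2 (fun u y : R => cos (u * y + theta) * pdf y) x y =
    - (sin (x * y + theta) * (y * pdf y)).
  by rewrite partial1of2E; exact: (@derive_val _ _ _ _ _ _ _ (dc x y)).
have G0 (y : R) : 0 <= `|y| * pdf y by rewrite mulr_ge0 // normal_pdf_ge0.
have Gub (x y : R) : `](tau - 1), (tau + 1)[%classic x -> setT y ->
    `|partial1of2 (fun u y : R => cos (u * y + theta) * pdf y) x y| <= `|y| * pdf y.
  move=> _ _; rewrite pE normrN normrM (normrM y) (ger0_norm (normal_pdf_ge0 _ _ _)).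
  by rewrite ler_piMl // abs_sin_le1.
have dF := derivable_under_integral measurableT tauI intf derf G0 integrable_abs_pdf Gub.
have vF := differentiation_under_integral measurableT tauI intf derf G0 integrable_abs_pdf Gub.
apply: DeriveDef; first exact: dF.
rewrite -derive1E [LHS]vF -Rintegral_sin_pdf.
by apply: eq_Rintegral => x _; exact: pE.
Qed.

(** F' = - s^2 tau F, by differentiation under the integral and integration by parts; hence F (tau)
    exp (s^2 tau^2 / 2) is constant and equal to F (0) = cos theta. *)
Lemma normal_characteristic_function (tau : R) :
  (\int[leb]_x (cos (tau * x + theta) * pdf x))%R =
  cos theta * expR (- (s ^+ 2 * tau ^+ 2 / 2)).
Proof.
have dg (x : R) : is_derive x (1 : R) (fun u => F u * expR (s ^+ 2 * u ^+ 2 / 2)) 0.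
  have d1 := is_derive_F x.
  by apply: is_derive_eq; rewrite /GRing.scale /=; field.
have := is_derive_0_is_cst tau 0 dg.
rewrite expr0n mulr0 mul0r expR0 mulr1 -/(F tau) => e.
have -> : F tau = F tau * expR (s ^+ 2 * tau ^+ 2 / 2) * expR (- (s ^+ 2 * tau ^+ 2 / 2)).
  by rewrite -mulrA -expRD subrr expR0 mulr1.
rewrite e; congr (_ * _); rewrite /F.
under eq_Rintegral do rewrite mul0r add0r.
rewrite RintegralZl //; last exact: integrable_normal_pdf.
by rewrite /Rintegral integral_normal_pdf mulr1.
Qed.

End NormalCharacteristicFunction.

(** * Trigonometric approximation and Levy continuity *)

Section Bernstein.
Variable R : realType.
Implicit Types (h : nat -> R) (u : R).

(* The Bernstein operator: the mean of [h] over a binomial variable with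
   parameters [n] and [u]. *)
Fixpoint bernstein n h u : R :=
  if n is m.+1 then
    u * bernstein m (fun k => h k.+1) u + (1 - u) * bernstein m h u
  else h 0%N.

Lemma bernstein_le n h h' u : 0 <= u <= 1 -> (forall k, h k <= h' k) ->
  bernstein n h u <= bernstein n h' u.
Proof.
move=> /andP[u0 u1]; elim: n h h' => [|n IH] h h' hh' //=.
by apply: lerD; apply: ler_wpM2l; rewrite ?subr_ge0 // IH.
Qed.

Lemma bernstein_affine n h u a b :
  bernstein n (fun k => a * h k + b) u = a * bernstein n h u + b.
Proof. by elim: n h => [|n IH] h //=; rewrite !IH; ring. Qed.

Lemma bernstein_sqr_dev n u c : bernstein n (fun k => (k%:R - c) ^+ 2) u =
  n%:R * u * (1 - u) + (n%:R * u - c) ^+ 2.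
Proof.
elim: n c => [|n IH] c /=; first by ring.
rewrite (_ : (fun k => (k.+1%:R - c) ^+ 2) = fun k => (k%:R - (c - 1)) ^+ 2); last first.
  by apply/funext => k; rewrite -natr1; congr (_ ^+ 2); ring.
by rewrite !IH -natr1; ring.
Qed.

(** Only [x] is confined to the segment: [bernstein_approx] compares f at a point of [0, 1] with f
    at k/n for every natural k, also beyond n. *)
Lemma continuous_segment_uniform (f : R -> R) (a b e : R) : continuous f -> 0 < e ->
  exists2 d, 0 < d & forall x y, a <= x <= b -> `|x - y| < d -> `|f x - f y| < e.
Proof.
move=> cf e0.
have /compact_near_coveringP cpt := @segment_compact R a b.
have := cpt R (0 : R)^'+ (fun d x => forall y, `|x - y| < d -> `|f x - f y| < e) _.
case.
  move=> x _; have e2 : 0 < e / 2 by rewrite divr_gt0.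
  have /cvgrPdist_lt/(_ _ e2) := cf x; rewrite near_simpl.
  case=> r /= r0 xr; exists (ball x (r / 2), [set d | d < r / 2]) => /=.
    split; first by exists (r / 2) => //=; rewrite divr_gt0.
    exists (r / 2) => /=; first by rewrite divr_gt0.
    by move=> d /=; rewrite sub0r normrN => /ltr_normlW + _.
  move=> [x' d] /= [xx' dr] y x'y; rewrite /ball /= in xx'.
  have h1 : `|f x - f x'| < e / 2 by apply: xr => /=; lra.
  have h2 : `|f x - f y| < e / 2.
    apply: xr => /=; have := ler_distD x' x y; lra.
  have := ler_distD (f x) (f x') (f y); rewrite [`|f x' - f x|]distrC; lra.
move=> r /= r0 H; exists (r / 2); first by rewrite divr_gt0.
move=> x y xab; apply: (H (r / 2)) => //=.
- by rewrite sub0r normrN gtr0_norm ?divr_gt0 //; lra.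
- by rewrite divr_gt0.
Qed.

(** Bernstein's argument: uniform continuity handles the nodes within [d] of [u], and Chebyshev's
    inequality for the binomial law handles the others, where the difference is at most 2 B. *)
Lemma bernstein_approx (f : R -> R) (B e : R) : continuous f ->
  (forall x, `|f x| <= B) -> 0 < e ->
  exists n, forall u, 0 <= u <= 1 ->
    `|bernstein n (fun k => f (k%:R / n%:R)) u - f u| <= e.
Proof.
move=> cf fB e0; have e2 : 0 < e / 2 by rewrite divr_gt0.
have B0 : 0 <= B by apply: le_trans (fB 0).
have [d d0 fd] := @continuous_segment_uniform f 0 1 _ cf e2.
(* Large enough for the Chebyshev term 2 B u (1 - u) / (d^2 n) to be at most e / 2. *)
pose n := (Num.truncn (4 * B / (d ^+ 2 * e))).+1.
have n0 : 0 < n%:R :> R by rewrite ltr0n.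
have nB : 2 * B / (d ^+ 2 * n%:R) <= e / 2.
  rewrite ler_pdivrMr; last by rewrite mulr_gt0 // exprn_gt0.
  have /ltW : 4 * B / (d ^+ 2 * e) < n%:R by exact: truncnS_gt.
  rewrite ler_pdivrMr; last by rewrite mulr_gt0 // exprn_gt0.
  by lra.
exists n => u u01.
have pt k : `|f (k%:R / n%:R) - f u| <=
    2 * B / (d ^+ 2 * n%:R ^+ 2) * (k%:R - n%:R * u) ^+ 2 + e / 2.
  have dev : (k%:R - n%:R * u) ^+ 2 = n%:R ^+ 2 * (u - k%:R / n%:R) ^+ 2.
    by field; rewrite gt_eqF.
  have -> : 2 * B / (d ^+ 2 * n%:R ^+ 2) * (k%:R - n%:R * u) ^+ 2 =
     2 * B * ((u - k%:R / n%:R) ^+ 2 / d ^+ 2).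
    by rewrite dev; field; rewrite !gt_eqF.
  have q0 : 0 <= (u - k%:R / n%:R) ^+ 2 / d ^+ 2.
    by rewrite divr_ge0 // sqr_ge0.
  have [lt_d|ge_d] := ltP `|u - k%:R / n%:R| d.
    have := fd _ _ u01 lt_d; rewrite distrC.
    have := mulr_ge0 (mulr_ge0 (ler0n R 2) B0) q0; lra.
  have q1 : 1 <= (u - k%:R / n%:R) ^+ 2 / d ^+ 2.
    rewrite ler_pdivlMr ?exprn_gt0 // mul1r -[leRHS]real_normK ?num_real //.
    by rewrite ler_pXn2r ?nnegrE // ltW.
  have := ler_normB (f (k%:R / n%:R)) (f u); have := fB u.
  have := fB (k%:R / n%:R); have := ler_wpM2l (mulr_ge0 (ler0n R 2) B0) q1; lra.
have /andP[u0 u1] := u01.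
set h := fun k => f (k%:R / n%:R).
have -> : bernstein n h u - f u = bernstein n (fun k => 1 * h k + - f u) u.
  by rewrite bernstein_affine mul1r.
have total : bernstein n (fun k => 2 * B / (d ^+ 2 * n%:R ^+ 2) *
    (k%:R - n%:R * u) ^+ 2 + e / 2) u <= e.
  rewrite bernstein_affine bernstein_sqr_dev subrr expr0n addr0.
  have -> : 2 * B / (d ^+ 2 * n%:R ^+ 2) * (n%:R * u * (1 - u)) =
    2 * B / (d ^+ 2 * n%:R) * (u * (1 - u)) by field; rewrite !gt_eqF.
  have c0 : 0 <= 2 * B / (d ^+ 2 * n%:R).
    by rewrite divr_ge0 // mulr_ge0 // sqr_ge0.
  have uu : u * (1 - u) <= 1 by nra.
  have := ler_wpM2l c0 uu; lra.
rewrite ler_norml; apply/andP; split; last first.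
  apply: le_trans total; apply: bernstein_le => // k.
  by apply: le_trans (pt k); rewrite mul1r ler_norm.
rewrite lerNl -mulN1r -[-1 * _]addr0 -bernstein_affine.
apply: le_trans total; apply: bernstein_le => // k.
by apply: le_trans (pt k); rewrite mul1r addr0 mulN1r -normrN ler_norm.
Qed.

End Bernstein.

Section TrigonometricPolynomials.
Variable R : realType.

(** The real form of finite exponential sums with arbitrary real frequencies; the phases make sines
    unnecessary as generators. *)
Inductive trig_poly : (R -> R) -> Prop :=
| TrigCos tau theta : trig_poly (fun x => cos (tau * x + theta))
| TrigAdd g h : trig_poly g -> trig_poly h -> trig_poly (fun x => g x + h x)
| TrigScale c g : trig_poly g -> trig_poly (fun x => c * g x).

Lemma trig_poly_cst c : trig_poly (fun=> c).
Proof.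
rewrite (_ : (fun=> c) = fun x => c * cos (0 * x + 0)).
  exact/TrigScale/TrigCos.
by apply/funext => x; rewrite mul0r addr0 cos0 mulr1.
Qed.

Lemma trig_poly_mul_sin a g : trig_poly g -> trig_poly (fun x => g x * sin (a * x)).
Proof.
elim=> {g} [tau theta|g h _ IHg _ IHh|c g _ IH].
- rewrite (_ : (fun x => _) = fun x => 2^-1 * cos ((tau + a) * x + (theta - pi / 2))
    + 2^-1 * cos ((tau - a) * x + (theta + pi / 2))).
    by apply: TrigAdd; apply: TrigScale; exact: TrigCos.
  apply/funext => x.
  have -> : (tau + a) * x + (theta - pi / 2) = (tau * x + theta) + (a * x - pi / 2) by ring.
  have -> : (tau - a) * x + (theta + pi / 2) = (tau * x + theta) - (a * x - pi / 2) by ring.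
  have -> : sin (a * x) = cos (a * x - pi / 2).
    by rewrite cosB cos_pihalf sin_pihalf mulr0 add0r mulr1.
  by rewrite [cos (tau * x + theta - _)]cosB [cos (_ + (a * x - _))]cosD; field.
- rewrite (_ : (fun x => _) = fun x => g x * sin (a * x) + h x * sin (a * x)).
    exact: TrigAdd.
  by apply/funext => x; rewrite mulrDl.
- rewrite (_ : (fun x => _) = fun x => c * (g x * sin (a * x))).
    exact: TrigScale.
  by apply/funext => x; rewrite mulrA.
Qed.

Lemma trig_poly_bernstein a n h :
  trig_poly (fun x => bernstein n h ((1 + sin (a * x)) / 2)).
Proof.
elim: n h => [|n IH] h /=; first exact: trig_poly_cst.
set p := fun x => bernstein n (fun k => h k.+1) ((1 + sin (a * x)) / 2).
set q := fun x => bernstein n h ((1 + sin (a * x)) / 2).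
rewrite (_ : (fun x => _) = fun x => (2^-1 * p x + 2^-1 * (p x * sin (a * x)))
   + (2^-1 * q x + - 2^-1 * (q x * sin (a * x)))).
  have tp : trig_poly p by exact: IH.
  have tq : trig_poly q by exact: IH.
  apply: TrigAdd; apply: TrigAdd; apply: TrigScale => //;
    exact: trig_poly_mul_sin.
by apply/funext => x; rewrite -/(p x) -/(q x); field.
Qed.

(** On [-M, M] the argument x / (2 M) stays in [-1/2, 1/2], where the sine is invertible, so f is a
    continuous function [phi] of u = (1 + sin (x / (2 M))) / 2. A Bernstein polynomial of [phi] in u
    is a trigonometric polynomial, and since u never leaves [0, 1] its bound holds on the whole
    line. *)
Lemma trig_poly_approx (f : R -> R) (B M e : R) : continuous f ->
  (forall x, `|f x| <= B) -> 0 < M -> 0 < e ->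
  exists g, [/\ trig_poly g, forall x, `|g x| <= B + e
    & forall x, `|x| <= M -> `|f x - g x| <= e].
Proof.
move=> cf fB M0 e0.
(* Clamping keeps the argument of [asin] away from the endpoints -1 and 1, which makes [phi]
   continuous on all of R; it changes nothing for |x| <= M, since |sin y| <= |y| <= 1/2. *)
pose clamp (z : R) := Num.max (- 2^-1) (Num.min 2^-1 z).
have clampP z : - 2^-1 <= clamp z <= 2^-1.
  by rewrite /clamp le_max lexx /= ge_max ge_min lexx andbT; lra.
pose phi u := f (2 * M * asin (clamp (2 * u - 1))).
have cclamp : continuous (fun u : R => clamp (2 * u - 1)).
  move=> u.
  have cmin : {for u, continuous ((cst 2^-1 : R -> R^o) \min (fun v : R => 2 * v - 1 : R^o))}.
    by apply: continuous_min; [exact: cst_continuous | exact: continuous_affine].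
  have cmax : {for u, continuous (cst (- 2^-1 : R^o))} by exact: cst_continuous.
  exact: (continuous_max cmax cmin).
have casin : continuous (fun u : R => asin (clamp (2 * u - 1))).
  move=> u; apply: (cvg_comp _ _ (cclamp u)).
  by apply: continuous_asin; have := clampP (2 * u - 1); lra.
have cphi : continuous phi.
  move=> u; apply: (cvg_comp (fun u => 2 * M * asin (clamp (2 * u - 1))) f _ (cf _)).
  by apply: cvgM; [exact: cvg_cst | exact: casin].
have [n hn] := bernstein_approx cphi (fun u => fB _) e0.
pose u x : R := (1 + sin ((2 * M)^-1 * x)) / 2.
have u01 x : 0 <= u x <= 1.
  by rewrite /u; have := sin_geN1 ((2 * M)^-1 * x); have := sin_le1 ((2 * M)^-1 * x); lra.
exists (fun x => bernstein n (fun k => phi (k%:R / n%:R)) (u x)); split.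
- exact: trig_poly_bernstein.
- move=> x; have := hn _ (u01 x); set b := bernstein _ _ _ => hb.
  have -> : b = (b - phi (u x)) + phi (u x) by rewrite subrK.
  by apply: le_trans (ler_normD _ _) _; rewrite addrC; apply: lerD; [exact: fB | exact: hb].
move=> x xM; suff -> : f x = phi (u x) by rewrite distrC; exact: hn.
have M2 : 2 * M != 0 by rewrite mulf_neq0 // gt_eqF.
have x2 : `|(2 * M)^-1 * x| <= 2^-1.
  have M20 : 0 < 2 * M by rewrite mulr_gt0.
  rewrite normrM (gtr0_norm (_ : 0 < (2 * M)^-1)) ?invr_gt0 // ler_pdivrMl //.
  by apply: le_trans xM _; lra.
have sx : `|sin ((2 * M)^-1 * x)| <= 2^-1 by apply: le_trans (abs_sin_le _) _.
have e1 : 2 * u x - 1 = sin ((2 * M)^-1 * x) by rewrite /u; field.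
rewrite /phi e1; have -> : clamp (sin ((2 * M)^-1 * x)) = sin ((2 * M)^-1 * x).
  move: sx; rewrite ler_norml /clamp => /andP[s1 s2].
  by rewrite (min_idPr s2) (max_idPr s1).
rewrite sinK ?mulrA ?divff ?mul1r //.
by rewrite in_itv /=; move: x2; rewrite ler_norml; have := pihalf_ge1 R; lra.
Qed.

End TrigonometricPolynomials.

Section LevyContinuity.
Variable R : realType.

Section FiniteExpectation.
Variable Om : finType.
Implicit Types f g : Om -> R.

Lemma Ex_le f g : (forall w, f w <= g w) -> Ex f <= Ex g.
Proof. by move=> fg; rewrite ler_wpM2r ?invr_ge0 // ler_sum. Qed.

Lemma ExD f g : Ex (fun w => f w + g w) = Ex f + Ex g.
Proof. by rewrite /Ex big_split mulrDl. Qed.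

Lemma ExZ (c : R) f : Ex (fun w => c * f w) = c * Ex f.
Proof. by rewrite /Ex -mulr_sumr mulrA. Qed.

Lemma ExN f : Ex (fun w => - f w) = - Ex f.
Proof. by rewrite /Ex sumrN mulNr. Qed.

Lemma ExB f g : Ex (fun w => f w - g w) = Ex f - Ex g.
Proof. by rewrite ExD ExN. Qed.

Lemma Ex_cst (c : R) : (0 < #|Om|)%N -> Ex (fun _ : Om => c) = c.
Proof.
by move=> Om0; rewrite /Ex sumr_const -[c *+ _]mulr_natr mulfK // pnatr_eq0 -lt0n.
Qed.

Lemma Ex_norm_le f : `|Ex f| <= Ex (fun w => `|f w|).
Proof.
rewrite ler_norml -ExN; apply/andP; split; apply: Ex_le => w;
by have := ler_norm (f w); have := ler_norm (- f w); rewrite normrN; lra.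
Qed.

(** Only an inequality, because on an empty sample space the expectation is 0. *)
Lemma Ex_cst_le (c : R) : 0 <= c -> Ex (fun _ : Om => c) <= c.
Proof.
move=> c0; have [Om0|Om0] := posnP #|Om|; last by rewrite Ex_cst.
by rewrite /Ex Om0 invr0 mulr0.
Qed.

End FiniteExpectation.

Section Integrals.
Variable mu : probability (measurableTypeR R) R.

Lemma integrable_continuous_bounded (f : R -> R) B : continuous f ->
  (forall x, `|f x| <= B) -> mu.-integrable setT (EFin \o f).
Proof.
move=> cf fB; apply: measurable_bounded_integrable => //.
- exact: (le_lt_trans (probability_le1 _ _) (ltry _)).
- exact: continuous_measurable_fun.
- by exists B; split; [exact: num_real | move=> x Bx y _ /=; exact: le_trans (ltW Bx)].
Qed.

Lemma trig_poly_continuous_bounded (g : R -> R) : trig_poly g ->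
  continuous g /\ exists B, forall x, `|g x| <= B.
Proof.
elim=> {g} [tau theta|g h _ [cg [B gB]] _ [ch [C hC]]|c g _ [cg [B gB]]].
- by split; [exact: continuous_cos_affine | exists 1 => x; exact: abs_cos_le1].
- split; first by move=> x; apply: cvgD; [exact: cg | exact: ch].
  by exists (B + C) => x; apply: le_trans (ler_normD _ _) _; apply: lerD.
- split; first by move=> x; apply: cvgM; [exact: cvg_cst | exact: cg].
  by exists (`|c| * B) => x; rewrite normrM ler_wpM2l.
Qed.

Lemma trig_poly_integrable (g : R -> R) : trig_poly g ->
  mu.-integrable setT (EFin \o g).
Proof.
move=> /trig_poly_continuous_bounded[cg [B gB]].
exact: integrable_continuous_bounded gB.
Qed.

Lemma measurable_norm_gt (M : R) : measurable [set x : R | M < `|x|].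
Proof.
rewrite (_ : [set x | _] = (fun x : R => `|x|) @^-1` `]M, +oo[%classic).
  by rewrite -[X in measurable X]setTI; exact: normr_measurable.
by apply/seteqP; split=> x /=; rewrite in_itv /= andbT.
Qed.

Lemma probability_tight e : 0 < e ->
  exists2 M, 0 < M & fine (mu [set x | M < `|x|]) <= e.
Proof.
move=> e0; pose D n : set R := [set x | n.+1%:R < `|x|].
have mD n : measurable (D n) by exact: measurable_norm_gt.
have D0 : \bigcap_n D n = set0.
  apply/seteqP; split=> // x /(_ (Num.truncn `|x|) I) /=.
  by rewrite /D /= ltNge ltW // truncnS_gt.
have : mu \o D @ \oo --> mu (\bigcap_n D n).
  apply: nonincreasing_cvg_mu => //.
  - by apply: le_lt_trans (probability_le1 mu (mD 0%N)) _; exact: ltry.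
  - by rewrite D0.
  - move=> m n mn; apply/subsetPset => x /=; rewrite /D /=; apply: le_lt_trans.
    by rewrite ler_nat.
rewrite D0 measure0 => /fine_cvgP[_ /cvgrPdist_le/(_ _ e0)].
case=> n _ /(_ n (leqnn n)) /=; rewrite sub0r normrN => h.
by exists n.+1%:R => //; apply: le_trans h; exact: ler_norm.
Qed.

End Integrals.

Section Convergence.
Variables (Om : nat -> finType) (Z : forall n, Om n -> R).
Variable mu : probability (measurableTypeR R) R.
Hypothesis cvg_cos : forall tau theta,
  Ex (fun w => cos (tau * @Z n w + theta)) @[n --> \oo] -->
  (\int[mu]_x cos (tau * x + theta))%R.
Variable K : R.
Hypothesis Z2_le : \forall n \near \oo, Ex (fun w => @Z n w ^+ 2) <= K.

Lemma cvg_trig_poly g : trig_poly g ->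
  Ex (fun w => g (@Z n w)) @[n --> \oo] --> (\int[mu]_x g x)%R.
Proof.
elim=> {g} [tau theta|g h tg IHg th IHh|c g tg IH]; first exact: cvg_cos.
- rewrite RintegralD //; try exact: trig_poly_integrable.
  rewrite (_ : (fun n => _) = fun n => Ex (fun w => g (@Z n w)) + Ex (fun w => h (@Z n w))).
    exact: cvgD.
  by apply/funext => n; rewrite ExD.
- rewrite RintegralZl //; last exact: trig_poly_integrable.
  rewrite (_ : (fun n => _) = fun n => c * Ex (fun w => g (@Z n w))).
    by apply: cvgM => //; exact: cvg_cst.
  by apply/funext => n; rewrite ExZ.
Qed.

(** Replace [f] by a trigonometric polynomial [g] close to it on [-M, M] and bounded everywhere.
    Outside, the samples are controlled by the uniform second moment through Chebyshev, and [mu] by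
    its own tightness. *)
Theorem levy_continuity : cvg_in_law Z mu.
Proof.
move=> f cf [B fB].
have B0 : 0 <= B by apply: le_trans (fB 0).
have K0 : 0 <= `|K| by [].
apply/cvgrPdist_le => e e0.
(* Five errors of size [e1] add up below: two for each replacement of [f] by [g], one for the
   convergence on [g]. The cap at 1 allows C = 2 B + 1 as a bound for |f - g|. *)
pose e1 := Num.min 1 (e / 8).
have e10 : 0 < e1 by rewrite lt_min ltr01 divr_gt0.
have e11 : e1 <= 1 by rewrite ge_min lexx.
have e18 : e1 <= e / 8 by rewrite ge_min lexx orbT.
pose C := 2 * B + 1.
have C0 : 0 < C by rewrite /C; lra.
have [M1 M10 tight] : exists2 M, 0 < M & fine (mu [set x | M < `|x|]) <= e1 / C.
  by apply: probability_tight; rewrite divr_gt0.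
pose M := Num.max M1 (1 + C * `|K| / e1).
have M0 : 0 < M by rewrite lt_max M10.
have M1M : M1 <= M by rewrite le_max lexx.
have MK : C * `|K| / M ^+ 2 <= e1.
  rewrite ler_pdivrMr ?exprn_gt0 //.
  have q0 : 0 <= C * `|K| / e1 by rewrite divr_ge0 ?mulr_ge0 // ltW.
  have MM : 1 + C * `|K| / e1 <= M by rewrite le_max lexx orbT.
  have : 1 + C * `|K| / e1 <= M ^+ 2.
    have M_ge1 : 1 <= M by apply: le_trans MM; lra.
    by apply: le_trans MM _; rewrite expr2 ler_peMl // ltW.
  move=> /(ler_wpM2l (ltW e10)); apply: le_trans.
  by rewrite mulrDr mulr1 mulrCA divff ?gt_eqF // mulr1; lra.
have [g [tg gB gf]] := trig_poly_approx cf fB M0 e10.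
have [cg _] := trig_poly_continuous_bounded tg.
have fg_le x : `|f x - g x| <= C.
  apply: le_trans (ler_normB _ _) _; rewrite /C.
  by have := fB x; have := gB x; lra.
(* Chebyshev in pointwise form: a quadratic majorant of the error, ready to be averaged. *)
have fg_sqr x : `|f x - g x| <= e1 + C / M ^+ 2 * x ^+ 2.
  have [xM|xM] := leP `|x| M.
    by apply: le_trans (gf x xM) _; rewrite lerDl mulr_ge0 ?sqr_ge0 // divr_ge0 ?sqr_ge0 // ltW.
  apply: le_trans (fg_le x) _; rewrite ler_wpDl ?(ltW e10) //.
  rewrite mulrAC ler_pdivlMr ?exprn_gt0 // ler_wpM2l ?(ltW C0) //.
  by rewrite -[leRHS]real_normK ?num_real // ler_pXn2r ?nnegrE ?(ltW M0) // ltW.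
have intf : mu.-integrable setT (EFin \o f) by exact: integrable_continuous_bounded fB.
have intg : mu.-integrable setT (EFin \o g) by exact: trig_poly_integrable.
have limit_gap : `|(\int[mu]_x f x)%R - (\int[mu]_x g x)%R| <= 2 * e1.
  rewrite -RintegralB //.
  have cfg : continuous (fun x => f x - g x).
    by move=> x; apply: cvgB; [exact: cf | exact: cg].
  have int_fg : mu.-integrable setT (EFin \o (fun x => f x - g x)).
    exact: integrable_continuous_bounded fg_le.
  apply: le_trans (le_normr_Rintegral measurableT int_fg) _.
  pose D := [set x : R | M1 < `|x|].
  have mD : measurable D by exact: measurable_norm_gt.
  have iD : mu.-integrable setT (EFin \o (\1_D : R -> R)).
    exact: (integrable_indic mu mD).
  apply: (@le_trans _ _ (\int[mu]_x (e1 + C * \1_D x))%R).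
    apply: le_Rintegral => //.
    - apply: (@integrable_continuous_bounded mu _ C) => x.
        exact: cvg_norm (cfg x).
      by rewrite normr_id.
    - apply: (@integrableD _ _ _ mu setT measurableT (EFin \o cst e1) (fun x => C%:E * (\1_D x)%:E)%E).
        exact: finite_measure_integrable_cst.
      exact: integrableZl.
    - move=> x _; rewrite indicE; have [xM|xM] := leP `|x| M1.
        rewrite memNset ?mulr0 ?addr0; first exact: gf (le_trans xM M1M).
        by rewrite /D /=; apply/negP; rewrite -leNgt.
      by rewrite mem_set // mulr1 ler_wpDl // ltW.
  rewrite RintegralD //; last 2 first.
  - exact: finite_measure_integrable_cst.
  - exact: integrableZl iD.
  rewrite RintegralZl // Rintegral_cst //. rewrite [X in e1 * fine X](_ : _ = 1%E); last exact: probability_setT.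
  rewrite /= mulr1.
  rewrite /Rintegral integral_indic // setIT.
  have := ler_wpM2l (ltW C0) tight; rewrite mulrCA divff ?gt_eqF // mulr1.
  by lra.
have /cvgrPdist_le/(_ _ e10) := cvg_trig_poly tg.
apply: filterS2 Z2_le => n Z2 gn.
have sample_gap : `|Ex (fun w => f (@Z n w)) - Ex (fun w => g (@Z n w))| <= 2 * e1.
  rewrite -ExB; apply: le_trans (Ex_norm_le _) _.
  apply: (@le_trans _ _ (Ex (fun w => e1 + C / M ^+ 2 * @Z n w ^+ 2))); first exact: Ex_le.
  rewrite ExD ExZ mulr_natl mulr2n; apply: lerD; first exact: Ex_cst_le (ltW _).
  apply: le_trans MK; rewrite mulrAC ler_wpM2r ?invr_ge0 ?sqr_ge0 //.
  by rewrite ler_wpM2l ?(ltW C0) // (le_trans Z2) // ler_norm.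
rewrite -(subrK (\int[mu]_x g x)%R (\int[mu]_x f x)%R) -addrA.
apply: le_trans (ler_normD _ _) _.
have -> : (\int[mu]_x g x)%R - Ex (fun w => f (@Z n w)) =
  ((\int[mu]_x g x)%R - Ex (fun w => g (@Z n w))) +
  (Ex (fun w => g (@Z n w)) - Ex (fun w => f (@Z n w))) by ring.
have := ler_normD ((\int[mu]_x g x)%R - Ex (fun w => g (@Z n w)))
  (Ex (fun w => g (@Z n w)) - Ex (fun w => f (@Z n w))).
rewrite distrC in sample_gap; lra.
Qed.

End Convergence.

(** Both branches of [centered_normal] obey one formula, so that the degenerate limit is covered by
    the same argument as the normal one. *)
Lemma centered_normal_cos (v : R) tau theta : 0 <= v ->
  (\int[centered_normal v]_x cos (tau * x + theta))%R =
  cos theta * expR (- (v * tau ^+ 2 / 2)).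
Proof.
move=> v0; have ccos := @continuous_cos_affine R tau theta.
have mcos : measurable_fun setT (fun x : R => cos (tau * x + theta)).
  exact: continuous_measurable_fun.
rewrite /centered_normal; case: eqVneq => [->|vn0].
  rewrite !mul0r oppr0 expR0 mulr1 /Rintegral integral_dirac //=.
    by rewrite indicT mul1r mulr0 add0r.
  exact/measurable_EFinP.
have s0 : 0 < Num.sqrt v by rewrite sqrtr_gt0 lt_neqAle eq_sym vn0.
have := normal_characteristic_function s0 theta tau; rewrite sqr_sqrtr // => <-.
rewrite /Rintegral integral_normal_prob //.
apply: (@integrable_continuous_bounded
  [the probability _ _ of normal_prob 0 (Num.sqrt v)] _ 1) => // x.
exact: abs_cos_le1.
Qed.

End LevyContinuity.

(** * Additive functionals of the random binary search tree *)

Section AdditiveFunctional.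
Variables (R : realType) (X : bintree -> R) (t : bintree -> bintree -> R).
Hypothesis X_node : forall l r, X (BNode l r) = X l + X r + t l r.
Hypothesis X_empty : `|X BEmpty| <= 1.
Hypothesis t_le1 : forall l r, `|t l r| <= 1.

(** The value at 0 is chosen so that the recurrence for the mean holds at [n = 0] as well. *)
Definition toll_mean n := if n is m.+1 then splitE m t else X BEmpty.

Lemma toll_mean_le1 n : `|toll_mean n| <= 1.
Proof.
case: n => [|n] //=; rewrite -(splitE_cst n 1).
by apply: splitE_norm_le => l r _; exact: t_le1.
Qed.

Lemma additive_mean n :
  bstE n X = toll_mean n + n.+1%:R * bst_series toll_mean n.
Proof.
apply: (@divide_rec R (fun n => bstE n X)) => -[|k] /=.
  by rewrite big_ord0 mulr0 addr0.
rewrite bstES (splitE_eq (k' := fun l r => (X l + X r) + t l r)); last first.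
  by move=> l r _; rewrite X_node.
by rewrite splitED splitED splitEl splitEr addrC; congr (_ + _); ring.
Qed.

Lemma additive_mean_linear :
  exists m, forall n, `|bstE n X - n.+1%:R * m| <= 3.
Proof.
have [m hm] := bst_series_bounded toll_mean_le1.
exists m => n; rewrite additive_mean.
have -> : toll_mean n + n.+1%:R * bst_series toll_mean n - n.+1%:R * m =
    toll_mean n + n.+1%:R * (bst_series toll_mean n - m) by ring.
apply: le_trans (ler_normD _ _) _; rewrite normrM ger0_norm //.
have h : n.+1%:R * `|bst_series toll_mean n - m| <= 2.
  apply: le_trans (ler_wpM2l _ (hm n)) _ => //.
  by rewrite mulrC mulr1 divfK.
by have := toll_mean_le1 n; lra.
Qed.

Definition centered T := X T - bstE (bt_size T) X.

Definition centered_toll l r :=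
  t l r + bstE (bt_size l) X + bstE (bt_size r) X
  - bstE (bt_size l + bt_size r).+1 X.

Definition variance n := bstE n (fun T => centered T ^+ 2).

Let W l r := centered l + centered r.

(** The source term in the recurrence for the variance. The product with [W] is the covariance
    between the toll and the counts in the subtrees; it need not vanish and is of order sqrt n. *)
Definition variance_toll n := if n is m.+1 then
    splitE m (fun l r => centered_toll l r ^+ 2 + 2 * (centered_toll l r * W l r))
  else 0.

Lemma centered_node l r :
  centered (BNode l r) = W l r + centered_toll l r.
Proof. by rewrite /W /centered /centered_toll X_node /=; ring. Qed.

(** The linear parts of the three means cancel since (i+1) + (j+1) = (i+j+1) + 1; there remain 1 for
    the toll and three errors of at most 3. *)
Lemma centered_toll_le l r : `|centered_toll l r| <= 10.
Proof.
have [m hm] := additive_mean_linear.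
have := t_le1 l r; have := hm (bt_size l); have := hm (bt_size r).
have := hm (bt_size l + bt_size r).+1; rewrite /centered_toll.
rewrite -!natr1 natrD !ler_norml => /andP[? ?] /andP[? ?] /andP[? ?] /andP[? ?].
by apply/andP; split; lra.
Qed.

Lemma bstE_centered n : bstE n centered = 0.
Proof.
rewrite (@bstE_eq _ _ _ (fun T => X T - bstE n X)) ; last by move=> T Tn; rewrite /centered Tn.
by rewrite bstEB bstE_cst subrr.
Qed.

Lemma splitE_W n : splitE n W = 0.
Proof.
rewrite splitED splitEl splitEr; under eq_bigr do rewrite bstE_centered.
by rewrite sumr_const mul0rn mul0r addr0.
Qed.

Lemma splitE_centered_toll n : splitE n centered_toll = 0.
Proof.
have := bstE_centered n.+1; rewrite bstES.
rewrite (splitE_eq (k' := fun l r => W l r + centered_toll l r)) => [|l r _].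
  by rewrite splitED splitE_W add0r.
exact: centered_node.
Qed.

(** The cross term vanishes: given the sizes, the two subtrees are independent and both counts are
    centered. *)
Lemma splitE_W2 n : splitE n (fun l r => W l r ^+ 2) =
  2 / n.+1%:R * \sum_(j < n.+1) variance j.
Proof.
rewrite (splitE_eq (k' := fun l r =>
    centered l ^+ 2 + centered r ^+ 2 + 2 * (centered l * centered r))); last first.
  by move=> l r _; rewrite /W; ring.
rewrite splitED splitED splitEl splitEr splitEZ splitEM.
rewrite (_ : \sum_(j < n.+1) bstE j centered * _ = 0); first by ring.
by apply: big1 => j _; rewrite bstE_centered mul0r.
Qed.

Lemma variance0 : variance 0 = 0.
Proof. by rewrite /variance bstE0 /centered bstE0 subrr expr0n. Qed.

Lemma variance_rec n :
  variance n = variance_toll n + 2 / n%:R * \sum_(j < n) variance j.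
Proof.
case: n => [|n] /=; first by rewrite big_ord0 mulr0 addr0 variance0.
rewrite -splitE_W2 -splitED /variance bstES; apply: splitE_eq => l r _.
by rewrite centered_node; ring.
Qed.

Lemma variance_series n :
  variance n = variance_toll n + n.+1%:R * bst_series variance_toll n.
Proof. exact/divide_rec/variance_rec. Qed.

Lemma variance_ge0 n : 0 <= variance n.
Proof.
by rewrite -(bstE_cst n 0); apply: bstE_le => T _; exact: sqr_ge0.
Qed.

Lemma splitE_absW_le n K : 0 <= K ->
  (forall j, (j <= n)%N -> variance j <= K ^+ 2 * j.+1%:R) ->
  splitE n (fun l r => W l r ^+ 2) <= K ^+ 2 * n.+2%:R /\
  splitE n (fun l r => `|W l r|) <= K * Num.sqrt n.+2%:R.
Proof.
move=> K0 vK.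
have W2 : splitE n (fun l r => W l r ^+ 2) <= K ^+ 2 * n.+2%:R.
  rewrite splitE_W2.
  have : \sum_(j < n.+1) variance j <= \sum_(j < n.+1) K ^+ 2 * j.+1%:R.
    by apply: ler_sum => j _; apply: vK; rewrite -ltnS.
  have -> : \sum_(j < n.+1) K ^+ 2 * j.+1%:R = K ^+ 2 * (n.+1%:R * n.+2%:R / 2).
    rewrite -mulr_sumr; congr (_ * _).
    elim: n {vK} => [|n IH]; first by rewrite big_ord_recr big_ord0 /=; field.
    by rewrite big_ord_recr /= IH -[n.+3%:R]natr1 -[n.+2%:R]natr1; field.
  move=> h; apply: le_trans (ler_wpM2l _ h) _; first by rewrite divr_ge0.
  by rewrite le_eqVlt; apply/orP; left; apply/eqP; field; natnz.
split=> //; apply: le_trans (splitE_abs_le_sqrt _ _) _.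
apply: le_trans (ler_wsqrtr W2) _.
by rewrite sqrtrM ?sqr_ge0 // sqrtr_sqr ger0_norm.
Qed.

Lemma variance_toll_le K n : 0 <= K ->
  (forall j, (j < n)%N -> variance j <= K ^+ 2 * j.+1%:R) ->
  `|variance_toll n| <= 100 + 20 * K * Num.sqrt n.+1%:R.
Proof.
move=> K0; case: n => [|n] vK /=.
  by rewrite normr0 addr_ge0 // !mulr_ge0.
have [_ absW] := splitE_absW_le K0 vK.
apply: (@le_trans _ _ (splitE n (fun l r => 100 + 20 * `|W l r|))).
  apply: splitE_norm_le => l r _.
  have c10 := centered_toll_le l r; have w0 := normr_ge0 (W l r).
  apply: le_trans (ler_normD _ _) _; apply: lerD.
    rewrite normrX; have := normr_ge0 (centered_toll l r).
    by move: c10; set c := `|_| => *; nra.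
  rewrite !normrM [`|2|]ger0_norm //.
  have := ler_wpM2r w0 c10; lra.
rewrite splitED splitE_cst splitEZ lerD2l -mulrA ler_wpM2l //.
Qed.

(** A bootstrap. If the variance is at most K^2 (j+1) at smaller sizes, the toll is at most 100 + 20
    K sqrt (k+1) by Cauchy-Schwarz, and the closed form of the recurrence gives at most (300 + 100
    K) (n+1). The value K = 110 satisfies 300 + 100 K <= K^2. *)
Lemma variance_le n : variance n <= 110 ^+ 2 * n.+1%:R.
Proof.
elim/ltn_ind: n => n IH; rewrite variance_series.
have vt k : (k <= n)%N ->
    `|variance_toll k| <= 100 + 20 * 110 * Num.sqrt k.+1%:R.
  by move=> kn; apply: variance_toll_le => // j jk; apply: IH (leq_trans jk kn).
have S : bst_series variance_toll n <= 2 * 100 + 4 * (20 * 110).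
  apply: le_trans (bst_series_cst_sqrt _ _ _) => //; apply: bst_series_le => k kn.
  exact: le_trans (ler_norm _) (vt _ (ltnW kn)).
have sq : Num.sqrt n.+1%:R <= n.+1%:R :> R.
  by rewrite -[leRHS]ger0_norm // -sqrtr_sqr ler_wsqrtr // -natrX ler_nat leq_pmulr.
have n1 : 1 <= n.+1%:R :> R by rewrite ler1n.
have vn := le_trans (ler_norm _) (vt n (leqnn n)).
have := ler_wpM2l (ler0n R n.+1) S; lra.
Qed.

Lemma variance_toll_sqrt n : `|variance_toll n| <= 23 * 100 * Num.sqrt n.+1%:R.
Proof.
apply: le_trans (variance_toll_le (K := 110) _ (fun j _ => variance_le j)) _ => //.
have : 1 <= Num.sqrt n.+1%:R :> R by rewrite -[leLHS]sqrtr1 ler_wsqrtr // ler1n.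
lra.
Qed.

(* [110] comes from [variance_le], [23 * 100] from [variance_toll_sqrt] and [115]
   is [5 * 23]: the constants do not depend on [X], which is what makes the
   approximation by truncated properties uniform. *)
Lemma variance_linear : exists s2, forall n,
  `|variance n - n.+1%:R * s2| <= 115 * 100 * Num.sqrt n.+1%:R.
Proof.
have [s2 hs] := bst_series_sqrt variance_toll_sqrt.
exists s2 => n; rewrite variance_series.
have -> : variance_toll n + n.+1%:R * bst_series variance_toll n - n.+1%:R * s2 =
   variance_toll n + n.+1%:R * (bst_series variance_toll n - s2) by ring.
apply: le_trans (ler_normD _ _) _; rewrite normrM [`|n.+1%:R|]ger0_norm //.
have := ler_wpM2l (ler0n R n.+1) (hs n).
have -> : n.+1%:R * (4 * (23 * 100) / Num.sqrt n.+1%:R) = 92 * 100 * Num.sqrt n.+1%:R :> R.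
  have s0 : Num.sqrt n.+1%:R != 0 :> R by rewrite gt_eqF // sqrtr_gt0.
  by rewrite -{1}(sqr_sqrtr (ler0n R n.+1)); field.
by have := variance_toll_sqrt n; lra.
Qed.

(** * Gaussian approximation of the characteristic function *)

Section CharacteristicFunction.
Variable s : R.

(** [g] is the Gaussian candidate with the exact variance at size [n], [err] bounds the error of one
    step of the recursion, and [bnd] is [err] accumulated by the divide-and-conquer recurrence. The
    factor 10^9 absorbs the constants of [toll_step] and [gauss_step]. *)
Let g n := expR (- (variance n * s ^+ 2 / 2)).
Let err n : R := 10 ^+ 9 * (`|s| ^+ 3 * n.+1%:R
  + `|s| ^+ 4 * n.+1%:R * Num.sqrt n.+1%:R).
Let bnd n := err n + n.+1%:R * bst_series err n.

Lemma err_ge0 n : 0 <= err n.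
Proof.
by apply: mulr_ge0; [exact: exprn_ge0 | rewrite addr_ge0 // !mulr_ge0 // exprn_ge0].
Qed.

Lemma bnd_rec n : bnd n.+1 = err n.+1 + splitE n (fun l r =>
  bnd (bt_size l) + bnd (bt_size r)).
Proof. by rewrite splitE_sizesD divide_rec_solution divff ?mul1r ?pnatr_eq0. Qed.

Lemma bnd_ge0 n : 0 <= bnd n.
Proof.
rewrite addr_ge0 ?err_ge0 // mulr_ge0 //; apply: sumr_ge0 => k _.
by rewrite mulr_ge0 ?err_ge0 // ltW ?bst_weight_gt0.
Qed.

Lemma g_bounds n : 0 <= g n <= 1.
Proof.
rewrite expR_ge0 -expR0 ler_expR oppr_le0.
by rewrite divr_ge0 // mulr_ge0 ?variance_ge0 ?sqr_ge0.
Qed.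

(** The effect of the toll alone. The first-order term has mean 0, and the mean of the second-order
    terms is the toll of the variance; the remainder uses the first two moments of |W| provided by
    [variance_le]. *)
Lemma toll_step n theta :
  `|splitE n (fun l r => cos (theta + s * W l r + s * centered_toll l r))
    - splitE n (fun l r => cos (theta + s * W l r))
    + s ^+ 2 / 2 * variance_toll n.+1 * cos theta|
  <= 10 ^+ 6 * (`|s| ^+ 3 * n.+2%:R + `|s| ^+ 4 * n.+2%:R * Num.sqrt n.+2%:R).
Proof.
have -> : splitE n (fun l r => cos (theta + s * W l r + s * centered_toll l r))
    - splitE n (fun l r => cos (theta + s * W l r))
    + s ^+ 2 / 2 * variance_toll n.+1 * cos theta =
  splitE n (fun l r => cos (theta + s * W l r + s * centered_toll l r)
    - cos (theta + s * W l r) + s * centered_toll l r * sin theta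
    + (s * centered_toll l r * (s * W l r) + (s * centered_toll l r) ^+ 2 / 2)
      * cos theta).
  rewrite [RHS](splitE_eq (k' := fun l r =>
     cos (theta + s * W l r + s * centered_toll l r) - cos (theta + s * W l r)
     + (s * sin theta) * centered_toll l r
     + (s ^+ 2 / 2 * cos theta) *
       (centered_toll l r ^+ 2 + 2 * (centered_toll l r * W l r)))); last first.
    by move=> l r _; field.
  by rewrite !splitED splitEN !splitEZ splitE_centered_toll /=; ring.
apply: (@le_trans _ _ (splitE n (fun l r => (10 ^+ 3 * `|s| ^+ 3 + 10 ^+ 4 * `|s| ^+ 4)
   + (30 * `|s| ^+ 3) * W l r ^+ 2 + (100 * `|s| ^+ 3) * `|W l r|))).
  apply: splitE_norm_le => l r _; apply: le_trans (cos_perturbation _ _ _) _.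
  have c10 := centered_toll_le l r.
  have c0 := normr_ge0 (centered_toll l r).
  have cp k : `|centered_toll l r| ^+ k <= 10 ^+ k by rewrite lerXn2r ?nnegrE.
  rewrite -[(s * centered_toll l r) ^+ 4]ger0_norm ?exprn_even_ge0 //.
  rewrite -[(s * centered_toll l r) ^+ 2]ger0_norm ?exprn_even_ge0 //.
  rewrite -[(s * W l r) ^+ 2]ger0_norm ?exprn_even_ge0 //.
  rewrite -[W l r ^+ 2]ger0_norm ?exprn_even_ge0 // !normrX !normrM !exprMn.
  have a0 := normr_ge0 s; have w0 := normr_ge0 (W l r).
  have h3 := ler_wpM2l (exprn_ge0 3 a0) (cp 3%N).
  have h4 := ler_wpM2l (exprn_ge0 4 a0) (cp 4%N).
  have h1 := ler_wpM2l (mulr_ge0 (exprn_ge0 3 a0) (exprn_ge0 2 w0)) (cp 1%N).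
  have h2 := ler_wpM2l (mulr_ge0 (exprn_ge0 3 a0) w0) (cp 2%N).
  move: h1 h2 h3 h4; move: `|s| `|W l r| `|centered_toll l r| => a w c h1 h2 h3 h4.
  by lra.
have [W2 W1] := splitE_absW_le (n := n) (K := 110) (ler0n R 110) (fun j _ => variance_le j).
rewrite !splitED !splitEZ splitE_cst.
have a3 := exprn_ge0 3 (normr_ge0 s); have a4 := exprn_ge0 4 (normr_ge0 s).
have N1 : 1 <= n.+2%:R :> R by rewrite ler1n.
have q1 : 1 <= Num.sqrt n.+2%:R :> R by rewrite -[leLHS]sqrtr1 ler_wsqrtr.
have qN : Num.sqrt n.+2%:R <= n.+2%:R :> R.
  by rewrite -[leRHS](@sqr_sqrtr R) // expr2 ler_peMl // (le_trans _ q1).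
have h1 := ler_wpM2l a3 W2; have h2 := ler_wpM2l a3 W1.
have h3 := ler_wpM2l a3 N1; have h4 := ler_wpM2l a3 qN.
have h5 := ler_wpM2l a4 N1.
have h6 := ler_wpM2l (mulr_ge0 a4 (ler0n R n.+2)) q1.
by lra.
Qed.

(** The linear parts cancel because i.+1 + j.+1 = (i + j).+2, leaving three errors of at most 115 *
    100 times the root. *)
Lemma variance_gap l r :
  `|variance (bt_size l + bt_size r).+1 - (variance (bt_size l) + variance (bt_size r))|
  <= 345 * 100 * Num.sqrt (bt_size l + bt_size r).+2%:R.
Proof.
have [s2 hs] := variance_linear.
set i := bt_size l; set j := bt_size r.
have hi := hs i; have hj := hs j; have hn := hs (i + j).+1.
have qi : Num.sqrt i.+1%:R <= Num.sqrt (i + j).+2%:R :> R.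
  by rewrite ler_wsqrtr // ler_nat; lia.
have qj : Num.sqrt j.+1%:R <= Num.sqrt (i + j).+2%:R :> R.
  by rewrite ler_wsqrtr // ler_nat; lia.
have e : (i + j).+2%:R = i.+1%:R + j.+1%:R :> R by rewrite -natrD addSn addnS.
rewrite e in hn; move: hi hj hn qi qj; rewrite -e.
rewrite !ler_norml => /andP[? ?] /andP[? ?] /andP[? ?] ? ?.
by apply/andP; split; lra.
Qed.

(** With x and y half of s^2 times the variance of the whole tree and of the two subtrees, exp (- y)
    - exp (- x) is x - y up to |x - y| (x + y), where x - y = O(s^2 sqrt n) and x + y = O(s^2 n). By
    the variance recurrence the mean of x - y is exactly the second-order term of [toll_step]. *)
Lemma gauss_step n :
  `|splitE n (fun l r => g (bt_size l) * g (bt_size r)) - g n.+1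
    - s ^+ 2 / 2 * variance_toll n.+1|
  <= 3 * 10 ^+ 8 * (`|s| ^+ 4 * n.+2%:R * Num.sqrt n.+2%:R).
Proof.
have -> : splitE n (fun l r => g (bt_size l) * g (bt_size r)) - g n.+1
    - s ^+ 2 / 2 * variance_toll n.+1 =
  splitE n (fun l r => g (bt_size l) * g (bt_size r) - g n.+1
    - s ^+ 2 / 2 * (variance n.+1 - (variance (bt_size l) + variance (bt_size r)))).
  rewrite !splitEB splitEZ splitE_cst splitEB splitE_cst splitE_sizesD.
  by rewrite {1}variance_rec addrK.
rewrite -(splitE_cst n (3 * _ * _)); apply: splitE_norm_le => l r lr.
have gap := variance_gap l r; rewrite lr in gap.
have vl := variance_le (bt_size l); have vr := variance_le (bt_size r).
have vn := variance_le n.+1.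
have eN : n.+2%:R = (bt_size l).+1%:R + (bt_size r).+1%:R :> R.
  by rewrite -natrD addSn addnS lr.
set x := variance n.+1 * s ^+ 2 / 2.
set y := (variance (bt_size l) + variance (bt_size r)) * s ^+ 2 / 2.
have -> : g (bt_size l) * g (bt_size r) = expR (- y).
  by rewrite -expRD /y; congr expR; ring.
have -> : s ^+ 2 / 2 * (variance n.+1 - (variance (bt_size l) + variance (bt_size r)))
    = x - y by rewrite /x /y; ring.
have s2 := sqr_ge0 s.
apply: le_trans (expRN_perturbation _ _) _.
- by rewrite divr_ge0 // mulr_ge0 // variance_ge0.
- by rewrite divr_ge0 // mulr_ge0 // addr_ge0 // variance_ge0.
have -> : x - y = s ^+ 2 / 2 *
    (variance n.+1 - (variance (bt_size l) + variance (bt_size r))).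
  by rewrite /x /y; ring.
have -> : x + y = s ^+ 2 / 2 *
    (variance n.+1 + (variance (bt_size l) + variance (bt_size r))).
  by rewrite /x /y; ring.
rewrite normrM ger0_norm; last by rewrite divr_ge0.
have sum_le : variance n.+1 + (variance (bt_size l) + variance (bt_size r)) <=
    2 * 110 ^+ 2 * n.+2%:R by rewrite [in leRHS]eN; move: vn; rewrite eN; lra.
have sum_ge : 0 <= variance n.+1 + (variance (bt_size l) + variance (bt_size r)).
  by rewrite !addr_ge0 // variance_ge0.
have s4 : `|s| ^+ 4 = s ^+ 2 * s ^+ 2.
  by rewrite -normrX ger0_norm ?exprn_even_ge0 // -exprD.
rewrite s4 mulrACA.
have P := ler_pM (normr_ge0 _) sum_ge gap sum_le.
apply: le_trans (ler_wpM2l _ P) _; first by rewrite mulr_ge0 // divr_ge0.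
have : 0 <= s ^+ 2 * s ^+ 2 * n.+2%:R * Num.sqrt n.+2%:R.
  exact: mulr_ge0 (mulr_ge0 (mulr_ge0 s2 s2) (ler0n _ _)) (sqrtr_ge0 _).
by move=> h; lra.
Qed.

(* The cosine satisfies the divide-and-conquer recursion up to the error of a
   third-order Taylor expansion in the toll, uniformly in the phase [theta]. *)
Lemma characteristic_function_rec n theta :
  `|bstE n (fun T => cos (s * centered T + theta)) - cos theta * g n| <= bnd n.
Proof.
elim/ltn_ind: n theta => -[|n] IH theta.
  rewrite bstE0 /g variance0 !mul0r oppr0 expR0 mulr1 /centered bstE0 subrr.
  by rewrite mulr0 add0r subrr normr0 bnd_ge0.
have csb (z : R) : `|cos z| <= 1 by rewrite ler_norml cos_geN1 cos_le1.
have indep : `|splitE n (fun l r => cos (theta + s * W l r))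
    - cos theta * splitE n (fun l r => g (bt_size l) * g (bt_size r))|
    <= splitE n (fun l r => bnd (bt_size l) + bnd (bt_size r)).
  rewrite -splitEZ -splitEB /splitE normrM [`|_^-1|]ger0_norm //.
  rewrite ler_wpM2r //; apply: le_trans (ler_norm_sum _ _ _) _.
  apply: ler_sum => j _.
  have jn : (j <= n)%N by rewrite -ltnS.
  have njn : (n - j < n.+1)%N by rewrite ltnS leq_subr.
  set k := (n - j)%N in njn *.
  (* For a fixed left subtree, [s * centered l] joins the phase and the induction hypothesis applies
     to the right subtree; averaging over the left subtree then uses the hypothesis once more. *)
  have inner l : bt_size l = j ->
      `|bstE k (fun r => cos (theta + s * W l r) - cos theta * (g (bt_size l) * g (bt_size r)))
        - (g k * cos (s * centered l + theta) - cos theta * (g j * g k))| <= bnd k.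
    move=> lj; have := IH _ njn (s * centered l + theta).
    rewrite bstEB (@bstE_eq _ _ (fun r => cos (theta + s * W l r))
      (fun r => cos (s * centered r + (s * centered l + theta)))); last first.
      by move=> r _; congr cos; rewrite /W; ring.
    rewrite (@bstE_eq _ _ (fun r => _ * (_ * _)) (fun=> cos theta * (g j * g k))); last first.
      by move=> r rk; rewrite lj rk.
    by rewrite bstE_cst; congr (`|_| <= _); ring.
  have outer : `|bstE j (fun l => g k * cos (s * centered l + theta) - cos theta * (g j * g k))|
      <= bnd j.
    rewrite bstEB bstEZ bstE_cst.
    have -> : g k * bstE j (fun T => cos (s * centered T + theta)) - cos theta * (g j * g k)
      = g k * (bstE j (fun T => cos (s * centered T + theta)) - cos theta * g j) by ring.
    have /andP[g0 g1] := g_bounds k.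
    rewrite normrM ger0_norm // (le_trans _ (IH _ (ltn_ord j) theta)) //.
    by rewrite ler_piMl.
  set E1 := bstE j (fun l => bstE k _).
  set E2 := bstE j _ in outer.
  have d12 : `|E1 - E2| <= bnd k.
    rewrite /E1 /E2 -bstEB -(bstE_cst j (bnd k)); apply: bstE_norm_le => l lj.
    exact: inner.
  have -> : bstE j (fun l => bstE k (fun r => bnd (bt_size l) + bnd (bt_size r)))
      = bnd k + bnd j.
    rewrite (@bstE_eq _ _ _ (fun=> bnd k + bnd j)) ?bstE_cst // => l lj.
    rewrite (@bstE_eq _ _ _ (fun=> bnd k + bnd j)) ?bstE_cst // => r rk.
    by rewrite lj rk addrC.
  have -> : E1 = (E1 - E2) + E2 by rewrite subrK.
  by apply: le_trans (ler_normD _ _) _; exact: lerD.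
rewrite bstES bnd_rec.
rewrite (splitE_eq (k' := fun l r => cos (theta + s * W l r + s * centered_toll l r))); last first.
  by move=> l r _; rewrite centered_node; congr cos; ring.
have st1 := toll_step n theta.
have st3 := gauss_step n.
move: indep st1 st3.
set C := splitE n (fun l r => cos (theta + s * W l r + s * centered_toll l r)).
set A := splitE n (fun l r => cos (theta + s * W l r)).
set B := splitE n (fun l r => g (bt_size l) * g (bt_size r)).
set D := splitE n _.
set d := s ^+ 2 / 2 * _ => i1 st1 st3.
(* Toll, independence and Gaussian steps; the second-order term [d] enters the first and the last
   with opposite signs. *)
have -> : C - cos theta * g n.+1 = (C - A + d * cos theta) + (A - cos theta * B)
    + cos theta * (B - g n.+1 - d) by ring.
have h3 : `|cos theta * (B - g n.+1 - d)| <=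
    3 * 10 ^+ 8 * (`|s| ^+ 4 * n.+2%:R * Num.sqrt n.+2%:R).
  by rewrite normrM (le_trans _ st3) // ler_piMl.
apply: le_trans (ler_normD _ _) _.
apply: le_trans (lerD (ler_normD _ _) h3) _.
have p3 : 0 <= `|s| ^+ 3 * n.+2%:R by rewrite mulr_ge0 // exprn_ge0.
have p4 : 0 <= `|s| ^+ 4 * n.+2%:R * Num.sqrt n.+2%:R.
  by rewrite !mulr_ge0 // exprn_ge0.
rewrite /err; move: p3 p4 i1 st1.
move: (`|s| ^+ 3 * n.+2%:R) (`|s| ^+ 4 * n.+2%:R * Num.sqrt n.+2%:R).
by move=> u w p3 p4 i1 st1; lra.
Qed.

(** Bounding sqrt (k+1) by sqrt (n+1) makes the error linear in k, and its weighted series becomes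
    harmonic. *)
Lemma characteristic_function_bound n theta :
  `|bstE n (fun T => cos (s * centered T + theta))
    - cos theta * expR (- (variance n * s ^+ 2 / 2))|
  <= 10 ^+ 9 * `|s| ^+ 3 * n.+1%:R * (1 + `|s| * Num.sqrt n.+1%:R)
     * (1 + 2 * \sum_(k < n) k.+1%:R^-1).
Proof.
apply: le_trans (characteristic_function_rec n theta) _.
set c := 10 ^+ 9 * `|s| ^+ 3 * (1 + `|s| * Num.sqrt n.+1%:R).
have c0 : 0 <= c by rewrite !mulr_ge0 ?exprn_ge0 // addr_ge0 // mulr_ge0.
have err_le k : (k <= n)%N -> err k <= c * k.+1%:R.
  move=> kn; rewrite /err /c.
  have -> : 10 ^+ 9 * (`|s| ^+ 3 * k.+1%:R + `|s| ^+ 4 * k.+1%:R * Num.sqrt k.+1%:R)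
    = (10 ^+ 9 * `|s| ^+ 3 * k.+1%:R) * (1 + `|s| * Num.sqrt k.+1%:R) by ring.
  rewrite [leRHS]mulrAC ler_wpM2l // ?mulr_ge0 ?exprn_ge0 //.
  by rewrite lerD2l ler_wpM2l // ler_wsqrtr // ler_nat ltnS.
have -> : 10 ^+ 9 * `|s| ^+ 3 * n.+1%:R * (1 + `|s| * Num.sqrt n.+1%:R)
     * (1 + 2 * \sum_(k < n) k.+1%:R^-1) =
   c * n.+1%:R + n.+1%:R * (2 * c * \sum_(k < n) k.+1%:R^-1) by rewrite /c; ring.
apply: lerD; first exact: err_le.
rewrite ler_wpM2l // mulr_sumr; apply: ler_sum => k _.
apply: (@le_trans _ _ (bst_weight R k * (c * k.+1%:R))).
  by apply: ler_wpM2l; [exact: ltW (bst_weight_gt0 R k) | exact: err_le (ltnW _)].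
rewrite /bst_weight natrM; move: (nat_of_ord k) => {}k.
have -> : 2 / (k.+1%:R * k.+2%:R) * (c * k.+1%:R) = 2 * c / k.+2%:R :> R.
  by rewrite -[k.+2%:R]natr1; field; natnz.
by rewrite ler_wpM2l ?mulr_ge0 // lef_pV2 ?posrE // ler_nat.
Qed.

End CharacteristicFunction.

End AdditiveFunctional.

(** * Insertion and splitting at the root *)

Section SearchTreeLaw.
Variable R : realType.
Implicit Types (u s : seq nat) (h : seq nat -> R).

(** The mean of [h] over a uniformly random ordering of [u], drawn key by key: the first key becomes
    the root of the search tree, so this recursion matches the splitting at the root. *)
Fixpoint permE_rec n u h : R :=
  if n is m.+1 then
    (\sum_(x <- u) permE_rec m (rem x u) (fun s => h (x :: s))) / n%:R
  else h [::].

Definition permE u h := permE_rec (size u) u h.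

Lemma permE_unfold u h : (0 < size u)%N ->
  (size u)%:R * permE u h = \sum_(x <- u) permE (rem x u) (fun s => h (x :: s)).
Proof.
case sz : (size u) => [//|m] _; rewrite /permE sz /= mulrC divfK ?pnatr_eq0 //.
by rewrite !big_seq; apply: eq_bigr => x xu; rewrite size_rem // sz.
Qed.

Lemma permE_rec_sum n u (I : Type) (r : seq I) (h : I -> seq nat -> R) :
  permE_rec n u (fun s => \sum_(i <- r) h i s) = \sum_(i <- r) permE_rec n u (h i).
Proof.
elim: n u h => [|n IH] u h //=; rewrite -mulr_suml; congr (_ / _).
rewrite exchange_big /=; apply: eq_bigr => x _; exact: IH.
Qed.

Lemma permE_recZ n u c h : permE_rec n u (fun s => c * h s) = c * permE_rec n u h.
Proof.
elim: n u h => [|n IH] u h //=; rewrite mulrA mulr_sumr; congr (_ / _).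
by apply: eq_bigr => x _; exact: IH.
Qed.

Lemma sum_permutations u h : uniq u ->
  \sum_(s <- permutations u) h s = (size u)`!%:R * permE u h.
Proof.
have [m] := ubnP (size u); elim: m u h => // m IH u h sz uu.
have [/size0nil ->|u0] := posnP (size u).
  by rewrite /permutations /= big_seq1 mul1r.
rewrite (perm_big _ (permutationsE u0)) /= big_allpairs_dep /= undup_id //.
rewrite -{1}(prednK u0) factS prednK // natrM mulrAC permE_unfold // mulr_suml.
rewrite !big_seq; apply: eq_bigr => x xu.
rewrite (IH (rem x u) (fun s => h (x :: s))) ?rem_uniq //; first by rewrite size_rem // mulrC.
by rewrite size_rem //; move: sz; rewrite ltnS; case: (size u) u0.
Qed.

(** In a random ordering, the keys satisfying [p] and the others appear in independent uniform
    orders. Induct on the first key drawn: each class contributes the product expectation as many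
    times as it has keys, and the two counts add up to the size of [u]. *)
Lemma permE_filter (p : pred nat) u (g : seq nat -> seq nat -> R) : uniq u ->
  permE u (fun s => g (seq.filter p s) (seq.filter (predC p) s)) =
  permE (seq.filter p u) (fun s1 => permE (seq.filter (predC p) u) (fun s2 => g s1 s2)).
Proof.
have [m] := ubnP (size u); elim: m u g => // m IH u g sz uu.
have [/size0nil -> //|u0] := posnP (size u).
have n0 : (size u)%:R != 0 :> R by rewrite pnatr_eq0 -lt0n.
apply: (mulfI n0); rewrite permE_unfold //.
have sz_rem x : x \in u -> (size (rem x u) < m)%N.
  by move=> xu; rewrite size_rem //; move: sz; rewrite ltnS; case: (size u) u0.
set F := permE (seq.filter p u) _.
rewrite (bigID p) /=.
have filt_rem (q : pred nat) x : seq.filter q (rem x u) = rem x (seq.filter q u).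
  rewrite !rem_filter ?filter_uniq // -!filter_predI.
  by apply: eq_filter => y /=; rewrite andbC.
have filt_rem_out (q : pred nat) x : ~~ q x -> seq.filter q (rem x u) = seq.filter q u.
  move=> qx; rewrite filt_rem rem_id // mem_filter negb_and qx //.
have -> : \sum_(x <- u | p x) permE (rem x u) (fun s =>
      g (seq.filter p (x :: s)) (seq.filter (predC p) (x :: s))) =
    (size (seq.filter p u))%:R * F.
  rewrite -big_filter.
  have -> : \sum_(x <- seq.filter p u) permE (rem x u) (fun s =>
      g (seq.filter p (x :: s)) (seq.filter (predC p) (x :: s))) =
    \sum_(x <- seq.filter p u) permE (rem x (seq.filter p u)) (fun s1 =>
       permE (seq.filter (predC p) u) (fun s2 => g (x :: s1) s2)).
    rewrite !big_seq; apply: eq_bigr => x; rewrite mem_filter => /andP[px xu].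
    rewrite (_ : (fun s => _) = fun s => g (x :: seq.filter p s) (seq.filter (predC p) s)).
      rewrite (IH _ (fun s1 s2 => g (x :: s1) s2)) ?rem_uniq ?sz_rem //.
      by rewrite filt_rem filt_rem_out //= px.
    by apply/funext => s /=; rewrite px.
  have [/size0nil e|q0] := posnP (size (seq.filter p u)).
    by rewrite e big_nil mul0r.
  by rewrite permE_unfold.
have -> : \sum_(x <- u | ~~ p x) permE (rem x u) (fun s =>
      g (seq.filter p (x :: s)) (seq.filter (predC p) (x :: s))) =
    (size (seq.filter (predC p) u))%:R * F.
  rewrite -big_filter.
  have -> : \sum_(x <- seq.filter (predC p) u) permE (rem x u) (fun s =>
      g (seq.filter p (x :: s)) (seq.filter (predC p) (x :: s))) =
    \sum_(x <- seq.filter (predC p) u) permE (seq.filter p u) (fun s1 =>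
       permE (rem x (seq.filter (predC p) u)) (fun s2 => g s1 (x :: s2))).
    rewrite !big_seq; apply: eq_bigr => x; rewrite mem_filter => /andP[/= px xu].
    rewrite (_ : (fun s => _) = fun s => g (seq.filter p s) (x :: seq.filter (predC p) s)).
      rewrite (IH _ (fun s1 s2 => g s1 (x :: s2))) ?rem_uniq ?sz_rem //.
      by rewrite filt_rem_out // filt_rem.
    by apply/funext => s /=; rewrite (negbTE px).
  have [/size0nil e|q0] := posnP (size (seq.filter (predC p) u)).
    by rewrite e big_nil mul0r.
  rewrite /F /permE -permE_rec_sum -permE_recZ; congr (permE_rec _ _ _).
  by apply/funext => s1; rewrite -[permE_rec _ _ _]/(permE _ _) permE_unfold.
by rewrite -mulrDl -natrD !size_filter count_predC.
Qed.

Lemma search_tree_cons x s : search_tree (x :: s) =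
  BNode (search_tree [seq y <- s | (y < x)%N])
        (search_tree [seq y <- s | ~~ (y < x)%N]).
Proof.
rewrite /search_tree /=.
suff -> : forall l r, foldl (fun t x => insert_key x t) (KNode l x r) s =
    KNode (foldl (fun t x => insert_key x t) l [seq y <- s | (y < x)%N]) x
      (foldl (fun t x => insert_key x t) r [seq y <- s | ~~ (y < x)%N]) by [].
by elim: s => //= y s IH l r; case: ltnP => yx /=; rewrite IH.
Qed.

(** Ranks are a bijection from the keys onto 0, ..., size u - 1: a uniform first key gives a uniform
    size of the left subtree. *)
Lemma sum_ranks u (f : nat -> R) : uniq u ->
  \sum_(x <- u) f (count (fun y => y < x)%N u) = \sum_(j < size u) f j.
Proof.
move=> uu; rewrite -(big_mkord xpredT f) /index_iota subn0.
rewrite -(big_map (fun x => count (fun y => y < x)%N u) xpredT f); apply: perm_big.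
have lt_count x y : x \in u -> (x < y)%N ->
    (count (fun z => z < x)%N u < count (fun z => z < y)%N u)%N.
  move=> xu xy; have h := count_predUI (fun z => z < x)%N (pred1 x) u.
  have i0 : count (predI (fun z => z < x)%N (pred1 x)) u = 0%N.
    apply/eqP; rewrite -leqn0 leqNgt -has_count; apply/hasPn => z _ /=.
    by case: eqP => [->|]; rewrite ?ltnn ?andbF.
  have c1 : (0 < count (pred1 x) u)%N.
    by rewrite -has_count; apply/hasP; exists x => //=.
  rewrite i0 addn0 in h.
  have le_y : (count (predU (fun z => z < x)%N (pred1 x)) u <= count (fun z => z < y)%N u)%N.
    by apply: sub_count => z /= /orP[zx|/eqP-> //]; exact: ltn_trans xy.
  by apply: leq_trans le_y; rewrite h -addn1 leq_add2l.
pose rank x := count (fun y => y < x)%N u.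
have rank_inj : {in u &, injective rank}.
  move=> x y xu yu; rewrite /rank; case: (ltngtP x y) => // xy e.
    by have := lt_count _ _ xu xy; rewrite e ltnn.
  by have := lt_count _ _ yu xy; rewrite e ltnn.
have uk : uniq [seq rank x | x <- u] by rewrite (map_inj_in_uniq rank_inj).
have sub : {subset [seq rank x | x <- u] <= iota 0 (size u)}.
  move=> _ /mapP[x xu ->]; rewrite mem_iota /= add0n.
  rewrite -[leqRHS](count_predC (fun y => y < x)%N u) -[ltnLHS]addn0 ltn_add2l.
  by rewrite -has_count; apply/hasP; exists x => //=; rewrite ltnn.
apply: uniq_perm => //; first exact: iota_uniq.
by have [] := uniq_min_size uk sub; rewrite // size_map size_iota.
Qed.

(** Stated for an arbitrary duplicate-free set of keys because the induction passes to the keys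
    below and above the root; only their relative order matters. *)
Lemma permE_search_tree u (h : bintree -> R) : uniq u ->
  permE u (fun s => h (search_tree s)) = bstE (size u) h.
Proof.
have [m] := ubnP (size u); elim: m u h => // m IH u h sz uu.
have [/size0nil -> //|u0] := posnP (size u).
have n0 : (size u)%:R != 0 :> R by rewrite pnatr_eq0 -lt0n.
apply: (mulfI n0); rewrite permE_unfold //.
case sz_u : (size u) u0 n0 => [//|n] u0 n0.
rewrite bstES /splitE mulrC divfK //.
have := @sum_ranks u (fun j => bstE j (fun l => bstE (n - j) (fun r => h (BNode l r)))) uu.
rewrite sz_u => <-.
rewrite !big_seq; apply: eq_bigr => x xu.
rewrite (_ : (fun s => _) = fun s => h (BNode (search_tree [seq y <- s | (y < x)%N])
     (search_tree [seq y <- s | predC (fun y => y < x)%N y]))); last first.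
  by apply/funext => s; rewrite search_tree_cons.
rewrite (permE_filter (fun y => y < x)%N
  (fun s1 s2 => h (BNode (search_tree s1) (search_tree s2)))) ?rem_uniq //.
have szrem : size (rem x u) = n by rewrite size_rem // sz_u.
have filt : (size [seq y <- rem x u | (y < x)%N] +
    size [seq y <- rem x u | predC (fun y => y < x)%N y] = n)%N.
  by rewrite !size_filter count_predC.
have c1 : size [seq y <- rem x u | (y < x)%N] = count (fun y => y < x)%N u.
  rewrite size_filter (seq.permP (perm_to_rem xu)) /= ltnn add0n //.
move: filt; rewrite c1 => filt.
have nm : (n < m)%N by rewrite -ltnS -sz_u.
rewrite (_ : (fun s1 => _) = fun s1 => bstE (n - count (fun y => y < x)%N u)
    (fun r => h (BNode (search_tree s1) r))); last first.
  apply/funext => s1; rewrite (IH _ (fun r => h (BNode (search_tree s1) r))).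
  - by congr bstE; rewrite -filt addKn.
  - by apply: leq_ltn_trans nm; rewrite -[leqRHS]filt leq_addl.
  - by rewrite filter_uniq // rem_uniq.
rewrite (IH _ (fun l => bstE (n - count (fun y => y < x)%N u) (fun r => h (BNode l r)))).
- by rewrite c1.
- by apply: leq_ltn_trans nm; rewrite c1 -[leqRHS]filt leq_addr.
- by rewrite filter_uniq // rem_uniq.
Qed.

Lemma Ex_bst n (h : bintree -> R) : Ex (fun s : 'S_n => h (bst s)) = bstE n h.
Proof.
pose keys (s : 'S_n) := [seq (s i).+1 | i <- enum 'I_n].
have keys_inj : injective keys.
  move=> s s' e; apply/perm.permP => i; apply/val_inj.
  have /eq_in_map/(_ i) := e.
  by rewrite mem_enum => /(_ isT) [].
have keysP : perm_eq (map keys (enum {: {perm 'I_n}})) (permutations (iota 1 n)).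
  have uk : uniq (map keys (enum {: {perm 'I_n}})) by rewrite map_inj_uniq ?enum_uniq.
  have sub : {subset (map keys (enum {: {perm 'I_n}})) <= permutations (iota 1 n)}.
    move=> _ /mapP[s _ ->]; rewrite mem_permutations; apply: uniq_perm.
    - by rewrite map_inj_uniq ?enum_uniq // => i j [] /val_inj /perm_inj.
    - exact: iota_uniq.
    - move=> x; rewrite mem_iota add1n ltnS; apply/mapP/idP => [[i _ ->]|/andP[x0 xn]].
        by rewrite ltn_ord.
      have xn' : (x.-1 < n)%N by rewrite prednK.
      exists (s^-1 (Ordinal xn'))%g; first by rewrite mem_enum.
      by rewrite permKV /= prednK.
  apply: uniq_perm => //; first exact: permutations_uniq.
  have [] := uniq_min_size uk sub; rewrite // size_map -cardE.
  by rewrite size_permutations ?iota_uniq // size_iota card_Sn.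
rewrite /Ex card_Sn.
have -> : \sum_(s : 'S_n) h (bst s) = \sum_(t <- permutations (iota 1 n)) h (search_tree t).
  by rewrite -(perm_big _ keysP) big_map big_enum.
rewrite sum_permutations ?iota_uniq // size_iota permE_search_tree ?iota_uniq //.
by rewrite size_iota mulrC mulKf // pnatr_eq0 -lt0n fact_gt0.
Qed.

End SearchTreeLaw.

(* The rotation correspondence between binary trees with [n] nodes and ordered
   trees with [n.+1] nodes: the left subtree of a node is the leftmost child. *)
Fixpoint rotation (T : bintree) : otree :=
  if T is BNode l r then ONode (rotation l :: children (rotation r))
  else ONode [::].

Fixpoint labels (t : labtree) : seq nat :=
  let: LNode x s := t in x :: flatten (map labels s).

(** Nested induction with a companion predicate for the forest of children, in terms of which
    statements on labels and attachment are proved simultaneously. *)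
Fixpoint labtree_forest_ind (Q : labtree -> Prop) (QF : seq labtree -> Prop)
    (Qnode : forall x s, QF s -> Q (LNode x s)) (Qnil : QF [::])
    (Qcons : forall t s, Q t -> QF s -> QF (t :: s)) (t : labtree) : Q t :=
  let: LNode x s := t in
  Qnode x s ((fix loop s : QF s :=
    if s is u :: s' then
      Qcons u s' (labtree_forest_ind Qnode Qnil Qcons u) (loop s')
    else Qnil) s).

(** * Rotation and random recursive trees *)

Section RecursiveTreeLaw.
Variable R : realType.

Section Grow.

(* The sum of [h] over the trees obtained by giving to some node of [t] a new
   rightmost child. *)
Fixpoint grow_sum (t : otree) (h : otree -> R) {struct t} : R :=
  let: ONode s := t in
  h (ONode (rcons s (ONode [::]))) +
  (fix grow_forest (s : seq otree) (H : seq otree -> R) : R :=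
     if s is u :: s' then
       grow_sum u (fun v => H (v :: s')) + grow_forest s' (fun w => H (u :: w))
     else 0) s (fun w => h (ONode w)).

(** The inner fixpoint of [grow_sum] under a name of its own; the two are convertible. *)
Fixpoint grow_forest_sum (s : seq otree) (H : seq otree -> R) : R :=
  if s is u :: s' then
    grow_sum u (fun v => H (v :: s')) + grow_forest_sum s' (fun w => H (u :: w))
  else 0.

Lemma grow_sumE s h : grow_sum (ONode s) h =
  h (ONode (rcons s (ONode [::]))) + grow_forest_sum s (fun w => h (ONode w)).
Proof. by []. Qed.

(* Filling an empty position of [T] corresponds, through [rotation], to giving a
   new rightmost child to a node of [rotation T]. *)
Fixpoint bgrow_sum (T : bintree) (h : bintree -> R) : R :=
  if T is BNode l r then
    bgrow_sum l (fun l' => h (BNode l' r)) + bgrow_sum r (fun r' => h (BNode l r'))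
  else h (BNode BEmpty BEmpty).

(** Under [rotation] the children of a node lie along a chain of right links, and a new rightmost
    child fills the empty position at the end of that chain. *)
Lemma grow_sum_rotation T h :
  grow_sum (rotation T) h = bgrow_sum T (fun T' => h (rotation T')).
Proof.
elim: T h => [|l IHl r IHr] h; first by rewrite grow_sumE /= addr0.
rewrite [rotation _]/= grow_sumE /= addrCA; congr (_ + _); first exact: IHl.
have e : rotation r = ONode (children (rotation r)) by case: (rotation r).
have := IHr (fun t => h (ONode (rotation l :: children t))).
by rewrite {1}e grow_sumE => <-.
Qed.

Lemma bgrow_sum_bstE T k (g : bintree -> bintree -> R) :
  bstE k (fun r => bgrow_sum T (fun l => g l r)) =
  bgrow_sum T (fun l => bstE k (g l)).
Proof.
elim: T g => [|l IHl r IHr] g //=; rewrite bstED; congr (_ + _).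
  exact: (IHl (fun l' => g (BNode l' r))).
exact: (IHr (fun r' => g (BNode l r'))).
Qed.

(** Filling a uniformly chosen empty position turns one random search tree into the next. When n+1
    nodes become n+2, left size i arises from an insertion on the left with weight i and on the
    right with weight n + 1 - i; the total does not depend on i, so the split stays uniform. *)
Lemma bstE_bgrow_sum n h : bstE n (bgrow_sum^~ h) = n.+1%:R * bstE n.+1 h.
Proof.
elim/ltn_ind: n h => -[|n] IH h.
  by rewrite bstES /splitE big_ord_recl big_ord0 !bstE0 /= addr0 divr1 mul1r.
pose C i k := bstE i (fun l => bstE k (fun r => h (BNode l r))).
have -> : n.+2%:R * bstE n.+2 h = \sum_(i < n.+2) C i (n.+1 - i)%N.
  by rewrite bstES /splitE mulrC divfK ?pnatr_eq0.
have n0 : n.+1%:R != 0 :> R by rewrite pnatr_eq0.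
apply: (mulfI n0); rewrite bstES /splitE mulrC divfK //.
have -> : \sum_(j < n.+1) bstE j (fun l => bstE (n - j) (fun r =>
    bgrow_sum (BNode l r) h)) =
  \sum_(j < n.+1) (j.+1%:R * C j.+1 (n - j)%N + (n.+1 - j)%:R * C j (n.+1 - j)%N).
  apply: eq_bigr => j _; have jn : (j <= n)%N by rewrite -ltnS.
  rewrite (_ : (fun l => _) = fun l =>
      bgrow_sum l (fun l' => bstE (n - j) (fun r => h (BNode l' r)))
      + (n.+1 - j)%:R * bstE (n.+1 - j) (fun r => h (BNode l r))).
    rewrite bstED bstEZ; congr (_ + _).
    exact: (IH j (ltn_ord j) (fun l => bstE (n - j) (fun r => h (BNode l r)))).
  apply/funext => l; rewrite /= bstED subSn //; congr (_ + _).
    exact: (bgrow_sum_bstE l (n - j) (fun l' r => h (BNode l' r))).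
  by rewrite (IH (n - j)%N) // ltnS leq_subr.
rewrite big_split /=.
have -> : \sum_(i < n.+1) i.+1%:R * C i.+1 (n - i)%N =
    \sum_(i < n.+2) i%:R * C i (n.+1 - i)%N.
  by rewrite [RHS]big_ord_recl mul0r add0r; apply: eq_bigr => i _; rewrite subSS.
have -> : \sum_(i < n.+1) (n.+1 - i)%:R * C i (n.+1 - i)%N =
    \sum_(i < n.+2) (n.+1 - i)%:R * C i (n.+1 - i)%N.
  by rewrite [RHS]big_ord_recr /= subnn mul0r addr0.
rewrite -big_split mulr_sumr /=; apply: eq_bigr => i _.
by rewrite -mulrDl -natrD subnKC // -ltnS.
Qed.

Definition forget_attach p new t := forget_labels (attach p new t).

Lemma attach_notin p new t : p \notin labels t -> attach p new t = t.
Proof.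
move: t; apply: (@labtree_forest_ind
  (fun t => p \notin labels t -> attach p new t = t)
  (fun s => p \notin flatten (map labels s) -> map (attach p new) s = s))
  => [x s IH| |t s IHt IHs] //=.
  by rewrite inE negb_or eq_sym => /andP[/negbTE -> /IH ->].
by rewrite mem_cat negb_or => /andP[/IHt -> /IHs ->].
Qed.

Lemma attach_forest_notin p new s :
  p \notin flatten (map labels s) -> map (attach p new) s = s.
Proof.
elim: s => //= t s IH; rewrite mem_cat negb_or => /andP[pt /IH ->].
by rewrite attach_notin.
Qed.

Lemma attach_sum new t h : uniq (labels t) ->
  \sum_(p <- labels t) h (forget_attach p new t) = grow_sum (forget_labels t) h.
Proof.
move: t h; apply: (@labtree_forest_ind
  (fun t => forall h, uniq (labels t) ->
    \sum_(p <- labels t) h (forget_attach p new t) = grow_sum (forget_labels t) h)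
  (fun s => forall H, uniq (flatten (map labels s)) ->
    \sum_(p <- flatten (map labels s)) H (map (forget_attach p new) s) =
    grow_forest_sum (map forget_labels s) H)) => [x s IH h| H|t s IHt IHs H].
- rewrite [labels _]/= [forget_labels _]/= cons_uniq grow_sumE big_cons => /andP[xs us].
  congr (_ + _).
    by rewrite /forget_attach /= eqxx /= map_rcons.
  rewrite -IH // !big_seq; apply: eq_bigr => p ps.
  rewrite /forget_attach /=; case: eqP => [xp|_]; first by rewrite xp ps in xs.
  by rewrite /= -map_comp.
- by rewrite big_nil.
- rewrite /= cat_uniq big_cat /= => /and3P[ut /hasPn dis us]; congr (_ + _).
    rewrite -IHt // !big_seq; apply: eq_bigr => p pt; congr (H (_ :: _)).
    rewrite -[in RHS](@attach_forest_notin p new s) -?map_comp //.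
    exact: contraL (dis p) pt.
  rewrite -IHs // !big_seq; apply: eq_bigr => p ps; congr (H (_ :: _)).
  by rewrite /forget_attach attach_notin // dis.
Qed.

Lemma labels_attach p new t : uniq (labels t) -> p \in labels t ->
  perm_eq (labels (attach p new t)) (new :: labels t).
Proof.
move: t; apply: (@labtree_forest_ind
  (fun t => uniq (labels t) -> p \in labels t ->
    perm_eq (labels (attach p new t)) (new :: labels t))
  (fun s => uniq (flatten (map labels s)) -> p \in flatten (map labels s) ->
    perm_eq (flatten (map labels (map (attach p new) s)))
      (new :: flatten (map labels s)))) => [x s IH| |t s IHt IHs] //=.
- rewrite inE => /andP[xs us] /predU1P[->|ps].
    rewrite eqxx /= map_rcons flatten_rcons /= cats1.
    by rewrite -rcons_cons perm_rcons.
  case: eqP => [e|_] /=; first by rewrite e ps in xs.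
  have := IH us ps; rewrite -(perm_cons x) => /perm_trans; apply.
  exact: permEl (perm_catCA [:: x] [:: new] _).
- rewrite mem_cat cat_uniq => /and3P[ut /hasPn dis us] pts.
  have [pt|pt] := boolP (p \in labels t).
    rewrite attach_forest_notin; last exact: contraL (dis p) pt.
    by rewrite -cat_cons perm_cat2r IHt.
  rewrite (negbTE pt) /= in pts; rewrite attach_notin //.
  have := IHs us pts; rewrite -(perm_cat2l (labels t)) => /perm_trans; apply.
  exact: permEl (perm_catCA _ [:: new] _).
Qed.

End Grow.

(** A list version of [rrt_choices]: unlike the dependent function type, it extends by one choice at
    the end, which is what induction on the number of nodes requires. *)
Fixpoint parent_seqs m : seq (seq nat) :=
  if m is n.+1 then [seq rcons s p | s <- parent_seqs n, p <- iota 0 m]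
  else [:: [::]].

Lemma parent_seqsS m : parent_seqs m.+1 =
  [seq rcons s p | s <- parent_seqs m, p <- iota 0 m.+1].
Proof. by []. Qed.

Definition labelled_tree (s : seq nat) : labtree :=
  foldl (fun t i => attach (nth 0%N s i).+1 i.+2 t) (LNode 1 [::])
    (iota 0 (size s)).

Lemma eq_in_foldl (T : Type) (f g : T -> nat -> T) z s :
  {in s, forall i z, f z i = g z i} -> foldl f z s = foldl g z s.
Proof.
elim: s z => //= i s IH z fg; rewrite fg ?mem_head // IH // => j js y.
by rewrite fg // inE js orbT.
Qed.

Lemma labelled_tree_rcons s p : labelled_tree (rcons s p) =
  attach p.+1 (size s).+2 (labelled_tree s).
Proof.
rewrite /labelled_tree size_rcons -[(size s).+1]addn1 iotaD add0n cats1 foldl_rcons.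
rewrite nth_rcons ltnn eqxx; congr (attach _ _ _); first by rewrite addn1.
apply: eq_in_foldl => i; by rewrite mem_iota /= add0n => si z; rewrite nth_rcons si.
Qed.

Lemma parent_seqs_size m s : s \in parent_seqs m -> size s = m.
Proof.
elim: m s => [|m IH] s; first by rewrite inE => /eqP ->.
by rewrite parent_seqsS => /allpairsP[[s' p] [/= /IH s'm _ ->]]; rewrite size_rcons s'm.
Qed.

Lemma labels_labelled_tree m s : s \in parent_seqs m ->
  perm_eq (labels (labelled_tree s)) (iota 1 m.+1).
Proof.
elim: m s => [|m IH] s; first by rewrite inE => /eqP ->.
rewrite parent_seqsS => /allpairsP[[s' p] [s'm pm ->]]; rewrite [_.1]/= [_.2]/= in s'm pm *.
have ps' := IH _ s'm; rewrite labelled_tree_rcons (parent_seqs_size s'm).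
apply: perm_trans (labels_attach _ _ _) _.
- by rewrite (perm_uniq ps') iota_uniq.
- by rewrite (perm_mem ps') mem_iota add1n ltnS; move: pm; rewrite mem_iota.
have -> : iota 1 m.+2 = rcons (iota 1 m.+1) m.+2.
  by rewrite -[in LHS](addn1 m.+1) iotaD cats1 add1n.
by rewrite perm_sym perm_rcons perm_cons perm_sym.
Qed.

Lemma sum_parent_seqs m (h : otree -> R) :
  \sum_(s <- parent_seqs m) h (forget_labels (labelled_tree s)) =
  m`!%:R * bstE m (fun T => h (rotation T)).
Proof.
elim: m h => [|m IH] h; first by rewrite big_seq1 mul1r.
rewrite parent_seqsS big_allpairs_dep.
have -> : \sum_(s <- parent_seqs m) \sum_(p <- iota 0 m.+1)
      h (forget_labels (labelled_tree (rcons s p))) =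
    \sum_(s <- parent_seqs m) grow_sum (forget_labels (labelled_tree s)) h.
  rewrite !big_seq; apply: eq_bigr => s sm.
  have ps := labels_labelled_tree sm.
  rewrite -(attach_sum m.+2) ?(perm_uniq ps) ?iota_uniq // (perm_big _ ps).
  rewrite (_ : iota 1 m.+1 = map (addn 1) (iota 0 m.+1)) ?big_map; last by rewrite -iotaDl.
  apply: eq_bigr => p _; rewrite labelled_tree_rcons (parent_seqs_size sm).
  by rewrite add1n.
rewrite (IH (fun t => grow_sum t h)) factS natrM -mulrA -mulrCA -bstE_bgrow_sum; congr (_ * bstE _ _).
by apply/funext => T; rewrite grow_sum_rotation.
Qed.

Lemma Ex_rrt n (h : otree -> R) :
  Ex (fun f : rrt_choices n.+1 => h (rrt f)) = bstE n (fun T => h (rotation T)).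
Proof.
pose vals (f : rrt_choices n.+1) := [seq (f i : nat) | i <- enum 'I_n].
have rrtE f : rrt f = forget_labels (labelled_tree (vals f)).
  have foldl_val (g : labtree -> nat -> labtree) z (e : seq 'I_n) :
      foldl g z (map val e) = foldl (fun t i => g t (val i)) z e.
    by elim: e z => //= i e IH z.
  congr forget_labels; rewrite /labelled_tree size_map size_enum_ord -val_enum_ord.
  rewrite foldl_val; congr foldl; apply/funext => t; apply/funext => i.
  rewrite (nth_map i); last by rewrite [X in (_ < X)%N]size_enum_ord; exact: ltn_ord.
  exact: (congr1 (fun j => attach (f j).+1 (val i).+2 t) (esym (nth_ord_enum i i))).
have vals_inj : injective vals.
  move=> f g e; apply/ffunP => i; apply: val_inj.
  have /eq_in_map/(_ i) := e.
  by rewrite mem_enum => /(_ isT).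
have seqs_uniq m : uniq (parent_seqs m).
  elim: m => // m IH; rewrite parent_seqsS; apply: allpairs_uniq => //; first exact: iota_uniq.
  by move=> [s p] [s' p'] _ _ /= /rcons_inj [-> ->].
have vals_in f : vals f \in parent_seqs n.
  suff gen m (b : nat -> nat) : (forall i, (b i <= i)%N) ->
      [seq b i | i <- iota 0 m] \in parent_seqs m.
    (* The choices are extended to all naturals by 0, which respects the bound b i <= i and is never
       read below [n]. *)
    have := gen n (fun i => if insub i is Some j then f j : nat else 0%N).
    have -> : [seq (if insub i is Some j then f j : nat else 0%N) | i <- iota 0 n] = vals f.
      rewrite -val_enum_ord -map_comp; apply/eq_map => i /=; by rewrite valK.
    apply=> i; case: insubP => // j _ ji; rewrite -ji -ltnS; exact: ltn_ord.
  move=> bi; elim: m => // m IH; rewrite -addn1 iotaD add0n cats1 map_rcons addn1.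
  rewrite parent_seqsS; apply/allpairsP; exists ([seq b i | i <- iota 0 m], b m).
  by split; [exact: IH | rewrite mem_iota add0n ltnS; exact: bi | by []].
have valsP : perm_eq (map vals (enum {: rrt_choices n.+1})) (parent_seqs n).
  have uv : uniq (map vals (enum {: rrt_choices n.+1})) by rewrite map_inj_uniq ?enum_uniq.
  have sub : {subset parent_seqs n <= map vals (enum {: rrt_choices n.+1})}.
    move=> s sn.
    have ssz := parent_seqs_size sn.
    have sb m (s' : seq nat) : s' \in parent_seqs m -> forall i, (i < m)%N -> (nth 0%N s' i < i.+1)%N.
      elim: m s' => // m IH s''; rewrite parent_seqsS => /allpairsP[[s' p] [s'm pm ->]] i im.
      rewrite [_.1]/= [_.2]/= in s'm pm *.
      rewrite nth_rcons (parent_seqs_size s'm).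
      move: im; rewrite ltnS leq_eqVlt => /predU1P[->|im]; last by rewrite im IH.
      by rewrite ltnn eqxx; move: pm; rewrite mem_iota.
    apply/mapP; exists [ffun i : 'I_n => Ordinal (sb _ _ sn i (ltn_ord i))] => //.
      by rewrite mem_enum.
    apply: (@eq_from_nth _ 0%N); first by rewrite size_map size_enum_ord.
    move=> i; rewrite ssz => ni.
    by rewrite (nth_map (Ordinal ni)) ?size_enum_ord // ffunE (nth_ord_enum _ (Ordinal ni)).
  apply: uniq_perm => // s; apply/idP/idP; last exact: sub.
  by case/mapP=> f _ ->.
(* The count is [sum_parent_seqs] applied to the constant 1. *)
have cardE : #|{: rrt_choices n.+1}| = n`!.
  rewrite cardE -(size_map vals) (perm_size valsP).
  have : (size (parent_seqs n))%:R = n`!%:R :> R.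
    by have := sum_parent_seqs n (fun=> 1); rewrite bstE_cst mulr1 big_const_seq count_predT iter_addr_0.
  by move/eqP; rewrite eqr_nat => /eqP.
rewrite /Ex cardE.
have -> : \sum_(f : rrt_choices n.+1) h (rrt f) =
    \sum_(s <- parent_seqs n) h (forget_labels (labelled_tree s)).
  by rewrite -(perm_big _ valsP) big_map big_enum; apply: eq_bigr => f _; rewrite rrtE.
by rewrite sum_parent_seqs mulrC mulKf // pnatr_eq0 -lt0n fact_gt0.
Qed.

End RecursiveTreeLaw.

(** * Exact variances for properties of bounded trees *)

Section QuadraticSolutions.
Variable R : realType.
Implicit Types (m g : nat -> R).

(** Subtracting consecutive instances leaves a first-order recurrence, solved homogeneously by
    multiples of n + 1 and, for increments C (n+1) (n+2) of the source, by C (n+1)^2. Hence [beta]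
    is determined by the single value at [n0]. *)
Lemma divide_quadratic m g (C beta : R) n0 : (0 < n0)%N ->
  (forall n, (0 < n)%N -> n%:R * m n = g n + 2 * \sum_(j < n) m j) ->
  m n0 = C * n0.+1%:R ^+ 2 - beta * n0.+1%:R ->
  (forall n, (n0 <= n)%N -> g n.+1 - g n = C * n.+1%:R * n.+2%:R) ->
  forall n, (n0 <= n)%N -> m n = C * n.+1%:R ^+ 2 - beta * n.+1%:R.
Proof.
move=> n00 rec m0 gS n n0n; rewrite -(subnKC n0n); move: (n - n0)%N => d {n n0n}.
elim: d => [|d IH]; first by rewrite addn0.
rewrite addnS; set n := (n0 + d)%N in IH *.
have n0n : (n0 <= n)%N by exact: leq_addr.
have := rec n.+1 isT; rewrite big_ord_recr /=.
have := rec n (leq_trans n00 n0n); have := gS n n0n; rewrite IH.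
rewrite -[n.+2%:R]natr1 -[n.+1%:R]natr1.
have nz : n%:R + 1 != 0 :> R by rewrite natr1 pnatr_eq0.
move: (\sum_(j < n) m j) nz => T nz e1 e2 e3; apply: (mulfI nz); rewrite e3.
have -> : g n.+1 = g n + C * (n%:R + 1) * (n%:R + 1 + 1) by rewrite -e1; ring.
have -> : 2 * (T + (C * (n%:R + 1) ^+ 2 - beta * (n%:R + 1))) =
  (g n + 2 * T) - g n + 2 * (C * (n%:R + 1) ^+ 2 - beta * (n%:R + 1)) by ring.
by rewrite -e2; ring.
Qed.

Lemma sum_affine_product (x y : R) d :
  \sum_(i < d) (x + i%:R) * (y - i%:R) =
  d%:R * x * y + (y - x) * (d%:R * (d%:R - 1) / 2)
  - d%:R * (d%:R - 1) * (2 * d%:R - 1) / 6.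
Proof.
elim: d => [|d IH]; first by rewrite big_ord0; field.
by rewrite big_ord_recr /= IH -natr1; field.
Qed.

Lemma sum_convolution_support (u v : nat -> R) a b d :
  (forall i, (i < a)%N -> u i = 0) -> (forall i, (i < b)%N -> v i = 0) ->
  \sum_(j < (a + b + d).+1) u j * v (a + b + d - j)%N =
  \sum_(i < d.+1) u (a + i)%N * v (b + (d - i))%N.
Proof.
move=> ua vb; rewrite -(big_mkord xpredT (fun j => u j * v (a + b + d - j)%N)).
rewrite (@big_cat_nat _ _ _ a) //=; last by lia.
rewrite big1_seq ?add0r => [|i]; last first.
  by rewrite mem_index_iota => /andP[_ ia]; rewrite ua // mul0r.
rewrite (@big_cat_nat _ _ _ (a + d.+1)) //=; [|lia..].
rewrite [X in _ + X]big1_seq ?addr0 => [|i]; last first.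
  by rewrite mem_index_iota => /andP[ai ia]; rewrite vb ?mulr0 //; lia.
rewrite -{1}[a]add0n big_addn addKn big_mkord; apply: eq_bigr => i _.
have id : (i <= d)%N by rewrite -ltnS.
by congr (u _ * v _); lia.
Qed.

Lemma sum_convolution0 (u v : nat -> R) a b n :
  (forall i, (i < a)%N -> u i = 0) -> (forall i, (i < b)%N -> v i = 0) ->
  (n <= a + b)%N -> \sum_(j < n) u j * v (n.-1 - j)%N = 0.
Proof.
move=> ua vb nab; apply: big1 => j _; have jn := ltn_ord j.
have [ja|aj] := ltnP j a; first by rewrite ua // mul0r.
by rewrite vb ?mulr0 //; lia.
Qed.

Section BstPairs.
Variables a b : nat.

(* The mean number of subtrees of size [k] in the random binary search tree with
   [n] nodes. *)
Definition bst_kernel k n : R := (n == k)%:R + (k < n)%:R * n.+1%:R * bst_weight R k.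

Let conv n := \sum_(j < n) bst_kernel a j * bst_kernel b (n.-1 - j)%N.

Lemma bst_kernel_lt k n : (n < k)%N -> bst_kernel k n = 0.
Proof. by move=> nk; rewrite /bst_kernel ltn_eqF // ltnNge ltnW //= !mul0r addr0. Qed.

Lemma bst_kernel_diag k : bst_kernel k k = 1.
Proof. by rewrite /bst_kernel eqxx ltnn !mul0r addr0. Qed.

Lemma bst_kernel_gt k n : (k < n)%N -> bst_kernel k n = n.+1%:R * bst_weight R k.
Proof. by move=> kn; rewrite /bst_kernel kn gtn_eqF // add0r mul1r. Qed.

(** The two separate terms are the splits in which one part has exactly size [a] or [b], where the
    kernel is 1 instead of linear. *)
Lemma bst_convE e : conv (a + b + e).+2 =
  (b + e).+2%:R * bst_weight R b + (a + e).+2%:R * bst_weight R a +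
  bst_weight R a * bst_weight R b *
    \sum_(i < e) (a%:R + 2 + i%:R) * (b%:R + e%:R + 1 - i%:R).
Proof.
rewrite /conv /= -[(a + b + e).+1]addnS.
rewrite (@sum_convolution_support (bst_kernel a) (bst_kernel b)); try exact: bst_kernel_lt.
rewrite big_ord_recl big_ord_recr /=.
rewrite [X in X + _](_ : _ = (b + e).+2%:R * bst_weight R b); last first.
  by rewrite addn0 subn0 bst_kernel_diag mul1r bst_kernel_gt addnS // ltnS leq_addr.
rewrite [X in _ + (_ + X)](_ : _ = (a + e).+2%:R * bst_weight R a); last first.
  rewrite /bump /= add1n subnn addn0 bst_kernel_diag mulr1.
  by rewrite bst_kernel_gt addnS // ltnS leq_addr.
rewrite [X in _ + (X + _)](_ : _ = bst_weight R a * bst_weight R b *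
    \sum_(i < e) (a%:R + 2 + i%:R) * (b%:R + e%:R + 1 - i%:R)); last first.
  rewrite mulr_sumr; apply: eq_bigr => i _; rewrite /bump /= add1n subSS.
  have ie := ltn_ord i.
  rewrite !bst_kernel_gt; [|lia..].
  rewrite addnS -[(b + (e - i)).+1]addn1 -[(a + i).+2]addn2 !natrD natrB ?(ltnW ie) //.
  by ring.
by ring.
Qed.

Lemma bst_conv_small n : (n <= a + b)%N -> conv n = 0.
Proof. by move=> nab; apply: sum_convolution0 nab; exact: bst_kernel_lt. Qed.

Lemma bst_conv_base : conv (a + b).+1 = 1.
Proof.
have := sum_convolution_support 0 (@bst_kernel_lt a) (@bst_kernel_lt b).
rewrite /conv /= addn0 => ->.
by rewrite big_ord_recl big_ord0 /= subn0 !addn0 !bst_kernel_diag mulr1 addr0.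
Qed.

(** The origin of [bst_beta]. The solution is fed by pairs of subtrees of sizes [a] and [b] on
    opposite sides of a common ancestor: it vanishes up to a + b, is 2 / (a+b+1) at a + b + 1, and
    follows a quadratic from a + b + 2 on. The leading term is the product of the two means, and
    [bst_beta] is minus the linear coefficient, read off at a + b + 2. *)
Lemma bst_pairs m : m 0%N = 0 ->
  (forall n, (0 < n)%N -> m n = 2 / n%:R * conv n + 2 / n%:R * \sum_(j < n) m j) ->
  forall n, ((a + b).+2 <= n)%N ->
  m n = n.+1%:R ^+ 2 * bst_weight R a * bst_weight R b - bst_beta R a b * n.+1%:R.
Proof.
move=> m0 rec0.
have rec n : (0 < n)%N -> n%:R * m n = 2 * conv n + 2 * \sum_(j < n) m j.
  by move=> n0; rewrite rec0 //; field; rewrite pnatr_eq0 -lt0n.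
have m_small n : (n <= a + b)%N -> m n = 0.
  elim/ltn_ind: n => -[//|n] IH nab; apply: (@mulfI _ n.+1%:R); first by rewrite pnatr_eq0.
  rewrite rec // bst_conv_small // big1 ?mulr0 ?addr0 // => j _.
  by rewrite IH // (leq_trans (ltnW (ltn_ord j))).
have m1 : m (a + b).+1 = 2 / (a + b).+1%:R.
  apply: (@mulfI _ (a + b).+1%:R); first by rewrite pnatr_eq0.
  rewrite rec // bst_conv_base big1 => [|j _]; last by rewrite m_small // -ltnS.
  by rewrite mulrCA divff ?pnatr_eq0 // !mulr1 mulr0 addr0.
suff H : forall n, ((a + b).+2 <= n)%N ->
    m n = (bst_weight R a * bst_weight R b) * n.+1%:R ^+ 2 - bst_beta R a b * n.+1%:R.
  by move=> n /H ->; rewrite mulrC mulrA.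
apply: (@divide_quadratic m (fun n => 2 * conv n)) => //.
- apply: (@mulfI _ (a + b).+2%:R); first by rewrite pnatr_eq0.
  rewrite rec // big_ord_recr /= m1 big1 ?add0r => [|j _]; last by rewrite m_small // -ltnS.
  have := bst_convE 0; rewrite big_ord0 mulr0 addr0 !addn0 => ->.
  rewrite /bst_weight /bst_beta !(natrM, natrD, natrX) -!natr1 !natrD.
  by field; natnz.
- move=> n nab; rewrite -(subnKC nab); move: (n - _)%N => e {n nab}.
  have := bst_convE e.+1; rewrite addnS !addSn => ->; rewrite bst_convE.
  rewrite !sum_affine_product !addnS.
  rewrite /bst_weight !(natrM, natrD) -!natr1 !natrD.
  by field; natnz.
Qed.

End BstPairs.

Section RecursivePairs.
Variables a b : nat.

(* The mean number of non-root subtrees with [k.+1] nodes in the random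
   recursive tree with [n.+1] nodes. *)
Definition rrt_kernel k n : R := (k < n)%:R * n.+1%:R / (k.+1 * k.+2)%:R.

Let full k n : R := (n == k)%:R + rrt_kernel k n.

(** Removing the first child of the root leaves two trees that play different roles: the root of the
    child is a genuine subtree and is counted in [full], whereas the root of the rest is the old
    root and is not. Adding the two assignments of [a] and [b] restores the symmetry of the
    covariance. *)
Let conv n := \sum_(j < n) (full a j * rrt_kernel b (n.-1 - j)%N
  + full b j * rrt_kernel a (n.-1 - j)%N).

Lemma rrt_kernel_le k n : (n < k.+1)%N -> rrt_kernel k n = 0.
Proof. by rewrite ltnS => nk; rewrite /rrt_kernel ltnNge nk !mul0r. Qed.

Lemma rrt_kernel_gt k n : (k < n)%N -> rrt_kernel k n = n.+1%:R / (k.+1 * k.+2)%:R.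
Proof. by move=> kn; rewrite /rrt_kernel kn mul1r. Qed.

Lemma full_lt k n : (n < k)%N -> full k n = 0.
Proof. by move=> nk; rewrite /full ltn_eqF // add0r rrt_kernel_le // ltnS ltnW. Qed.

Lemma rrt_half_convE c d e :
  \sum_(j < (c + d + e).+2) full c j * rrt_kernel d ((c + d + e).+1 - j)%N =
  (d + e).+2%:R / (d.+1 * d.+2)%:R + ((c.+1 * c.+2)%:R)^-1 * ((d.+1 * d.+2)%:R)^-1 *
    \sum_(i < e) (c%:R + 2 + i%:R) * (d%:R + e%:R + 1 - i%:R).
Proof.
have := sum_convolution_support e (@full_lt c) (@rrt_kernel_le d).
rewrite addnS addSn => ->.
rewrite big_ord_recl /= addn0 subn0 /full eqxx rrt_kernel_le ?leqnn // addr0 mul1r.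
rewrite rrt_kernel_gt; last by lia.
rewrite addSn; congr (_ + _).
rewrite mulr_sumr; apply: eq_bigr => i _; rewrite /bump /= add1n.
have ie := ltn_ord i.
rewrite gtn_eqF ?add0r; last by lia.
rewrite !rrt_kernel_gt; [|lia..].
have -> : (d.+1 + (e - i.+1)).+1 = (d + e - i).+1 by lia.
rewrite -[(d + e - i).+1]addn1 natrD natrB ?natrD; last by lia.
rewrite -[(c + i.+1).+1]addn1 addnS -addn1 !natrD.
by ring.
Qed.

Lemma rrt_pairs m : m 0%N = 0 ->
  (forall n, (0 < n)%N -> m n = n%:R^-1 * conv n + 2 / n%:R * \sum_(j < n) m j) ->
  forall n, ((a + b).+2 <= n)%N ->
  m n = n.+1%:R ^+ 2 / (a.+1 * a.+2)%:R / (b.+1 * b.+2)%:R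
    - rrt_beta R a.+1 b.+1 * n.+1%:R.
Proof.
move=> m0 rec0.
have rec n : (0 < n)%N -> n%:R * m n = conv n + 2 * \sum_(j < n) m j.
  by move=> n0; rewrite rec0 //; field; rewrite pnatr_eq0 -lt0n.
have convE e : conv (a + b + e).+2 =
   \sum_(j < (a + b + e).+2) full a j * rrt_kernel b ((a + b + e).+1 - j)%N +
   \sum_(j < (b + a + e).+2) full b j * rrt_kernel a ((b + a + e).+1 - j)%N.
  by rewrite [(b + a)%N]addnC -big_split.
have conv_small n : (n <= a + b + 1)%N -> conv n = 0.
  move=> nab; rewrite /conv big_split /= (@sum_convolution0 _ _ a b.+1) ?add0r.
  - by apply: (@sum_convolution0 _ _ b a.+1); [exact: full_lt|exact: rrt_kernel_le|lia].
  - exact: full_lt.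
  - exact: rrt_kernel_le.
  - by lia.
have m_small n : (n <= a + b + 1)%N -> m n = 0.
  elim/ltn_ind: n => -[//|n] IH nab; apply: (@mulfI _ n.+1%:R); first by rewrite pnatr_eq0.
  rewrite rec // conv_small // big1 ?mulr0 ?addr0 // => j _.
  by rewrite IH // (leq_trans (ltnW (ltn_ord j))).
suff H : forall n, ((a + b).+2 <= n)%N -> m n =
    ((a.+1 * a.+2)%:R^-1 / (b.+1 * b.+2)%:R) * n.+1%:R ^+ 2 - rrt_beta R a.+1 b.+1 * n.+1%:R.
  by move=> n /H ->; congr (_ - _); ring.
apply: (@divide_quadratic m conv) => //.
- apply: (@mulfI _ (a + b).+2%:R); first by rewrite pnatr_eq0.
  rewrite rec // big1 ?mulr0 ?addr0 => [|j _]; last first.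
    by rewrite m_small //; have := ltn_ord j; lia.
  have := convE 0%N; rewrite !rrt_half_convE !big_ord0 !mulr0 !addr0 !addn0 => ->.
  rewrite /rrt_beta !(natrM, natrD, natrX) -!natr1 !natrD.
  by field; natnz.
- move=> n nab; rewrite -(subnKC nab); move: (n - _)%N => e {n nab}.
  have c0 := convE e; have c1 := convE e.+1.
  rewrite !rrt_half_convE !sum_affine_product in c0 c1.
  rewrite !(addnS, addSn) in c0 c1 *; rewrite c1 c0 {c0 c1}.
  rewrite !(natrM, natrD) -!natr1 !natrD.
  by field; natnz.
Qed.

End RecursivePairs.

End QuadraticSolutions.

(** * Second moments by superposition over sizes *)

Section ExactVariance.
Variable R : realType.
Implicit Types (u v w : nat -> R).

Lemma varianceE (X : bintree -> R) n :
  variance X n = bstE n (fun T => X T ^+ 2) - bstE n X ^+ 2.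
Proof.
set mu := bstE n X; rewrite /variance.
rewrite (@bstE_eq _ _ _ (fun T => X T ^+ 2 - (2 * mu) * X T + mu ^+ 2)).
  by rewrite bstED bstEB bstEZ bstE_cst -/mu; ring.
by move=> T Tn; rewrite /centered Tn -/mu; ring.
Qed.

Lemma sum_ord_eq w N (n : nat) : (forall a, (N <= a)%N -> w a = 0) ->
  \sum_(a < N) (n == a)%:R * w a = w n.
Proof.
move=> wN; have [nN|Nn] := ltnP n N.
  rewrite (bigD1 (Ordinal nN)) //= [X in X + _](_ : _ = w n); last first.
    by rewrite [_ == _]eqxx mul1r.
  rewrite big1 ?addr0 // => i iN; rewrite [_ == _](_ : _ = false) ?mul0r //.
  by apply/negbTE; apply: contra iN => /eqP ni; apply/eqP/val_inj; rewrite /= -ni.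
rewrite wN // big1 // => i _; case: eqP => [ni|_]; last by rewrite mul0r.
by have := ltn_ord i; rewrite -ni ltnNge Nn.
Qed.

Lemma sum_ord_lt w N (n : nat) : (forall a, (N <= a)%N -> w a = 0) ->
  \sum_(a < N) (a < n)%:R * w a = \sum_(k < n) w k.
Proof.
move=> wN; elim: n => [|n IH].
  by rewrite big_ord0 big1 // => i _; rewrite mul0r.
rewrite big_ord_recr /= -IH -(sum_ord_eq n wN) -big_split /=; apply: eq_bigr => a _.
rewrite -mulrDl -natrD; congr (_%:R * _).
by rewrite ltnS leq_eqVlt; case: ltngtP.
Qed.

Section Bst.
Variables (phi X : bintree -> R) (N : nat).
Hypothesis phi2 : forall T, phi T ^+ 2 = phi T.
Hypothesis X_empty : X BEmpty = 0.
Hypothesis X_node : forall l r, X (BNode l r) = X l + X r + phi (BNode l r).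
Hypothesis phi_le : forall T, (N < bt_size T)%N -> phi T = 0.

(** [p] and [c] are the sources of the first and second moments: as phi^2 = phi, the square of X is
    the square of X l + X r plus phi (2 X - 1). At size 0 both are set to 0, since the empty tree is
    not counted. *)
Let p k := if k is 0 then 0 else bstE k phi.
Let c k := if k is 0 then 0 else bstE k (fun T => phi T * (2 * X T - 1)).
Let mu n := bstE n X.
Let d n : R := 2 / n%:R * \sum_(j < n) mu j * mu (n.-1 - j)%N.

Let p_out a : (N.+1 <= a)%N -> p a = 0.
Proof.
case: a => // a Na; rewrite /p (@bstE_eq _ _ _ (fun=> 0)) ?bstE_cst // => T Ta.
by apply: phi_le; rewrite Ta.
Qed.

Let c_out a : (N.+1 <= a)%N -> c a = 0.
Proof.
case: a => // a Na; rewrite /c (@bstE_eq _ _ _ (fun=> 0)) ?bstE_cst // => T Ta.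
by rewrite phi_le ?mul0r // Ta.
Qed.

Let mu_rec n : mu n = p n + 2 / n%:R * \sum_(j < n) mu j.
Proof.
case: n => [|n]; first by rewrite big_ord0 mulr0 addr0 /mu bstE0.
rewrite /mu /p !bstES (@splitE_eq _ _ _ (fun l r => X l + X r + phi (BNode l r))) => [|l r _].
  by rewrite !splitED splitEl splitEr addrC; congr (_ + _); ring.
exact: X_node.
Qed.

Lemma bst_meanE n : mu n = p n + n.+1%:R * bst_series p n.
Proof. exact/divide_rec/mu_rec. Qed.

Let mu_kernel n : mu n = \sum_(a < N.+1) p a * bst_kernel R a n.
Proof.
rewrite bst_meanE -(sum_ord_eq n p_out) /bst_series.
rewrite -(@sum_ord_lt (fun k => bst_weight R k * p k) N.+1 n) => [|a Na]; last first.
  by rewrite p_out // mulr0.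
rewrite mulr_sumr -big_split /=; apply: eq_bigr => a _; rewrite /bst_kernel; ring.
Qed.

Let e_rec n : bstE n (fun T => X T ^+ 2) =
  c n + d n + 2 / n%:R * \sum_(j < n) bstE j (fun T => X T ^+ 2).
Proof.
case: n => [|n].
  by rewrite /d !big_ord0 !mulr0 !addr0 bstE0 X_empty expr0n.
rewrite /c /d !bstES (@splitE_eq _ _ _ (fun l r => (phi (BNode l r) * (2 * X (BNode l r) - 1)
    + 2 * (X l * X r)) + (X l ^+ 2 + X r ^+ 2))) => [|l r _].
  rewrite !splitED splitEl splitEr splitEZ splitEM; congr (_ + _); first congr (_ + _).
    by rewrite mulrA mulrAC.
  by ring.
have e := phi2 (BNode l r); rewrite X_node.
set q := phi _ in e *.
have -> : q * (2 * (X l + X r + q) - 1) = 2 * q * (X l + X r) + 2 * q ^+ 2 - q by ring.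
by rewrite -[in - q]e; ring.
Qed.

Let e_series n : bstE n (fun T => X T ^+ 2) =
  (c n + n.+1%:R * bst_series c n) + (d n + n.+1%:R * bst_series d n).
Proof.
rewrite (divide_rec e_rec) /bst_series.
under eq_bigr do rewrite mulrDr.
by rewrite big_split /=; ring.
Qed.

Let dab a b n : R := 2 / n%:R * \sum_(j < n) bst_kernel R a j * bst_kernel R b (n.-1 - j)%N.

Let d_kernel n : d n = \sum_(a < N.+1) \sum_(b < N.+1) p a * p b * dab a b n.
Proof.
rewrite /d; under eq_bigr do rewrite !mu_kernel big_distrlr /=.
rewrite exchange_big mulr_sumr /=; apply: eq_bigr => a _.
rewrite exchange_big mulr_sumr /=; apply: eq_bigr => b _.
rewrite /dab mulrCA; congr (_ * _); rewrite mulr_sumr; apply: eq_bigr => j _.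
by rewrite mulrACA.
Qed.

(** The second moment is linear in its sources [c] and [d]. The source [c] contributes exactly (n+1)
    times its series; [d] is bilinear in [p] and is solved pair by pair with [bst_pairs], whose
    leading terms cancel the squared mean. The threshold ensures n >= a + b + 2 for all sizes up to
    N. *)
Lemma bst_variance_exact n : (2 * N.+1 <= n)%N ->
  variance X n = n.+1%:R * (\sum_(k < N.+1) bst_weight R k * c k
    - \sum_(a < N.+1) \sum_(b < N.+1) bst_beta R a b * p a * p b).
Proof.
move=> Nn; rewrite varianceE e_series c_out ?add0r; last by lia.
have -> : bst_series c n = \sum_(k < N.+1) bst_weight R k * c k.
  rewrite /bst_series -(@sum_ord_lt (fun k => bst_weight R k * c k) N.+1 n) => [|a Na]; last first.
    by rewrite c_out // mulr0.
  apply: eq_bigr => k _; rewrite [(k < n)%N](_ : _ = true) ?mul1r //.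
  by have := ltn_ord k; lia.
have -> : d n + n.+1%:R * bst_series d n = \sum_(a < N.+1) \sum_(b < N.+1)
    p a * p b * (dab a b n + n.+1%:R * bst_series (dab a b) n).
  rewrite d_kernel /bst_series.
  under [X in _ + _ * X]eq_bigr do rewrite d_kernel mulr_sumr.
  rewrite [X in _ + _ * X]exchange_big mulr_sumr -big_split /=; apply: eq_bigr => a _.
  under [X in _ + _ * X]eq_bigr do rewrite mulr_sumr.
  rewrite [X in _ + _ * X]exchange_big mulr_sumr -big_split /=; apply: eq_bigr => b _.
  rewrite mulrDr; congr (_ + _); rewrite mulrCA; congr (_ * _).
  by rewrite mulr_sumr; apply: eq_bigr => k _; rewrite mulrCA.
have -> : \sum_(a < N.+1) \sum_(b < N.+1)
    p a * p b * (dab a b n + n.+1%:R * bst_series (dab a b) n) =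
   \sum_(a < N.+1) \sum_(b < N.+1) p a * p b *
     (n.+1%:R ^+ 2 * bst_weight R a * bst_weight R b - bst_beta R a b * n.+1%:R).
  apply: eq_bigr => a _; apply: eq_bigr => b _; congr (_ * _).
  apply: (@bst_pairs R a b (fun n => dab a b n + n.+1%:R * bst_series (dab a b) n)).
  - by rewrite /dab /bst_series !big_ord0 !mulr0 addr0.
  - by move=> k k0; rewrite divide_rec_solution divff ?mul1r // pnatr_eq0 -lt0n.
  - by have := ltn_ord a; have := ltn_ord b; lia.
have -> : bstE n X = n.+1%:R * \sum_(a < N.+1) p a * bst_weight R a.
  rewrite -/(mu n) mu_kernel mulr_sumr; apply: eq_bigr => a _.
  by rewrite bst_kernel_gt 1?mulrCA //; have := ltn_ord a; lia.
rewrite exprMn [X in _ - _ * X]expr2 big_distrlr /= mulrBr !mulr_sumr.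
rewrite -[LHS]addrA; congr (_ + _).
rewrite -sumrB -sumrN; apply: eq_bigr => a _.
rewrite !mulr_sumr -sumrB -sumrN; apply: eq_bigr => b _; ring.
Qed.

End Bst.

Section Rrt.
Variables (phi X : bintree -> R) (N : nat).
Hypothesis phi2 : forall T, phi T ^+ 2 = phi T.
Hypothesis X_empty : X BEmpty = phi BEmpty.
Hypothesis X_node : forall l r,
  X (BNode l r) = X l + X r + (phi (BNode l r) - phi r).
Hypothesis phi_le : forall T, (N <= bt_size T)%N -> phi T = 0.

Let p k := bstE k phi.
Let c k := bstE k (fun T => phi T * (2 * X T - 1)).
(** The count without the root. The root of the rotated right part is the root of the whole tree, so
    [G] satisfies G (BNode l r) = X l + G r, with no toll. *)
Let G T := X T - phi T.
Let gam n := bstE n G.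

Let G_node l r : G (BNode l r) = X l + G r.
Proof. by rewrite /G X_node; ring. Qed.

Let p_out a : (N <= a)%N -> p a = 0.
Proof.
move=> Na; rewrite /p (@bstE_eq _ _ _ (fun=> 0)) ?bstE_cst // => T Ta.
by apply: phi_le; rewrite Ta.
Qed.

Let c_out a : (N <= a)%N -> c a = 0.
Proof.
move=> Na; rewrite /c (@bstE_eq _ _ _ (fun=> 0)) ?bstE_cst // => T Ta.
by rewrite phi_le ?mul0r // Ta.
Qed.

Lemma sum_rrt_kernel a n : \sum_(j < n) rrt_kernel R a j =
  (a < n)%:R * (n%:R * n.+1%:R / 2 / (a.+1 * a.+2)%:R - 2^-1).
Proof.
elim: n => [|n IH]; first by rewrite big_ord0 mul0r.
rewrite big_ord_recr /= IH /rrt_kernel; case: (ltngtP a n) => [an|na|->].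
- rewrite ltnS (ltnW an) !mul1r natrM -[a.+2%:R]natr1 -[a.+1%:R]natr1.
  by rewrite -[n.+2%:R]natr1 -[n.+1%:R]natr1; field; natnz.
- by rewrite ltnS leqNgt na !mul0r addr0.
- rewrite ltnSn !mul0r mul1r addr0 natrM -[n.+2%:R]natr1 -[n.+1%:R]natr1.
  by field; natnz.
Qed.

Lemma rrt_kernel_rec a n : (0 < n)%N -> rrt_kernel R a n =
  n%:R^-1 * (a < n)%:R + 2 / n%:R * \sum_(j < n) rrt_kernel R a j.
Proof.
case: n => // n _; rewrite sum_rrt_kernel /rrt_kernel; case: (a < n.+1)%N.
  rewrite /= !mulr1n natrM -[a.+2%:R]natr1 -[a.+1%:R]natr1 -[n.+2%:R]natr1 -[n.+1%:R]natr1.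
  by field; natnz.
by rewrite !mul0r !mulr0 addr0.
Qed.

Lemma rrt_kernel_solution (q z : nat -> R) M : (forall a, (M <= a)%N -> q a = 0) ->
  z 0%N = 0 ->
  (forall n, (0 < n)%N ->
     z n = n%:R^-1 * \sum_(j < n) q j + 2 / n%:R * \sum_(j < n) z j) ->
  forall n, z n = \sum_(a < M) q a * rrt_kernel R a n.
Proof.
move=> qM z0 zr; apply: (divide_rec_unique zr) => [n n0|].
  rewrite -(sum_ord_lt n qM) exchange_big !mulr_sumr -big_split /=.
  apply: eq_bigr => a _; rewrite rrt_kernel_rec // -mulr_sumr; ring.
by rewrite z0 big1 // => a _; rewrite rrt_kernel_le ?mulr0.
Qed.

Let muX n : bstE n X = p n + gam n.
Proof.
by rewrite /p /gam -bstED; apply: bstE_eq => T _; rewrite /G addrC subrK.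
Qed.

Let G_empty : G BEmpty = 0. Proof. by rewrite /G X_empty subrr. Qed.

Let gam_rec n : (0 < n)%N ->
  gam n = n%:R^-1 * \sum_(j < n) p j + 2 / n%:R * \sum_(j < n) gam j.
Proof.
case: n => // n _; rewrite {1}/gam bstES (@splitE_eq _ _ _ (fun l r => X l + G r)) => [|l r _].
  rewrite splitED splitEl splitEr; under eq_bigr do rewrite muX.
  by rewrite big_split /= -/gam; ring.
exact: G_node.
Qed.

Let gam_kernel n : gam n = \sum_(a < N) p a * rrt_kernel R a n.
Proof.
by apply: (rrt_kernel_solution p_out _ gam_rec); rewrite /gam bstE0 G_empty.
Qed.

Let g_rec n : (0 < n)%N -> bstE n (fun T => G T ^+ 2) =
  n%:R^-1 * \sum_(j < n) c j
  + 2 / n%:R * \sum_(j < n) bstE j X * gam (n.-1 - j)%N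
  + 2 / n%:R * \sum_(j < n) bstE j (fun T => G T ^+ 2).
Proof.
case: n => // n _; rewrite bstES (@splitE_eq _ _ _ (fun l r =>
    X l ^+ 2 + G r ^+ 2 + 2 * (X l * G r))) => [|l r _]; last by rewrite G_node; ring.
rewrite !splitED splitEl splitEr splitEZ splitEM.
have X2 j : bstE j (fun T => X T ^+ 2) = c j + bstE j (fun T => G T ^+ 2).
  rewrite /c -bstED; apply: bstE_eq => T _; have e := phi2 T; rewrite /G.
  have -> : phi T * (2 * X T - 1) + (X T - phi T) ^+ 2 =
    X T ^+ 2 + phi T ^+ 2 - phi T by ring.
  by rewrite e addrK.
by under eq_bigr do rewrite X2; rewrite big_split /=; ring.
Qed.

Let dab a b n : R := n%:R^-1 * \sum_(j < n)
  (((j : nat) == a)%:R + rrt_kernel R a j) * rrt_kernel R b (n.-1 - j)%N.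

Let dsym a b n : R := n%:R^-1 * \sum_(j < n)
  ((((j : nat) == a)%:R + rrt_kernel R a j) * rrt_kernel R b (n.-1 - j)%N +
   (((j : nat) == b)%:R + rrt_kernel R b j) * rrt_kernel R a (n.-1 - j)%N).

Let d n : R := 2 / n%:R * \sum_(j < n) bstE j X * gam (n.-1 - j)%N.

Let d_kernel n : d n = \sum_(a < N) \sum_(b < N) p a * p b * dsym a b n.
Proof.
have half : n%:R^-1 * \sum_(j < n) bstE j X * gam (n.-1 - j)%N =
    \sum_(a < N) \sum_(b < N) p a * p b * dab a b n.
  have XE j : bstE j X = \sum_(a < N) p a * ((j == a)%:R + rrt_kernel R a j).
    rewrite muX gam_kernel -(sum_ord_eq j p_out) -big_split /=.
    by apply: eq_bigr => a _; ring.
  under eq_bigr do rewrite XE gam_kernel big_distrlr /=.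
  rewrite exchange_big mulr_sumr /=; apply: eq_bigr => a _.
  rewrite exchange_big mulr_sumr /=; apply: eq_bigr => b _.
  rewrite /dab mulrCA; congr (_ * _); rewrite mulr_sumr; apply: eq_bigr => j _.
  by rewrite mulrACA.
rewrite /d -mulrA mulr_natl mulr2n half {2}exchange_big -big_split /=.
apply: eq_bigr => a _; rewrite -big_split /=; apply: eq_bigr => b _.
by rewrite /dab /dsym big_split /= mulrDr; ring.
Qed.

(** At such sizes the root cannot have the property, so [X] and [G] agree. The part of the second
    moment fed by [c] is subtracted in [D], and the rest is solved pair by pair with [rrt_pairs]. *)
Lemma rrt_variance_exact n : (2 * N <= n)%N -> (0 < N)%N ->
  variance X n = n.+1%:R * (\sum_(k < N) (k.+1 * k.+2)%:R^-1 * c k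
    - \sum_(a < N) \sum_(b < N) rrt_beta R a.+1 b.+1 * p a * p b).
Proof.
move=> Nn N0.
have nN : (N <= n)%N by lia.
have -> : variance X n = bstE n (fun T => G T ^+ 2) - gam n ^+ 2.
  have XG T : bt_size T = n -> X T = G T.
    by move=> Tn; rewrite /G phi_le ?subr0 // Tn.
  rewrite varianceE; congr (_ - _ ^+ 2); last exact: bstE_eq.
  by apply: bstE_eq => T /XG ->.
pose D n := bstE n (fun T => G T ^+ 2) - \sum_(a < N) c a * rrt_kernel R a n.
have D_rec k : (0 < k)%N -> D k = d k + 2 / k%:R * \sum_(j < k) D j.
  move=> k0; rewrite /D sumrB g_rec //.
  have -> : \sum_(a < N) c a * rrt_kernel R a k = k%:R^-1 * \sum_(j < k) c j +
      2 / k%:R * \sum_(j < k) \sum_(a < N) c a * rrt_kernel R a j.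
    rewrite -(sum_ord_lt k c_out) exchange_big !mulr_sumr -big_split /=.
    by apply: eq_bigr => a _; rewrite rrt_kernel_rec // -mulr_sumr; ring.
  by rewrite /d; ring.
have D0 : D 0%N = 0.
  rewrite /D bstE0 G_empty expr0n sub0r big1 ?oppr0 // => a _.
  by rewrite rrt_kernel_le ?mulr0.
have DE k : D k = d k + k.+1%:R * bst_series d k.
  apply: divide_rec => -[|i]; last exact: D_rec.
  by rewrite D0 /d !big_ord0 !mulr0 addr0.
have D_val : D n = \sum_(a < N) \sum_(b < N) p a * p b *
    (n.+1%:R ^+ 2 / (a.+1 * a.+2)%:R / (b.+1 * b.+2)%:R
     - rrt_beta R a.+1 b.+1 * n.+1%:R).
  rewrite DE.
  have -> : d n + n.+1%:R * bst_series d n = \sum_(a < N) \sum_(b < N)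
      p a * p b * (dsym a b n + n.+1%:R * bst_series (dsym a b) n).
    rewrite d_kernel /bst_series.
    under [X in _ + _ * X]eq_bigr do rewrite d_kernel mulr_sumr.
    rewrite [X in _ + _ * X]exchange_big mulr_sumr -big_split /=; apply: eq_bigr => a _.
    under [X in _ + _ * X]eq_bigr do rewrite mulr_sumr.
    rewrite [X in _ + _ * X]exchange_big mulr_sumr -big_split /=; apply: eq_bigr => b _.
    rewrite mulrDr; congr (_ + _); rewrite mulrCA; congr (_ * _).
    by rewrite mulr_sumr; apply: eq_bigr => k _; rewrite mulrCA.
  apply: eq_bigr => a _; apply: eq_bigr => b _; congr (_ * _).
  apply: (@rrt_pairs R a b (fun n => dsym a b n + n.+1%:R * bst_series (dsym a b) n)).
  - by rewrite /dsym /bst_series !big_ord0 !mulr0 addr0.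
  - by move=> k k0; rewrite divide_rec_solution divff ?mul1r // pnatr_eq0 -lt0n.
  - by have := ltn_ord a; have := ltn_ord b; lia.
have kerE (a : 'I_N) : rrt_kernel R a n = n.+1%:R / (a.+1 * a.+2)%:R.
  by rewrite rrt_kernel_gt //; have := ltn_ord a; lia.
have -> : bstE n (fun T => G T ^+ 2) = D n + \sum_(a < N) c a * rrt_kernel R a n.
  by rewrite /D subrK.
rewrite D_val gam_kernel [X in _ - X]expr2 [X in _ - X]big_distrlr /=.
rewrite mulrBr !mulr_sumr [LHS]addrAC [RHS]addrC -sumrB -sumrN; congr (_ + _).
  apply: eq_bigr => a _; rewrite mulr_sumr -sumrB -sumrN; apply: eq_bigr => b _.
  by rewrite !kerE; ring.
by apply: eq_bigr => a _; rewrite kerE; ring.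
Qed.

End Rrt.

Lemma rrt_meanE (phi X : bintree -> R) n : X BEmpty = phi BEmpty ->
  (forall l r, X (BNode l r) = X l + X r + (phi (BNode l r) - phi r)) ->
  bstE n X = bstE n phi + n.+1%:R * \sum_(k < n) (k.+1 * k.+2)%:R^-1 * bstE k phi.
Proof.
move=> X0 XN.
have muX k : bstE k X = bstE k phi + bstE k (fun T => X T - phi T).
  by rewrite -bstED; apply: bstE_eq => T _; rewrite addrC subrK.
rewrite muX; congr (_ + _).
(* Here [phi] has no size bound; cutting it off at [n] makes the superposition finite without
   affecting sizes up to [n]. *)
pose q a := (a < n)%:R * bstE a phi.
have zrec k : (k <= n)%N -> bstE k (fun T => X T - phi T) =
    \sum_(a < n) q a * rrt_kernel R a k.
  elim/ltn_ind: k => -[|k] IH kn.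
    by rewrite bstE0 X0 subrr big1 // => a _; rewrite rrt_kernel_le ?mulr0.
  rewrite bstES (@splitE_eq _ _ _ (fun l r => X l + (X r - phi r))) => [|l r _]; last first.
    by rewrite XN; ring.
  rewrite splitED splitEl splitEr.
  under eq_bigr do rewrite muX.
  rewrite big_split /=.
  have -> : \sum_(i < k.+1) bstE i (fun T => X T - phi T) =
      \sum_(i < k.+1) \sum_(a < n) q a * rrt_kernel R a i.
    by apply: eq_bigr => i _; rewrite IH // (leq_trans (ltnW (ltn_ord i))).
  have -> : \sum_(i < k.+1) bstE i phi = \sum_(a < n) (a < k.+1)%:R * q a.
    rewrite sum_ord_lt => [|a na]; last by rewrite /q ltnNge na mul0r.
    apply: eq_bigr => i _; rewrite /q [(i < n)%N](_ : _ = true) ?mul1r //.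
    exact: leq_trans (ltn_ord i) kn.
  have -> : \sum_(a < n) q a * rrt_kernel R a k.+1 = \sum_(a < n)
     (k.+1%:R^-1 * ((a < k.+1)%:R * q a) +
      2 / k.+1%:R * \sum_(i < k.+1) q a * rrt_kernel R a i).
    by apply: eq_bigr => a _; rewrite rrt_kernel_rec // -mulr_sumr; ring.
  by rewrite big_split /= -!mulr_sumr exchange_big /=; ring.
rewrite zrec // mulr_sumr; apply: eq_bigr => a _.
by rewrite /q ltn_ord mul1r rrt_kernel_gt //; ring.
Qed.

End ExactVariance.

(** * Sums of covariances *)

Section SigmaPartial.
Variables (R : realType) (M : random_tree).
Hypothesis size_rtree : forall n (w : sample M n), (0 < n)%N ->
  tree_size (rtree n w) = n.
Hypothesis subtreesP : forall T : tree M, (0 < tree_size T)%N ->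
  exists2 s, perm_eq (subtrees T) (T :: s)
    & forall U, U \in s -> (0 < tree_size U < tree_size T)%N.
Hypothesis finite_size : forall N, finite_set [set T : tree M | (tree_size T <= N)%N].
Variables (pN : nat -> R) (beta : nat -> nat -> R) (P : set (tree M)).
Hypothesis beta_sym : forall k m, beta k m = beta m k.

Definition prop_prob k : R := Ex (fun w : sample M k => (rtree k w \in P)%:R).

Definition prop_pair k : R := Ex (fun w : sample M k =>
  (rtree k w \in P)%:R * (2 * fringe_count R P w - 1)).

Section Partial.
Variable N : nat.

Let PN := [set T | P T /\ (0 < tree_size T <= N)%N].

Let finPN : finite_set PN.
Proof. by apply: sub_finite_set (finite_size N) => T [_ /andP[]]. Qed.

Let e : seq (tree M) := finmap.enum_fset (fset_set PN).

Let mem_e T : (T \in e) = (T \in P) && (0 < tree_size T <= N)%N.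
Proof.
transitivity (T \in PN); first exact: (in_fset_set finPN T).
apply/idP/idP.
  by move=> /set_mem[PT ->]; rewrite mem_set.
by case/andP=> /set_mem PT TN; rewrite mem_set.
Qed.

Let uniq_e : uniq e. Proof. exact: finmap.fset_uniq. Qed.

Lemma sum_ptree (g : tree M -> R) : \sum_(T <- e) ptree R T * g T =
  \sum_(1 <= k < N.+1) Ex (fun w : sample M k => (rtree k w \in P)%:R * g (rtree k w)).
Proof.
have -> : \sum_(T <- e) ptree R T * g T =
    \sum_(T <- e) \sum_(1 <= k < N.+1) (tree_size T == k)%:R * (ptree R T * g T).
  rewrite !big_seq; apply: eq_bigr => T; rewrite mem_e => /andP[_ /andP[T0 TN]].
  rewrite (bigD1_seq (tree_size T)) ?iota_uniq ?mem_index_iota ?T0 //= eqxx mul1r.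
  by rewrite big1 ?addr0 // => k kT; rewrite eq_sym (negbTE kT) mul0r.
rewrite exchange_big /= !big_seq; apply: eq_bigr => k.
rewrite mem_index_iota ltnS => /andP[k0 kN].
have -> : \sum_(T <- e) (tree_size T == k)%:R * (ptree R T * g T) =
    Ex (fun w : sample M k => \sum_(T <- e) (rtree k w == T)%:R * g T).
  rewrite /Ex exchange_big /= mulr_suml; apply: eq_bigr => T _.
  case: eqP => [<-|Tk]; last first.
    rewrite mul0r big1 ?mul0r // => w _; case: eqP => [wT|_]; last by rewrite mul0r.
    by case: Tk; rewrite -wT size_rtree.
  rewrite mul1r /ptree /Pr mulrAC -mulr_suml; congr (_ * _ / _).
  by rewrite -sum1_card natr_sum big_mkcond; apply: eq_bigr => w _; rewrite inE; case: eqP.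
congr (_ / _); apply: eq_bigr => w _.
have sz : tree_size (rtree k w) = k by exact: size_rtree.
have [wP|wP] := boolP (rtree k w \in P); last first.
  rewrite mul0r big1_seq // => T /andP[_ Te]; case: eqP => [wT|_]; last by rewrite mul0r.
  by move: Te; rewrite mem_e -wT (negbTE wP).
rewrite mul1r (bigD1_seq (rtree k w)) ?uniq_e //=; last by rewrite mem_e wP sz k0.
rewrite eqxx mul1r big1 ?addr0 // => T Tw.
by rewrite eq_sym (negbTE Tw) mul0r.
Qed.

Lemma sum_count_mem (q : pred (tree M)) (s : seq (tree M)) :
  \sum_(T <- e | q T) ((count_mem T s)%:R : R) =
  (count (fun U => (U \in e) && q U) s)%:R.
Proof.
elim: s => [|U s IH]; first by rewrite big1.
rewrite /= natrD -IH.
under eq_bigr do rewrite natrD.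
rewrite big_split /=; congr (_ + _).
have [Ue|Ue] := boolP (U \in e); last first.
  rewrite big1_seq // => T /andP[_ Te]; case: eqP => // UT.
  by rewrite UT Te in Ue.
rewrite big_mkcond (bigD1_seq U) //= eqxx big1 ?addr0 => [|T TU]; last first.
  by rewrite eq_sym (negbTE TU); case: (q T).
by case: (q U).
Qed.

(** Exchanging the trees in the half of the sum where the second is larger puts the larger tree
    first everywhere. For fixed T, the trees of size at most |T| then count all its subtrees in P
    and those of smaller size all but T itself, whence the factor 2 count - 1. *)
Lemma sigma2_partialE : sigma2_partial pN beta P N =
  \sum_(1 <= k < N.+1) pN k * prop_pair k
  - \sum_(1 <= a < N.+1) \sum_(1 <= b < N.+1) beta a b * prop_prob a * prop_prob b.
Proof.
rewrite /sigma2_partial -/PN fsbig_finite //.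
under eq_bigr do rewrite fsbig_finite //.
rewrite -/e.
pose h (T T' : tree M) : R := pN (tree_size T) * (count_mem T' (subtrees T))%:R * ptree R T.
have sigmaE (T T' : tree M) : sigma pN beta T T' =
    ((tree_size T' <= tree_size T)%N%:R * h T T' + (tree_size T < tree_size T')%N%:R * h T' T)
    - beta (tree_size T) (tree_size T') * ptree R T * ptree R T'.
  rewrite /sigma /sigma_ge /h ltnNge; case: (leqP (tree_size T') _) => _ /=.
    by rewrite mul1r mul0r addr0.
  by rewrite mul0r mul1r add0r beta_sym; congr (_ - _); ring.
under eq_bigr do under eq_bigr do rewrite sigmaE.
under eq_bigr do rewrite sumrB.
rewrite sumrB; congr (_ - _).
  under eq_bigr do rewrite big_split.
  rewrite big_split /= [X in _ + X]exchange_big -big_split /=.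
  have -> : \sum_(T <- e) (\sum_(T' <- e) (tree_size T' <= tree_size T)%N%:R * h T T' +
      \sum_(T' <- e) (tree_size T' < tree_size T)%N%:R * h T T') =
    \sum_(T <- e) ptree R T * (pN (tree_size T) *
      (2 * (count (mem P) (subtrees T))%:R - 1)).
    rewrite !big_seq; apply: eq_bigr => T Te.
    move: (Te); rewrite mem_e => /andP[PT /andP[T0 TN]].
    have [s sub sizes] := subtreesP T0.
    have pull (q : pred (tree M)) : \sum_(T' <- e) (q T')%:R * h T T' =
        pN (tree_size T) * ptree R T * (count (fun U => (U \in e) && q U) (subtrees T))%:R.
      rewrite -sum_count_mem [X in _ = _ * X]big_mkcond mulr_sumr; apply: eq_bigr => T' _.
      by rewrite /h; case: (q T'); rewrite ?mul1r ?mul0r ?mulr0 //; ring.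
    rewrite (pull (fun T' => (tree_size T' <= tree_size T)%N)).
    rewrite (pull (fun T' => (tree_size T' < tree_size T)%N)).
    rewrite !(seq.permP sub) /= Te leqnn ltnn PT /=.
    have cP : count (fun U => (U \in e) && (tree_size U <= tree_size T)%N) s = count (mem P) s.
      apply: eq_in_count => U /sizes /andP[U0 UT].
      by rewrite mem_e U0 (ltnW UT) (leq_trans (ltnW UT) TN) !andbT.
    have cP' : count (fun U => (U \in e) && (tree_size U < tree_size T)%N) s = count (mem P) s.
      apply: eq_in_count => U /sizes /andP[U0 UT].
      by rewrite mem_e U0 UT (leq_trans (ltnW UT) TN) !andbT.
    by rewrite cP cP' !natrD; ring.
  rewrite sum_ptree; apply: eq_big_nat => k /andP[k0 _].
  rewrite /prop_pair -ExZ; congr (_ / _); apply: eq_bigr => w _.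
  by rewrite size_rtree // /fringe_count mulrCA.
have -> : \sum_(T <- e) \sum_(T' <- e)
      beta (tree_size T) (tree_size T') * ptree R T * ptree R T' =
    \sum_(T <- e) ptree R T * \sum_(1 <= b < N.+1) beta (tree_size T) b * prop_prob b.
  apply: eq_bigr => T _.
  have -> : \sum_(1 <= b < N.+1) beta (tree_size T) b * prop_prob b =
      \sum_(T' <- e) ptree R T' * beta (tree_size T) (tree_size T').
    rewrite sum_ptree; apply: eq_big_nat => b /andP[b0 _].
    rewrite /prop_prob -ExZ; congr (_ / _); apply: eq_bigr => w _.
    by rewrite size_rtree // mulrC.
  by rewrite mulr_sumr; apply: eq_bigr => T' _; ring.
rewrite sum_ptree; apply: eq_big_nat => a /andP[a0 _].
under eq_bigr do rewrite -mulrA mulrCA.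
rewrite -mulr_sumr mulrC /prop_prob -ExZ; congr (_ / _); apply: eq_bigr => w _.
by rewrite size_rtree // mulrC.
Qed.

End Partial.

End SigmaPartial.

(** * Limit laws for a random tree *)

Section Rates.
Variable R : realType.

(** A power bound replaces the logarithm: the fourth root is enough against a decay of 1 / sqrt n.
    With q and r consecutive fourth roots, r^4 - q^4 = 1 factors through r - q, and r >= 1. *)
Lemma harmonic_le n :
  \sum_(k < n) k.+1%:R^-1 <= 4 * Num.sqrt (Num.sqrt n%:R) :> R.
Proof.
elim: n => [|n IH]; first by rewrite big_ord0 mulr_ge0.
rewrite big_ord_recr /=.
suff : n.+1%:R^-1 <= 4 * Num.sqrt (Num.sqrt n.+1%:R) - 4 * Num.sqrt (Num.sqrt n%:R) :> R.
  by move=> step; apply: le_trans (lerD IH step) _; rewrite addrC subrK.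
have q0 : 0 <= Num.sqrt (Num.sqrt n%:R) :> R by [].
have q1 : 1 <= Num.sqrt (Num.sqrt n.+1%:R) :> R.
  by rewrite -[leLHS]sqrtr1 ler_wsqrtr // -[leLHS]sqrtr1 ler_wsqrtr // ler1n.
have e0 : n%:R = Num.sqrt (Num.sqrt n%:R) ^+ 4 :> R.
  by rewrite -[4%N]/(2 * 2)%N exprM !sqr_sqrtr.
have e1 : n.+1%:R = Num.sqrt (Num.sqrt n.+1%:R) ^+ 4 :> R.
  by rewrite -[4%N]/(2 * 2)%N exprM !sqr_sqrtr.
have le_q : Num.sqrt (Num.sqrt n%:R) <= Num.sqrt (Num.sqrt n.+1%:R) :> R.
  by rewrite !ler_wsqrtr // ler_nat.
have e : Num.sqrt (Num.sqrt n.+1%:R) ^+ 4 = Num.sqrt (Num.sqrt n%:R) ^+ 4 + 1 :> R.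
  by rewrite -e0 -e1 natr1.
rewrite {1}e1; move: e {e0 e1}.
move: (Num.sqrt (Num.sqrt n%:R)) (Num.sqrt (Num.sqrt n.+1%:R)) q0 q1 le_q => q r q0 q1 qr e.
have r4 : 0 < r ^+ 4 by rewrite exprn_gt0 //; lra.
rewrite -[leLHS]mul1r ler_pdivrMr //.
have fact : (r - q) * ((r + q) * (r ^+ 2 + q ^+ 2)) = 1.
  have -> : (r - q) * ((r + q) * (r ^+ 2 + q ^+ 2)) = r ^+ 4 - q ^+ 4 by ring.
  by rewrite e; ring.
rewrite -[leLHS]fact; have -> : (4 * r - 4 * q) * r ^+ 4 = (r - q) * (4 * r ^+ 4) by ring.
apply: ler_wpM2l; first by rewrite subr_ge0.
apply: (@le_trans _ _ ((2 * r) * (2 * r ^+ 2))).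
  apply: ler_pM.
  - by lra.
  - by rewrite addr_ge0 // sqr_ge0.
  - by lra.
  - have : q ^+ 2 <= r ^+ 2 by rewrite ler_pXn2r ?nnegrE //; lra.
    by lra.
have -> : 2 * r * (2 * r ^+ 2) = 4 * r ^+ 3 by ring.
by rewrite ler_wpM2l // [leRHS]exprS ler_peMl // exprn_ge0 //; lra.
Qed.

Lemma cvg_inv_sqrt : (Num.sqrt n%:R)^-1 @[n --> \oo] --> (0 : R).
Proof.
have inv0 : n%:R^-1 @[n --> \oo] --> (0 : R).
  by apply/gtr0_cvgV0; [near=> n; rewrite ltr0n; near: n; exact: nbhs_infty_gt | exact: cvgr_idn].
have : Num.sqrt n%:R^-1 @[n --> \oo] --> Num.sqrt (0 : R).
  by apply: continuous_cvg inv0; exact: sqrt_continuous.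
rewrite sqrtr0; apply: cvg_trans; apply: near_eq_cvg; near=> n.
by rewrite sqrtrV.
Unshelve. all: by end_near. Qed.

Lemma cvg_inv_sqrt2 : (Num.sqrt (Num.sqrt n%:R))^-1 @[n --> \oo] --> (0 : R).
Proof.
have : Num.sqrt (Num.sqrt n%:R)^-1 @[n --> \oo] --> Num.sqrt (0 : R).
  by apply: continuous_cvg cvg_inv_sqrt; exact: sqrt_continuous.
rewrite sqrtr0; apply: cvg_trans; apply: near_eq_cvg; near=> n.
by rewrite sqrtrV // sqrtr_ge0.
Unshelve. all: by end_near. Qed.

Lemma cvg_dist_bound (u d : nat -> R) l : d @ \oo --> (0 : R) ->
  (\forall n \near \oo, `|u n - l| <= d n) -> u @ \oo --> l.
Proof.
move=> d0 ud; apply/subr_cvg0.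
apply: (@squeeze_cvgr _ _ _ _ (fun n => - d n) d) => //.
- by apply: filterS ud => n; rewrite ler_norml.
- by rewrite -oppr0; exact: cvgN.
Qed.

End Rates.

Section CharacteristicLimit.
Variables (R : realType) (X : bintree -> R) (t : bintree -> bintree -> R).
Hypothesis X_node : forall l r, X (BNode l r) = X l + X r + t l r.
Hypothesis X_empty : `|X BEmpty| <= 1.
Hypothesis t_le1 : forall l r, `|t l r| <= 1.
Variables (o : nat) (s2 : R).
Hypothesis var_cvg : variance X (n - o) / n%:R @[n --> \oo] --> s2.

Lemma characteristic_limit tau theta :
  bstE (n - o) (fun T => cos (tau / Num.sqrt n%:R * centered X T + theta))
    @[n --> \oo] --> cos theta * expR (- (s2 * tau ^+ 2 / 2)).
Proof.
set cf := fun n => bstE _ _.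
pose g n := cos theta * expR (- (variance X (n - o) / n%:R * tau ^+ 2 / 2)).
have g_cvg : g @ \oo --> cos theta * expR (- (s2 * tau ^+ 2 / 2)).
  apply: cvgM; first exact: cvg_cst.
  apply: continuous_cvg; first exact: continuous_expR.
  apply: cvgN; rewrite -mulrA; under eq_fun do rewrite -mulrA.
  by apply: cvgM => //; exact: cvg_cst.
rewrite -[X in _ --> X]add0r.
rewrite (_ : cf = fun n => (cf n - g n) + g n); last first.
  by apply/funext => n; rewrite subrK.
apply: cvgD => //.
(* The first two factors 2 come from m + 1 <= 2 n, and 9 = 1 + 2 * 4 from the harmonic bound; what
   remains is n^(-1/2) times the fourth root of n. *)
pose C := 10 ^+ 9 * (2 * `|tau| ^+ 3) * (1 + 2 * `|tau|) * 9.
apply: (@cvg_dist_bound _ _ (fun n => C * (Num.sqrt (Num.sqrt n%:R))^-1)).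
  rewrite -[X in _ --> X](mulr0 C); apply: cvgM; first exact: cvg_cst.
  exact: cvg_inv_sqrt2.
near=> n; rewrite subr0.
have n0 : (0 < n)%N by near: n; exact: nbhs_infty_gt.
have N0 : 0 < n%:R :> R by rewrite ltr0n.
have r1 : 1 <= Num.sqrt n%:R :> R by rewrite -[leLHS]sqrtr1 ler_wsqrtr // ler1n.
have r0 : 0 < Num.sqrt n%:R :> R by exact: lt_le_trans r1.
have q1 : 1 <= Num.sqrt (Num.sqrt n%:R) :> R by rewrite -[leLHS]sqrtr1 ler_wsqrtr.
have q2 : Num.sqrt (Num.sqrt n%:R) ^+ 2 = Num.sqrt n%:R :> R by rewrite sqr_sqrtr.
have rN : Num.sqrt n%:R ^+ 2 = n%:R :> R by rewrite sqr_sqrtr.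
have := characteristic_function_bound X_node X_empty t_le1 (tau / Num.sqrt n%:R) (n - o) theta.
have -> : variance X (n - o) * (tau / Num.sqrt n%:R) ^+ 2 / 2 =
    variance X (n - o) / n%:R * tau ^+ 2 / 2.
  by rewrite expr_div_n rN; field; rewrite gt_eqF.
rewrite -/(g n) -/(cf n) => bound; apply: le_trans bound _.
set m := (n - o)%N; have mn : (m <= n)%N by exact: leq_subr.
have abs_s : `|tau / Num.sqrt n%:R| = `|tau| / Num.sqrt n%:R.
  by rewrite normrM normfV (gtr0_norm r0).
rewrite abs_s.
have m2n : m.+1%:R <= 2 * n%:R :> R.
  by rewrite -natrM ler_nat; lia.
have h1 : (`|tau| / Num.sqrt n%:R) ^+ 3 * m.+1%:R <= 2 * `|tau| ^+ 3 / Num.sqrt n%:R.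
  have -> : 2 * `|tau| ^+ 3 / Num.sqrt n%:R = (`|tau| / Num.sqrt n%:R) ^+ 3 * (2 * n%:R).
    by rewrite -[X in _ = _ * (2 * X)]rN; field; rewrite gt_eqF.
  by rewrite ler_wpM2l // exprn_ge0 // divr_ge0.
have h2 : `|tau| / Num.sqrt n%:R * Num.sqrt m.+1%:R <= 2 * `|tau|.
  have -> : 2 * `|tau| = `|tau| / Num.sqrt n%:R * (2 * Num.sqrt n%:R).
    by field; rewrite gt_eqF.
  rewrite ler_wpM2l ?divr_ge0 // -[2 * _]ger0_norm ?mulr_ge0 // -sqrtr_sqr.
  by rewrite ler_wsqrtr // exprMn rN; move: m2n N0; lra.
have h3 : 1 + 2 * \sum_(k < m) k.+1%:R^-1 <= 9 * Num.sqrt (Num.sqrt n%:R) :> R.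
  have := harmonic_le R m.
  have : Num.sqrt (Num.sqrt m%:R) <= Num.sqrt (Num.sqrt n%:R) :> R.
    by rewrite !ler_wsqrtr // ler_nat.
  by move: q1; lra.
have S0 : 0 <= \sum_(k < m) k.+1%:R^-1 :> R by apply: sumr_ge0 => k _; rewrite invr_ge0.
have -> : C * (Num.sqrt (Num.sqrt n%:R))^-1 = 10 ^+ 9 * (2 * `|tau| ^+ 3 / Num.sqrt n%:R)
   * (1 + 2 * `|tau|) * (9 * Num.sqrt (Num.sqrt n%:R)).
  have -> : (Num.sqrt (Num.sqrt n%:R))^-1 = Num.sqrt (Num.sqrt n%:R) / Num.sqrt n%:R :> R.
    by rewrite -[X in _ = _ / X]q2; field; rewrite gt_eqF // (lt_le_trans _ q1).
  by rewrite /C; field; rewrite gt_eqF.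
have t0 := normr_ge0 tau.
apply: ler_pM => //; first by rewrite addr_ge0 // mulr_ge0.
apply: ler_pM.
- by rewrite !mulr_ge0 ?exprn_ge0 ?divr_ge0.
- by rewrite addr_ge0 // !mulr_ge0 // invr_ge0.
- by rewrite -mulrA ler_wpM2l // exprn_ge0.
- by rewrite lerD2l.
Unshelve. all: by end_near. Qed.

End CharacteristicLimit.

Lemma cos_lipschitz (R : realType) (x y : R) : `|cos y - cos x| <= `|y - x|.
Proof.
have [c _ ->] := MVT_min_max x y (@is_derive_cos R).
by rewrite normrM normrN ler_piMl // abs_sin_le1.
Qed.

Definition fringe_limits (R : realType) (M : random_tree) (pN : nat -> R)
    (beta : nat -> nat -> R) (P : set (tree M)) : Prop :=
  let X := fringe_count R P in
  let mu := mu_lim pN P in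
  let S := sigma2_partial pN beta P in
  let sigma2 := limn S in
  [/\ Ex (X n) / n%:R @[n --> \oo] --> mu,
      cvgn S,
      Var (X n) / n%:R @[n --> \oo] --> sigma2,
      cvg_in_law (fun n w => (X n w - Ex (X n)) / Num.sqrt n%:R)
        (centered_normal sigma2)
    & cvg_in_law (fun n w => (X n w - n%:R * mu) / Num.sqrt n%:R)
        (centered_normal sigma2)].

(* In law, [rtree n] is the image by [theta] of the random binary search tree with
   [n - o] nodes. *)
Section Model.
Variables (R : realType) (M : random_tree) (o : nat) (theta : bintree -> tree M).
Variables (pN : nat -> R) (beta : nat -> nat -> R).
Hypothesis o_le1 : (o <= 1)%N.
Hypothesis size_theta : forall T, tree_size (theta T) = (bt_size T + o)%N.
Hypothesis subtreesP : forall T : tree M, (0 < tree_size T)%N ->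
  exists2 s, perm_eq (subtrees T) (T :: s)
    & forall U, U \in s -> (0 < tree_size U < tree_size T)%N.
Hypothesis law : forall n (h : tree M -> R), (0 < n)%N ->
  Ex (fun w : sample M n => h (rtree n w)) = bstE (n - o) (fun T => h (theta T)).
Hypothesis pN_ge0 : forall k, 0 <= pN k.
Hypothesis pN_le : forall k, (0 < k)%N -> pN k <= 2 / (k * k.+1)%:R.

Definition fringe (P : set (tree M)) T : R := (count (mem P) (subtrees (theta T)))%:R.

Variable toll : set (tree M) -> bintree -> bintree -> R.
Hypothesis fringe_empty : forall P, `|fringe P BEmpty| <= 1.
Hypothesis fringe_node : forall P l r,
  fringe P (BNode l r) = fringe P l + fringe P r + toll P l r.
Hypothesis toll_le1 : forall P l r, `|toll P l r| <= 1.
Hypothesis fringe_mean : forall P n, (0 < n + o)%N ->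
  `|bstE n (fringe P) - n.+1%:R * \sum_(1 <= k < n + o) pN k * prop_prob R P k| <= 1.
Hypothesis fringe_variance : forall P N n, (0 < N)%N ->
  (forall T, P T -> (tree_size T <= N)%N) -> (2 * N.+1 <= n)%N ->
  variance (fringe P) n = n.+1%:R * sigma2_partial pN beta P N.

Variable P : set (tree M).
Let X := fringe_count R P.
Let mu := mu_lim pN P.
Let S := sigma2_partial pN beta P.

Lemma Ex_fringe n (g : R -> R) : (0 < n)%N ->
  Ex (fun w : sample M n => g (X w)) = bstE (n - o) (fun T => g (fringe P T)).
Proof. by move=> n0; rewrite -(law (fun U => g (count (mem P) (subtrees U))%:R)). Qed.

Lemma Var_fringe n : (0 < n)%N -> Var (@X n) = variance (fringe P) (n - o).
Proof.
move=> n0; rewrite /Var (Ex_fringe (fun x => (x - _) ^+ 2)) //.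
by rewrite (Ex_fringe id n0); apply: bstE_eq => T Tn; rewrite /centered Tn.
Qed.

Lemma prop_prob_ge0 k : 0 <= prop_prob R P k.
Proof. by rewrite divr_ge0 // sumr_ge0. Qed.

Lemma prop_prob_le1 k : prop_prob R P k <= 1.
Proof.
apply: (le_trans _ (@Ex_cst_le R (sample M k) 1 ler01)).
by apply: Ex_le => w; case: (_ \in _).
Qed.

Lemma mu_limE : mu = limn (fun n => \sum_(1 <= k < n) pN k * prop_prob R P k).
Proof.
congr (limn _); apply/funext => n; apply: eq_bigr => k _; congr (_ * (_ / _)).
by rewrite -sum1_card natr_sum big_mkcond; apply: eq_bigr => w _; rewrite inE; case: (_ \in _).
Qed.

(** The majorant 2 / (k (k+1)) of [pN] fits both size laws and telescopes. The rate 1/n is what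
    bounds the distance of the mean from [n * mu]. *)
Lemma mu_lim_rate n : `|\sum_(1 <= k < n.+1) pN k * prop_prob R P k - mu| <= 2 / n.+1%:R.
Proof.
pose u n := \sum_(1 <= k < n.+1) pN k * prop_prob R P k.
have [//|m|m hm] := @telescoping_bound R u (fun n => 2 / n.+1%:R).
  rewrite /u big_nat_recr //= addrAC subrr add0r.
  rewrite ger0_norm; last exact: mulr_ge0 (pN_ge0 _) (prop_prob_ge0 _).
  apply: (@le_trans _ _ (pN m.+1)); first by rewrite ler_piMr // prop_prob_le1.
  apply: le_trans (pN_le _) _ => //.
  rewrite [leLHS](_ : _ = 2 / m.+1%:R - 2 / m.+2%:R) //.
  by rewrite natrM; field; natnz.
suff -> : mu = m by exact: hm.
rewrite mu_limE; apply/cvg_lim => //; rewrite -cvg_shiftS.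
apply: (@cvg_dist_bound _ _ (fun n => 2 / n.+1%:R)); last by near=> k; exact: hm.
rewrite -[X in _ --> X](mulr0 2); apply: cvgM; first exact: cvg_cst.
exact: cvg_harmonic.
Unshelve. all: by end_near. Qed.

Lemma mean_rate n : (0 < n)%N -> `|Ex (@X n) - n%:R * mu| <= 5 + `|mu|.
Proof.
move=> n0; rewrite (Ex_fringe id n0).
have e : (n - o + o)%N = n by lia.
have := fringe_mean P (n := (n - o)%N); rewrite e => /(_ n0).
have := mu_lim_rate n.-1; rewrite prednK //.
set u := \sum_(1 <= k < n) _ => hu hm.
have N0 : 0 < n%:R :> R by rewrite ltr0n.
have N1 : (n - o).+1%:R <= 2 * n%:R :> R by rewrite -natrM ler_nat; lia.
have hu' : (n - o).+1%:R * `|u - mu| <= 4.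
  apply: (@le_trans _ _ (2 * n%:R * (2 / n%:R))); first by rewrite ler_pM.
  by rewrite mulrACA mulfV ?gt_eqF // mulr1; lra.
have h3 : `|(n - o).+1%:R - n%:R| <= 1 :> R.
  have [->|o0] := posnP o; first by rewrite subn0 -natr1 addrAC subrr add0r normr1.
  have -> : (n - o).+1 = n by lia.
  by rewrite subrr normr0.
have -> : bstE (n - o) (fun T => id (fringe P T)) - n%:R * mu =
   (bstE (n - o) (fringe P) - (n - o).+1%:R * u) + (n - o).+1%:R * (u - mu)
   + ((n - o).+1%:R - n%:R) * mu by ring.
apply: le_trans (ler_normD _ _) _; rewrite normrM; apply: lerD; last by rewrite ler_piMl.
apply: le_trans (ler_normD _ _) _; rewrite normrM normr_nat.
by move: hm hu'; lra.
Qed.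

Lemma mean_limit : Ex (@X n) / n%:R @[n --> \oo] --> mu.
Proof.
apply: (@cvg_dist_bound _ _ (fun n => (5 + `|mu|) * n%:R^-1)).
  rewrite -[X in _ --> X](mulr0 (5 + `|mu|)); apply: cvgM; first exact: cvg_cst.
  by apply/gtr0_cvgV0; [near=> n; rewrite ltr0n; near: n; exact: nbhs_infty_gt | exact: cvgr_idn].
near=> n.
have n0 : (0 < n)%N by near: n; exact: nbhs_infty_gt.
have N0 : 0 < n%:R :> R by rewrite ltr0n.
have -> : Ex (@X n) / n%:R - mu = (Ex (@X n) - n%:R * mu) / n%:R.
  by field; rewrite gt_eqF.
by rewrite normrM normfV normr_nat ler_wpM2r ?invr_ge0 ?mean_rate.
Unshelve. all: by end_near. Qed.

Lemma centering_limit :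
  (n%:R * mu - Ex (@X n)) / Num.sqrt n%:R @[n --> \oo] --> (0 : R).
Proof.
apply: (@cvg_dist_bound _ _ (fun n => (5 + `|mu|) * (Num.sqrt n%:R)^-1)).
  rewrite -[X in _ --> X](mulr0 (5 + `|mu|)); apply: cvgM; first exact: cvg_cst.
  exact: cvg_inv_sqrt.
near=> n.
have n0 : (0 < n)%N by near: n; exact: nbhs_infty_gt.
rewrite subr0 normrM normfV [X in _ / X]ger0_norm // ler_wpM2r ?invr_ge0 //.
by rewrite distrC mean_rate.
Unshelve. all: by end_near. Qed.

Lemma variance_rate_cvg (s2 : R) :
  (forall n, `|variance (fringe P) n - n.+1%:R * s2| <= 115 * 100 * Num.sqrt n.+1%:R) ->
  variance (fringe P) (n - o) / n%:R @[n --> \oo] --> s2.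
Proof.
move=> hs; pose C : R := 115 * 100 * 2 + `|s2|.
apply: (@cvg_dist_bound _ _ (fun n => C * (Num.sqrt n%:R)^-1)).
  by rewrite -[X in _ --> X](mulr0 C); apply: cvgM; [exact: cvg_cst | exact: cvg_inv_sqrt].
near=> n.
have n0 : (0 < n)%N by near: n; exact: nbhs_infty_gt.
have N0 : 0 < n%:R :> R by rewrite ltr0n.
have r1 : 1 <= Num.sqrt n%:R :> R by rewrite -[leLHS]sqrtr1 ler_wsqrtr // ler1n.
have rN : Num.sqrt n%:R ^+ 2 = n%:R :> R by rewrite sqr_sqrtr.
have N1 : Num.sqrt (n - o).+1%:R <= 2 * Num.sqrt n%:R :> R.
  rewrite -[2 * _]ger0_norm ?mulr_ge0 // -sqrtr_sqr ler_wsqrtr // exprMn rN.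
  by rewrite -natrX -natrM ler_nat; lia.
have h3 : `|(n - o).+1%:R - n%:R| <= 1 :> R.
  have [->|o0] := posnP o; first by rewrite subn0 -natr1 addrAC subrr add0r normr1.
  have -> : (n - o).+1 = n by lia.
  by rewrite subrr normr0.
have -> : C * (Num.sqrt n%:R)^-1 = C * Num.sqrt n%:R / n%:R.
  by rewrite -[X in _ = _ / X]rN; field; rewrite gt_eqF // (lt_le_trans _ r1).
have -> : variance (fringe P) (n - o) / n%:R - s2 =
   (variance (fringe P) (n - o) - (n - o).+1%:R * s2 + ((n - o).+1%:R - n%:R) * s2) / n%:R.
  by field; rewrite gt_eqF.
rewrite normrM normfV normr_nat ler_wpM2r ?invr_ge0 //.
apply: le_trans (ler_normD _ _) _; rewrite normrM.
have h4 : `|(n - o).+1%:R - n%:R| * `|s2| <= `|s2| by rewrite ler_piMl.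
have h5 : `|s2| <= `|s2| * Num.sqrt n%:R by rewrite ler_peMr.
by rewrite /C; move: (hs (n - o)%N) N1 h4 h5; lra.
Unshelve. all: by end_near. Qed.

Lemma variance_rate : exists2 s2 : R, 0 <= s2 & forall n,
  `|variance (fringe P) n - n.+1%:R * s2| <= 115 * 100 * Num.sqrt n.+1%:R.
Proof.
have [s2 h] := variance_linear (fringe_node P) (fringe_empty P) (toll_le1 P).
exists s2 => //; have lim := variance_rate_cvg h.
rewrite -(cvg_lim _ lim) //; apply: limr_ge; first by apply/cvg_ex; exists s2.
by apply: nearW => n; rewrite divr_ge0 ?variance_ge0.
Qed.

Let trunc N := P `&` [set T | (tree_size T <= N)%N].

Lemma variance_trunc N n : (0 < N)%N -> (n + o <= N)%N -> (0 < n + o)%N ->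
  variance (fringe (trunc N)) n = variance (fringe P) n.
Proof.
move=> N0 nN no0.
have e T : bt_size T = n -> fringe (trunc N) T = fringe P T.
  move=> Tn; have sT : tree_size (theta T) = (n + o)%N by rewrite size_theta Tn.
  have [|s sub sizes] := subtreesP (T := theta T); first by rewrite sT.
  rewrite /fringe !(seq.permP sub); congr (_%:R); apply: eq_in_count => U UT.
  have UN : (tree_size U <= N)%N.
    move: UT; rewrite inE => /predU1P[->|/sizes/andP[_ U_lt]]; first by rewrite sT.
    by apply: leq_trans nN; rewrite -sT ltnW.
  apply/idP/idP => /set_mem.
    by case=> PU _; apply/mem_set.
  by move=> PU; apply/mem_set; split.
by apply: bstE_eq => T Tn; rewrite /centered e // Tn (bstE_eq e).
Qed.

Lemma sigma2_partial_trunc N : sigma2_partial pN beta (trunc N) N = S N.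
Proof.
rewrite /S /sigma2_partial.
suff -> : [set T | trunc N T /\ (0 < tree_size T <= N)%N] =
  [set T | P T /\ (0 < tree_size T <= N)%N] by [].
apply/seteqP; split => T /=; first by case=> -[].
by case=> PT TN; split=> //; split=> //; case/andP: TN.
Qed.

(* Truncating the property at size [N] does not change the variance of the count
   in a tree with [N] nodes, where the two linear asymptotics can be compared. *)
Lemma sigma2_partial_rate (s2 : R) :
  (forall n, `|variance (fringe P) n - n.+1%:R * s2| <= 115 * 100 * Num.sqrt n.+1%:R) ->
  S @ \oo --> s2.
Proof.
move=> hs; pose C : R := 2 * (115 * 100).
apply: (@cvg_dist_bound _ _ (fun n => C * (Num.sqrt n%:R)^-1)).
  by rewrite -[X in _ --> X](mulr0 C); apply: cvgM; [exact: cvg_cst | exact: cvg_inv_sqrt].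
near=> N.
have N0 : (0 < N)%N by near: N; exact: nbhs_infty_gt.
have [s h] := variance_linear (fringe_node (trunc N)) (fringe_empty (trunc N)) (toll_le1 (trunc N)).
(* The truncated count has variance exactly (n+1) S N for large n, so the slope supplied by
   [variance_linear] must be S N. *)
have sE : S N = s.
  have exact_var n : (2 * N.+1 <= n)%N -> variance (fringe (trunc N)) n = n.+1%:R * S N.
    by move=> Nn; rewrite (@fringe_variance _ N) ?sigma2_partial_trunc // => T [].
  have cS : n.+1%:R * S N / n.+1%:R @[n --> \oo] --> S N.
    rewrite (_ : (fun _ => _) = fun=> S N); first exact: cvg_cst.
    by apply/funext => n; rewrite mulrC mulKf.
  suff cs : n.+1%:R * S N / n.+1%:R @[n --> \oo] --> s.
    by rewrite -(cvg_lim _ cS) // (cvg_lim _ cs).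
  rewrite (cvg_shiftS (fun n => n%:R * S N / n%:R)).
  apply: (@cvg_dist_bound _ _ (fun n => 115 * 100 * (Num.sqrt n%:R)^-1)).
    rewrite -[X in _ --> X](mulr0 (115 * 100 : R)); apply: cvgM; first exact: cvg_cst.
    exact: cvg_inv_sqrt.
  near=> n.
  have n0 : (2 * N.+1 < n)%N by near: n; exact: nbhs_infty_gt.
  have [m nm] : exists m, n = m.+1 by exists n.-1; lia.
  move: n0; rewrite nm => n0; have := h m; rewrite exact_var //.
  have r0 : 0 < Num.sqrt m.+1%:R :> R by rewrite sqrtr_gt0.
  have rN : Num.sqrt m.+1%:R ^+ 2 = m.+1%:R :> R by rewrite sqr_sqrtr.
  have -> : m.+1%:R * S N / m.+1%:R - s = (m.+1%:R * S N - m.+1%:R * s) / m.+1%:R by field; natnz.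
  move=> hn; rewrite normrM normfV normr_nat ler_pdivrMr //.
  by rewrite -[X in _ <= _ * X]rN expr2 mulrA mulfVK ?gt_eqF.
have := h (N - o)%N; have := hs (N - o)%N.
have e : (N - o + o)%N = N by lia.
rewrite variance_trunc ?e // -sE.
set v := variance _ _; set q := Num.sqrt _ => h1 h2.
have q0 : 0 < q by rewrite sqrtr_gt0.
have qN : q ^+ 2 = (N - o).+1%:R by rewrite sqr_sqrtr.
have h3 : (N - o).+1%:R * `|S N - s2| <= C * q.
  rewrite -[X in X * _]normr_nat -normrM.
  have -> : (N - o).+1%:R * (S N - s2) = (v - (N - o).+1%:R * s2) - (v - (N - o).+1%:R * S N) by ring.
  by apply: le_trans (ler_normB _ _) _; rewrite /C; move: h1 h2; lra.
have h4 : `|S N - s2| <= C / q.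
  rewrite ler_pdivlMr // -(ler_pM2l q0); move: h3; rewrite -qN; congr (_ <= _); ring.
apply: le_trans h4 _; rewrite ler_wpM2l ?/C // ?mulr_ge0 // lef_pV2 ?posrE ?sqrtr_gt0 ?ltr0n //.
by rewrite ler_wsqrtr // ler_nat; lia.
Unshelve. all: by end_near. Qed.

(** A centering within o(sqrt n) of the mean covers both limit laws: it shifts the cosine by a
    vanishing amount, since the cosine is 1-Lipschitz, and (y - d)^2 <= 2 y^2 + 2 d^2 gives the
    second-moment bound 2 (s2 + 1) + 2. *)
Lemma clt_recentered (s2 : R) (c : nat -> R) : 0 <= s2 ->
  variance (fringe P) (n - o) / n%:R @[n --> \oo] --> s2 ->
  (c n - Ex (@X n)) / Num.sqrt n%:R @[n --> \oo] --> (0 : R) ->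
  cvg_in_law (fun n w => (@X n w - c n) / Num.sqrt n%:R) (centered_normal s2).
Proof.
move=> s20 var_cvg c_cvg.
have XE n : Ex (@X n) = bstE (n - o) (fringe P) \/ n = 0%N.
  by case: n => [|n]; [right | left; rewrite -(Ex_fringe id)].
apply: (@levy_continuity _ _ _ _ _ (2 * (s2 + 1) + 2)) => [tau phase|].
  rewrite centered_normal_cos //.
  have lim := characteristic_limit (fringe_node P) (fringe_empty P) (toll_le1 P) var_cvg
    (tau := tau) (theta := phase).
  set u := fun n => Ex _; set g := fun n => bstE _ _ in lim.
  rewrite (_ : u = fun n => (u n - g n) + g n); last by apply/funext => n; rewrite subrK.
  rewrite -[X in _ --> X]add0r; apply: cvgD => //.
  apply: (@cvg_dist_bound _ _ (fun n => `|tau| * `|(c n - Ex (@X n)) / Num.sqrt n%:R|)).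
    rewrite -[X in _ --> X](mulr0 `|tau|); apply: cvgM; first exact: cvg_cst.
    by rewrite -(normr0 R); exact: cvg_norm.
  near=> n; have n0 : (0 < n)%N by near: n; exact: nbhs_infty_gt.
  rewrite subr0 /u /g (Ex_fringe (fun x => cos (tau * ((x - c n) / Num.sqrt n%:R) + phase)) n0).
  rewrite -bstEB -[leRHS](bstE_cst (n - o)); apply: bstE_norm_le => T Tn.
  apply: le_trans (cos_lipschitz _ _) _; rewrite -normrM le_eqVlt; apply/orP; left.
  rewrite distrC; apply/eqP; congr `|_|.
  by rewrite /centered Tn; case: (XE n) n0 => [->|->] // _; ring.
near=> n; have n0 : (0 < n)%N by near: n; exact: nbhs_infty_gt.
have N0 : 0 < n%:R :> R by rewrite ltr0n.
rewrite (Ex_fringe (fun x => ((x - c n) / Num.sqrt n%:R) ^+ 2) n0).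
have v1 : variance (fringe P) (n - o) / n%:R <= s2 + 1.
  by near: n; apply: (cvgr_le _ var_cvg); rewrite ltrDl.
have d1 : `|(c n - Ex (@X n)) / Num.sqrt n%:R| <= 1.
  near: n; have /cvgrPdist_le/(_ 1 ltr01) := c_cvg.
  by apply: filterS => n; rewrite sub0r normrN.
set d := (c n - Ex (@X n)) / Num.sqrt n%:R in d1 *.
have d2 : d ^+ 2 <= 1 by rewrite -real_normK ?num_real // expr_le1.
have rN : Num.sqrt n%:R ^+ 2 = n%:R :> R by rewrite sqr_sqrtr.
apply: (@le_trans _ _ (2 * (variance (fringe P) (n - o) / n%:R) + 2 * d ^+ 2)); last first.
  by move: v1 d2; lra.
rewrite /variance [_ / n%:R]mulrC -!bstEZ -[2 * d ^+ 2](bstE_cst (n - o)) -bstED.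
apply: bstE_le => T Tn.
have -> : (fringe P T - c n) / Num.sqrt n%:R = centered (fringe P) T / Num.sqrt n%:R - d.
  by rewrite /d /centered Tn; case: (XE n) n0 => [->|->] // _; ring.
set y := centered _ _.
have -> : n%:R^-1 * y ^+ 2 = (y / Num.sqrt n%:R) ^+ 2 by rewrite expr_div_n rN mulrC.
by have := sqr_ge0 (y / Num.sqrt n%:R + d); set z := y / _; nra.
Unshelve. all: by end_near. Qed.

Theorem model_limits : fringe_limits pN beta P.
Proof.
have [s2 s20 hs] := variance_rate.
have S_cvg := sigma2_partial_rate hs.
have v_cvg := variance_rate_cvg hs.
rewrite /fringe_limits (cvg_lim _ S_cvg) //; split.
- exact: mean_limit.
- exact: S_cvg.
- apply: cvg_trans v_cvg; apply: near_eq_cvg; near=> n.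
  by rewrite Var_fringe //; near: n; exact: nbhs_infty_gt.
- apply: clt_recentered => //.
  rewrite (_ : (fun _ => _) = fun=> 0); first exact: cvg_cst.
  by apply/funext => n; rewrite subrr mul0r.
- exact: clt_recentered v_cvg centering_limit.
Unshelve. all: by end_near. Qed.

End Model.

Lemma sum_nat_shift (R : realType) (f : nat -> R) N :
  \sum_(1 <= k < N.+1) f k = \sum_(j < N) f j.+1.
Proof. by rewrite big_add1 big_mkord. Qed.

Lemma sum_ord_nat1 (R : realType) (f : nat -> R) N : f 0%N = 0 ->
  \sum_(k < N) f k = \sum_(1 <= k < N) f k.
Proof.
move=> f0; case: N => [|N]; first by rewrite big_ord0 big_geq.
by rewrite -(big_mkord xpredT f) big_ltn // f0 add0r.
Qed.

Lemma norm_bstE_nat_of_bool (R : realType) n (p : pred bintree) :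
  `|bstE n (fun T => (p T)%:R) : R| <= 1.
Proof.
rewrite -[leRHS](bstE_cst n); apply: bstE_norm_le => T _.
by case: (p T); rewrite ?normr1 ?normr0.
Qed.

Section SizeFromLaw.
Variables (R : realType) (M : random_tree) (o : nat) (theta : bintree -> tree M).
Hypothesis o_le1 : (o <= 1)%N.
Hypothesis size_theta : forall T, tree_size (theta T) = (bt_size T + o)%N.
Hypothesis law : forall n (h : tree M -> R), (0 < n)%N ->
  Ex (fun w : sample M n => h (rtree n w)) = bstE (n - o) (fun T => h (theta T)).

(** Deduced from the law: the indicator of a wrong size has expectation 0, and a vanishing sum of
    nonnegative terms over a finite space vanishes at every sample. *)
Lemma size_rtree n (w : sample M n) : (0 < n)%N -> tree_size (rtree n w) = n.
Proof.
move=> n0; pose h (T : tree M) : R := (tree_size T != n)%:R.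
have Ex0 : Ex (fun w : sample M n => h (rtree n w)) = 0.
  rewrite law // -[RHS](bstE_cst (n - o)); apply: bstE_eq => T Tn.
  by rewrite /h size_theta Tn subnK ?eqxx // (leq_trans o_le1).
have sum0 : \sum_(w : sample M n) h (rtree n w) = 0.
  apply/eqP; move/eqP: Ex0; rewrite mulf_eq0 => /orP[//|].
  rewrite invr_eq0 pnatr_eq0 => /eqP card0.
  by have := fintype0 w card0.
have /psumr_eq0P/(_ w isT)/eqP := sum0.
by rewrite pnatr_eq0 eqb0 negbK => /(_ _)/eqP; apply => ? _.
Qed.

Lemma prop_probE P k : (0 < k)%N ->
  prop_prob R P k = bstE (k - o) (fun T => (theta T \in P)%:R).
Proof. exact: (law (fun T => (T \in P)%:R)). Qed.

Lemma prop_pairE P k : (0 < k)%N -> prop_pair R P k =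
  bstE (k - o) (fun T => (theta T \in P)%:R * (2 * fringe R theta P T - 1)).
Proof.
exact: (law (fun T => (T \in P)%:R * (2 * (count (mem P) (subtrees T))%:R - 1))).
Qed.

End SizeFromLaw.

(** * The random binary search tree *)

Section BinaryTrees.
Variable R : realType.

Lemma bst_beta_sym k m : bst_beta R k m = bst_beta R m k.
Proof.
rewrite /bst_beta; congr (_%:R / _%:R - _%:R / _%:R); lia.
Qed.

Lemma bt_subtrees_size T U : U \in bt_subtrees T -> (0 < bt_size U <= bt_size T)%N.
Proof.
elim: T => // l IHl r IHr /=; rewrite inE mem_cat => /predU1P[->|/orP[/IHl|/IHr]] //=; lia.
Qed.

Lemma bt_subtreesP (T : tree BST) : (0 < tree_size T)%N ->
  exists2 s, perm_eq (subtrees T) (T :: s)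
    & forall U, U \in s -> (0 < tree_size U < tree_size T)%N.
Proof.
case: T => // l r _; exists (bt_subtrees l ++ bt_subtrees r) => [|U]; first exact: perm_refl.
by rewrite mem_cat => /orP[/bt_subtrees_size|/bt_subtrees_size] /=; lia.
Qed.

Lemma finite_bintrees N : finite_set [set T | (bt_size T <= N)%N].
Proof.
elim: N => [|N IH].
  by apply: (@sub_finite_set _ _ [set BEmpty]) => [[]|] //; exact: finite_set1.
apply: (@sub_finite_set _ _ ([set BEmpty] `|`
    (fun lr => BNode lr.1 lr.2) @` ([set T | (bt_size T <= N)%N] `*` [set T | (bt_size T <= N)%N]))).
  case=> [|l r] /= s; first by left.
  by right; exists (l, r) => //=; split => /=; lia.
by rewrite finite_setU; split; [exact: finite_set1 | apply: finite_image; exact: finite_setX].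
Qed.

Let theta (T : bintree) : tree BST := T.

Let law n (h : tree BST -> R) : (0 < n)%N ->
  Ex (fun w : sample BST n => h (rtree n w)) = bstE (n - 0) (fun T => h (theta T)).
Proof. by rewrite subn0 => _; exact: Ex_bst. Qed.

Let size_theta T : tree_size (theta T) = (bt_size T + 0)%N.
Proof. by rewrite addn0. Qed.

Let phi (P : set (tree BST)) (T : bintree) : R := ((T : tree BST) \in P)%:R.

Lemma bst_fringe_node P l r : fringe R theta P (BNode l r) =
  fringe R theta P l + fringe R theta P r + phi P (BNode l r).
Proof. by rewrite /fringe /= count_cat !natrD addrC. Qed.

Theorem bst_limits P : @fringe_limits R BST (bst_pN R) (bst_beta R) P.
Proof.
apply: (@model_limits R BST 0 theta (bst_pN R) (bst_beta R) _ _ _ _ _ _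
  (fun Q l r => phi Q (BNode l r))) => //.
- exact: bt_subtreesP.
- by move=> k; rewrite divr_ge0.
- move=> k k0; rewrite ler_wpM2l // lef_pV2 ?posrE ?ltr0n ?muln_gt0 ?k0 // ler_nat; lia.
- by move=> Q; rewrite normr0.
- exact: bst_fringe_node.
- by move=> Q l r; rewrite /phi; case: (_ \in _); rewrite ?normr1 ?normr0.
- move=> Q n n0; rewrite (@bst_meanE R (phi Q)) //; last exact: bst_fringe_node.
  rewrite addn0 /= (_ : bst_series _ n = \sum_(1 <= k < n) bst_pN R k * prop_prob R Q k).
    rewrite addrK; case: {n0} n => [|n]; first by rewrite normr0.
    exact: norm_bstE_nat_of_bool.
  pose f k : R := bst_weight R k * (if k is 0 then 0 else bstE k (phi Q)).
  rewrite (_ : bst_series _ n = \sum_(k < n) f k) // sum_ord_nat1 /f ?mulr0 //.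
  apply: eq_big_nat => -[//|k] _.
  by rewrite (prop_probE law) // subn0.
- move=> Q N n N0 QN Nn.
  have phi_idem T : phi Q T ^+ 2 = phi Q T by rewrite /phi; case: (_ \in _); rewrite ?expr1n ?expr0n.
  have phi_large T : (N < bt_size T)%N -> phi Q T = 0.
    by move=> NT; rewrite /phi; case: (boolP (_ \in _)) => // /set_mem/QN; rewrite leqNgt NT.
  rewrite (bst_variance_exact phi_idem _ (bst_fringe_node Q) phi_large Nn) //; congr (_ * _).
  rewrite (sigma2_partialE (size_rtree (leq0n 1) size_theta law) bt_subtreesP finite_bintrees
    (bst_pN R) Q bst_beta_sym).
  pose f k : R := bst_weight R k *
    (if k is 0 then 0 else bstE k (fun T => phi Q T * (2 * fringe R theta Q T - 1))).
  pose p k : R := if k is 0 then 0 else bstE k (phi Q).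
  pose g a : R := \sum_(b < N.+1) bst_beta R a b * p a * p b.
  transitivity (\sum_(k < N.+1) f k - \sum_(a < N.+1) g a) => //.
  have g0 : g 0%N = 0 by rewrite /g big1 // => b _; rewrite mulr0 mul0r.
  rewrite !sum_ord_nat1 ?g0 ?/f ?mulr0 //.
  congr (_ - _); apply: eq_big_nat => -[//|k] _.
    by rewrite (prop_pairE law) // subn0.
  rewrite /g (sum_ord_nat1 (f := fun b => bst_beta R k.+1 b * p k.+1 * p b)) ?mulr0 //.
  apply: eq_big_nat => -[//|b] _.
  by rewrite !(prop_probE law).
Qed.

End BinaryTrees.

(** * Random recursive trees, ordered and unordered *)

Section RecursiveTrees.
Variables (R : realType) (M : random_tree) (theta : bintree -> tree M).
Hypothesis size_theta : forall T, tree_size (theta T) = (bt_size T + 1)%N.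
Hypothesis subtreesP : forall T : tree M, (0 < tree_size T)%N ->
  exists2 s, perm_eq (subtrees T) (T :: s)
    & forall U, U \in s -> (0 < tree_size U < tree_size T)%N.
Hypothesis finite_size : forall N, finite_set [set T : tree M | (tree_size T <= N)%N].
Hypothesis law : forall n (h : tree M -> R), (0 < n)%N ->
  Ex (fun w : sample M n => h (rtree n w)) = bstE (n - 1) (fun T => h (theta T)).
Let phi (P : set (tree M)) (T : bintree) : R := (theta T \in P)%:R.
Hypothesis fringe_empty : forall P, fringe R theta P BEmpty = phi P BEmpty.
Hypothesis fringe_node : forall P l r, fringe R theta P (BNode l r) =
  fringe R theta P l + fringe R theta P r + (phi P (BNode l r) - phi P r).

Lemma rrt_beta_sym k m : rrt_beta R k m = rrt_beta R m k.
Proof. rewrite /rrt_beta; congr (_%:R / _%:R); lia. Qed.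

Lemma rrt_limits (P : set (tree M)) : fringe_limits (rrt_pN R) (rrt_beta R) P.
Proof.
apply: (@model_limits R M 1 theta (rrt_pN R) (rrt_beta R) _ _ _ _ _ _
  (fun Q l r => phi Q (BNode l r) - phi Q r)) => //.
- by move=> k; rewrite divr_ge0.
- by move=> k k0; rewrite ler_wpM2r ?invr_ge0 // ler1n.
- by move=> Q; rewrite fringe_empty /phi; case: (_ \in _); rewrite ?normr1 ?normr0.
- by move=> Q l r; rewrite /phi; do 2 case: (_ \in _);
    rewrite ?subrr ?subr0 ?sub0r ?normrN ?normr1 ?normr0.
- move=> Q n _; rewrite (rrt_meanE _ (fringe_empty Q) (fringe_node Q)) addn1.
  rewrite sum_nat_shift.
  have -> : \sum_(j < n) rrt_pN R j.+1 * prop_prob R Q j.+1 =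
      \sum_(k < n) (k.+1 * k.+2)%:R^-1 * bstE k (phi Q).
    by apply: eq_bigr => k _; rewrite (prop_probE law) // subn1 /rrt_pN mul1r.
  by rewrite addrK; exact: norm_bstE_nat_of_bool.
- move=> Q N n N0 QN Nn.
  have phi_idem T : phi Q T ^+ 2 = phi Q T by rewrite /phi; case: (_ \in _); rewrite ?expr1n ?expr0n.
  have phi_large T : (N <= bt_size T)%N -> phi Q T = 0.
    move=> NT; rewrite /phi; case: (boolP (_ \in _)) => // /set_mem/QN.
    by rewrite size_theta addn1 leqNgt ltnS NT.
  rewrite (rrt_variance_exact phi_idem (fringe_empty Q) (fringe_node Q) phi_large) //; last by lia.
  congr (_ * _).
  rewrite (sigma2_partialE (size_rtree (leqnn 1) size_theta law) subtreesP finite_size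
    (rrt_pN R) Q rrt_beta_sym).
  rewrite !sum_nat_shift; congr (_ - _); apply: eq_bigr => k _.
    by rewrite (prop_pairE law) // subn1 /rrt_pN mul1r.
  rewrite sum_nat_shift; apply: eq_bigr => b _.
  by rewrite !(prop_probE law) // !subn1.
Qed.

End RecursiveTrees.

Lemma Ex_rrt_tree (R : realType) n (h : otree -> R) : (0 < n)%N ->
  Ex (fun f : rrt_choices n => h (rrt f)) = bstE (n - 1) (fun T => h (rotation T)).
Proof. by case: n => // n _; rewrite subn1; exact: Ex_rrt. Qed.

Lemma ot_size_children t : ot_size t = (sumn (map ot_size (children t))).+1.
Proof. by case: t. Qed.

Lemma ot_size_rotation T : ot_size (rotation T) = (bt_size T + 1)%N.
Proof.
elim: T => //= l IHl r IHr.
by move: IHr; rewrite IHl ot_size_children; lia.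
Qed.

(** Transfers to ordered trees the finiteness of the set of binary trees of bounded size. *)
Lemma rotation_surj t : exists T, rotation T = t.
Proof.
suff forest s : exists T, children (rotation T) = s.
  by case: t => s; have [T <-] := forest s; exists T; case: (rotation T).
have [n] := ubnP (sumn (map ot_size s)); elim: n s => // n IH [_|[u] s]; first by exists BEmpty.
rewrite /= addSn !ltnS => us.
have [|l lu] := IH u; first exact: leq_ltn_trans (leq_addr _ _) us.
have [|r rs] := IH s; first exact: leq_ltn_trans (leq_addl _ _) us.
exists (BNode l r) => /=; rewrite rs -lu; case: (rotation l) => //.
Qed.

Lemma finite_otrees N : finite_set [set t | (ot_size t <= N)%N].
Proof.
apply: (@sub_finite_set _ _ (rotation @` [set T | (bt_size T <= N)%N])).
  move=> t /= tN; have [T Tt] := rotation_surj t; exists T => //=.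
  by move: tN; rewrite -Tt ot_size_rotation addn1 => /ltnW.
exact/finite_image/finite_bintrees.
Qed.

Lemma ot_size_gt0 t : (0 < ot_size t)%N. Proof. by case: t. Qed.

Lemma ot_subtrees_size t u : u \in ot_subtrees t -> (ot_size u <= ot_size t)%N.
Proof.
elim/otree_ind_in: t => s IH /=; rewrite inE => /predU1P[-> //|].
case/flattenP=> _ /mapP[v vs ->] /(IH v vs) uv; apply: leq_trans uv (leqW _).
by rewrite (perm_sumn (perm_map _ (perm_to_rem vs))) /= leq_addr.
Qed.

Lemma ot_subtreesP t : exists2 s, ot_subtrees t = t :: s
  & forall u, u \in s -> (0 < ot_size u < ot_size t)%N.
Proof.
case: t => s; exists (flatten (map ot_subtrees s)) => // u.
case/flattenP=> _ /mapP[v vs ->] /ot_subtrees_size uv; rewrite ot_size_gt0 /= ltnS.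
by apply: leq_trans uv _; rewrite (perm_sumn (perm_map _ (perm_to_rem vs))) /= leq_addr.
Qed.

(** Joining the first child to the rest replaces the root of [rotation r] by a larger one, so its
    indicator is traded for that of the new root. *)
Lemma count_subtrees_rotation (R : realType) (p : pred otree) l r :
  (count p (ot_subtrees (rotation (BNode l r))))%:R =
  (count p (ot_subtrees (rotation l)))%:R + (count p (ot_subtrees (rotation r)))%:R
  + ((p (rotation (BNode l r)))%:R - (p (rotation r))%:R) :> R.
Proof.
apply/eqP; rewrite addrA eq_sym subr_eq -!natrD eqr_nat; apply/eqP.
by rewrite /= count_cat; case: (rotation r) => s /=; lia.
Qed.

Section Instances.
Variable R : realType.

Lemma ordered_rrt_limits P : @fringe_limits R ordered_RRT (rrt_pN R) (rrt_beta R) P.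
Proof.
apply: (@rrt_limits R ordered_RRT rotation).
- exact: ot_size_rotation.
- by move=> t _; have [s e h] := ot_subtreesP t; exists s => //; rewrite [subtrees t]e.
- exact: finite_otrees.
- move=> n h n0; exact: Ex_rrt_tree.
- by move=> Q; rewrite /fringe /= addn0.
- by move=> Q l r; exact: count_subtrees_rotation.
Qed.

(** A property of unordered trees is pulled back along [utree_of] to an isomorphism-invariant
    property of ordered trees with the same fringe count. *)
Lemma unordered_rrt_limits P : @fringe_limits R unordered_RRT (rrt_pN R) (rrt_beta R) P.
Proof.
have countE (Q : set utree) t : count (mem Q) (ut_subtrees (utree_of t)) =
    count (fun u => utree_of u \in Q) (ot_subtrees t).
  by rewrite (seq.permP (ut_subtreesE t)) count_map; apply: eq_count.
apply: (@rrt_limits R unordered_RRT (fun T => utree_of (rotation T))).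
- by move=> T; rewrite /= ut_sizeE ot_size_rotation.
- move=> t _; have [s e h] := ot_subtreesP (generic_quotient.repr (t : utree)).
  exists (map utree_of s); first by rewrite /= /ut_subtrees e /= /utree_of generic_quotient.reprK.
  by move=> _ /mapP[u us ->]; rewrite /= ut_sizeE h.
- move=> N; apply: (@sub_finite_set _ _ (utree_of @` [set t | (ot_size t <= N)%N])).
    by move=> t /= tN; exists (generic_quotient.repr (t : utree)) => //; rewrite /utree_of generic_quotient.reprK.
  exact/finite_image/finite_otrees.
- by move=> n h n0; exact: (Ex_rrt_tree (fun t => h (utree_of t)) n0).
- by move=> Q; rewrite /fringe [subtrees _]/= countE /= addn0.
- move=> Q l r; rewrite /fringe [subtrees]/= !countE.
  exact: (count_subtrees_rotation R (fun u => utree_of u \in Q)).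
Qed.

End Instances.
Theorem corollary1p24 (R : realType) :
  [/\ forall P : set (tree BST),
        let X := fringe_count R P in
        let mu := mu_lim (bst_pN R) P in
        let S := sigma2_partial (bst_pN R) (bst_beta R) P in
        let sigma2 := limn S in
        [/\ Ex (X n) / n%:R @[n --> \oo] --> mu,
            cvgn S,
            Var (X n) / n%:R @[n --> \oo] --> sigma2,
            cvg_in_law (fun n w => (X n w - Ex (X n)) / Num.sqrt n%:R)
              (centered_normal sigma2)
          & cvg_in_law (fun n w => (X n w - n%:R * mu) / Num.sqrt n%:R)
              (centered_normal sigma2)],
      forall P : set (tree ordered_RRT),
        let X := fringe_count R P in
        let mu := mu_lim (rrt_pN R) P in
        let S := sigma2_partial (rrt_pN R) (rrt_beta R) P in
        let sigma2 := limn S in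
        [/\ Ex (X n) / n%:R @[n --> \oo] --> mu,
            cvgn S,
            Var (X n) / n%:R @[n --> \oo] --> sigma2,
            cvg_in_law (fun n w => (X n w - Ex (X n)) / Num.sqrt n%:R)
              (centered_normal sigma2)
          & cvg_in_law (fun n w => (X n w - n%:R * mu) / Num.sqrt n%:R)
              (centered_normal sigma2)]
    & forall P : set (tree unordered_RRT),
        let X := fringe_count R P in
        let mu := mu_lim (rrt_pN R) P in
        let S := sigma2_partial (rrt_pN R) (rrt_beta R) P in
        let sigma2 := limn S in
        [/\ Ex (X n) / n%:R @[n --> \oo] --> mu,
            cvgn S,
            Var (X n) / n%:R @[n --> \oo] --> sigma2,
            cvg_in_law (fun n w => (X n w - Ex (X n)) / Num.sqrt n%:R)
              (centered_normal sigma2)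
          & cvg_in_law (fun n w => (X n w - n%:R * mu) / Num.sqrt n%:R)
              (centered_normal sigma2)]].

Proof.
split=> P.
- exact: bst_limits.
- exact: ordered_rrt_limits.
- exact: unordered_rrt_limits.
Qed.
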